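(* Let $\mathcal G$ be a connected metric graph and $N\ge1$. The following two definitions of the space $H^1(\mathbb R^N\times\mathcal G)$ are equivalent, i.e. they define the same set of functions $u$ on $\mathbb R^N\times\mathcal G$. Definition A (edgewise): (i) $u\in L^2(\mathbb R^N\times\mathcal G)$; (ii) $u_e\in H^1(\mathbb R^N\times e)$ for every edge $e$; (iii) $\sum_e\|u_e\|_{H^1(\mathbb R^N\times e)}^2<+\infty$; (iv) for all edges $e_1,e_2$ meeting at a vertex $v$, $T_{\mathbb R^N\times\{v\}}(u_{e_1})=T_{\mathbb R^N\times\{v\}}(u_{e_2})$, where $T_{\mathbb R^N\times\{v\}}:H^1(\mathbb R^N\times e)\to L^2(\mathbb R^N\times\{v\})\simeq L^2(\mathbb R^N)$ is the trace operator. Definition B (fiberwise): (i) $u(\cdot,y)\in H^1(\mathbb R^N)$ for a.e. $y\in\mathcal G$; (ii) $\int_{\mathcal G}\|u(\cdot,y)\|_{H^1(\mathbb R^N)}^2\,dy<+\infty$; (iii) $u(x,\cdot)\in H^1(\mathcal G)$ for a.e. $x\in\mathbb R^N$; (iv) $\int_{\mathbb R^N}\|u(x,\cdot)\|_{H^1(\mathcal G)}^2\,dx<+\infty$.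
   Context: A metric graph $\mathcal G$ is given by (at most countable) sets of edges $\mathfrak E$ and vertices $\mathcal V$; each edge $e$ has a length $\ell_e\in(0,+\infty]$ and is identified with $[0,\ell_e]$ if $\ell_e<\infty$ (endpoints glued at vertices, self-loops allowed) or with $[0,+\infty)$ if $\ell_e=\infty$ (with $0$ glued at a vertex). Functions $w$ on $\mathcal G$ are families $\{w_e\}_{e\in\mathfrak E}$; $H^1(\mathcal G)$ is the set of $w$ with $w_e\in H^1(e)$ for every $e$, $\|w\|_{H^1(\mathcal G)}^2=\sum_e\|w_e\|_{H^1(e)}^2<\infty$, and $w$ continuous at every vertex. A function $u$ on $\mathbb R^N\times\mathcal G$ is a family $\{u_e\}$ with $u_e$ defined on $\mathbb R^N\times e\subset\mathbb R^{N+1}$ (with Lebesgue measure), and $\|u\|_{L^2(\mathbb R^N\times\mathcal G)}^2=\sum_e\|u_e\|_{L^2(\mathbb R^N\times e)}^2$. Functions are real-valued, measurable, and identified when they agree almost everywhere (conditions on slices are understood for a suitable representative). *)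

(* Defs.v *)
From HB Require Import structures.
From mathcomp Require Import all_boot all_order all_algebra.
From mathcomp Require Import all_classical all_reals all_analysis.
From Stdlib Require Import Relation_Operators.

Set Implicit Arguments.
Unset Strict Implicit.
Unset Printing Implicit Defensive.

Import Order.TTheory GRing.Theory Num.Theory.
Import numFieldNormedType.Exports.

Local Open Scope classical_set_scope.
Local Open Scope ring_scope.

(* Product sigma-algebra on matrices, i.e. the one generated by the entries. *)

Definition matrix_display : measure_display -> measure_display.
Proof. exact. Qed.

Section measurable_matrix.
Context {d : measure_display} {T : measurableType d} {m n : nat}.

Definition matrix_measurable : set (set 'M[T]_(m, n)) :=
  <<s \bigcup_(ij in [set: 'I_m * 'I_n])
        preimage_set_system setT (fun M : 'M[T]_(m, n) => M ij.1 ij.2)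
          measurable >>.

Let matrix_set0 : matrix_measurable set0.
Proof. exact: sigma_algebra0. Qed.

Let matrix_setC A : matrix_measurable A -> matrix_measurable (~` A).
Proof. exact: sigma_algebraC. Qed.

Let matrix_bigcup (F : (set 'M[T]_(m, n))^nat) :
  (forall i, matrix_measurable (F i)) -> matrix_measurable (\bigcup_i F i).
Proof. exact: sigma_algebra_bigcup. Qed.

HB.instance Definition _ := @isMeasurable.Build (matrix_display d)
  'M[T]_(m, n) matrix_measurable matrix_set0 matrix_setC matrix_bigcup.

Lemma measurable_matrix_entry (i : 'I_m) (j : 'I_n) :
  measurable_fun [set: 'M[T]_(m, n)] (fun M : 'M[T]_(m, n) => M i j).
Proof.
move=> _ Y mY; apply: sub_sigma_algebra.
by exists (i, j) => //; exists Y.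
Qed.

Lemma measurable_fun_matrix d' (S : measurableType d')
    (f : S -> 'M[T]_(m, n)) :
  (forall i j, measurable_fun [set: S] (fun x => f x i j)) ->
  measurable_fun [set: S] f.
Proof.
move=> mf _ Y mY; rewrite setTI.
have: matrix_measurable `<=` [set A | measurable (f @^-1` A)].
  apply: smallest_sub.
    split => /=; first by rewrite preimage_set0.
      by move=> A mA; rewrite setTD preimage_setC; exact: measurableC.
    by move=> F mF; rewrite preimage_bigcup; exact: bigcupT_measurable.
  move=> _ [[i j] _ [A mA <-]] /=; rewrite setTI.
  by have := mf i j measurableT A mA; rewrite setTI.
exact.
Qed.

End measurable_matrix.

(* Lebesgue measure on R^n, by recursion: the image of
   lebesgue_measure \x (Lebesgue measure on R^n) under (x, v) |-> row_mx x v *)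

Section lebesgue_rV.
Context {R : realType}.

Definition rV_cons n (p : measurableTypeR R * 'rV[R]_n) : 'rV[R]_n.+1 :=
  \row_(i < n.+1) oapp (p.2 ord0) p.1 (unlift ord0 i).

Lemma measurable_rV_cons n : measurable_fun setT (@rV_cons n).
Proof.
apply: measurable_fun_matrix => i j.
under eq_fun do rewrite mxE.
case: unliftP => [k _|_] /=; last exact: measurable_fst.
exact: (measurableT_comp (measurable_matrix_entry ord0 k) measurable_snd).
Qed.

Definition rV_uncons n (v : 'rV[R]_n.+1) : measurableTypeR R * 'rV[R]_n :=
  (v ord0 ord0, \row_(i < n) v ord0 (lift ord0 i)).

Lemma rV_consK n : cancel (@rV_cons n) (@rV_uncons n).
Proof.
case=> x v; rewrite /rV_uncons !mxE unlift_none /=; congr pair.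
by apply/rowP => i; rewrite !mxE liftK.
Qed.

Lemma rV_unconsK n : cancel (@rV_uncons n) (@rV_cons n).
Proof.
move=> v; apply/rowP => i; rewrite mxE.
by case: unliftP => [k ->|->] /=; rewrite ?mxE.
Qed.

Lemma measurable_rV_uncons n : measurable_fun setT (@rV_uncons n).
Proof.
apply: measurable_fun_pair; first exact: measurable_matrix_entry.
apply: measurable_fun_matrix => i j; under eq_fun do rewrite mxE.
exact: measurable_matrix_entry.
Qed.

Section step.
Context (n : nat) (mu : {sigma_finite_measure set 'rV[R]_n -> \bar R}).

Definition lebesgue_rV_step : set 'rV[R]_n.+1 -> \bar R :=
  pushforward (lebesgue_measure \x mu)%E (@rV_cons n).

Let image_measure : {measure set 'rV[R]_n.+1 -> \bar R} :=
  measure_function_pushforward__canonical__measure_function_Measure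
    (lebesgue_measure \x mu)%E (@measurable_rV_cons n).

HB.instance Definition _ := isMeasure.Build _ _ _ lebesgue_rV_step
  (measure0 image_measure) (@measure_ge0 _ _ _ image_measure)
  (@measure_semi_sigma_additive _ _ _ image_measure).

Let lebesgue_rV_step_sigma_finite : sigma_finite setT lebesgue_rV_step.
Proof.
have /sigma_finiteP[F [TF ndF Foo]] := sigma_finiteT (@lebesgue_measure R).
have /sigma_finiteP[G [TG ndG Goo]] := sigma_finiteT mu.
exists (fun k => @rV_uncons n @^-1` (F k `*` G k)).
  rewrite -preimage_bigcup -[LHS](@preimage_setT _ _ (@rV_uncons n)).
  congr (_ @^-1` _); rewrite -setXTT TF TG predeqE => -[x y]; split.
    move=> [/= [k _ Fkx] [l _ Gly]]; exists (maxn k l) => //; split.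
    - by move: x Fkx; exact/subsetPset/ndF/leq_maxl.
    - by move: y Gly; exact/subsetPset/ndG/leq_maxr.
  by move=> [k _ []/= ? ?]; split; exists k.
move=> k; have [mF ?] := Foo k; have [mG ?] := Goo k; split.
  by rewrite -[X in measurable X]setTI; apply: measurable_rV_uncons => //;
    exact: measurableX.
rewrite /lebesgue_rV_step /pushforward -comp_preimage.
rewrite (_ : _ \o _ = id) ?preimage_id.
  by rewrite product_measure1E// lte_mul_pinfty// ge0_fin_numE.
by apply/funext => p /=; rewrite rV_consK.
Qed.

HB.instance Definition _ := Measure_isSigmaFinite.Build _ _ _
  lebesgue_rV_step lebesgue_rV_step_sigma_finite.

End step.

Fixpoint lebesgue_rV n : {sigma_finite_measure set 'rV[R]_n -> \bar R} :=
  match n with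
  | 0 => \d_(0 : 'rV[R]_0)
  | n.+1 => lebesgue_rV_step (lebesgue_rV n)
  end.

Definition rV_box n (a b : 'I_n -> R) : set 'rV[R]_n :=
  [set v | forall i, v ord0 i \in `[a i, b i]].

Lemma measurable_rV_box n (a b : 'I_n -> R) : measurable (rV_box a b).
Proof.
rewrite (_ : rV_box a b = \bigcap_(i in [set: 'I_n])
  ((fun v : 'rV[R]_n => v ord0 i) @^-1` [set` `[a i, b i]])).
  apply: fin_bigcap_measurable => // i _; rewrite -[X in measurable X]setTI.
  by apply: measurable_matrix_entry => //; exact: measurable_itv.
by apply/seteqP; split => [v ab i _|v ab i]; [exact: ab|exact: (ab i Logic.I)].
Qed.

Lemma lebesgue_rV_box n (a b : 'I_n -> R) : (forall i, a i <= b i) ->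
  lebesgue_rV n (rV_box a b) = (\prod_(i < n) (b i - a i))%:E.
Proof.
elim: n a b => [|n IHn] a b ab.
  rewrite big_ord0 /= diracE mem_set//; by case.
pose a' i := a (lift ord0 i); pose b' i := b (lift ord0 i).
rewrite big_ord_recl EFinM -[X in (_ * X)%E](IHn a' b'); last by move=> i; exact: ab.
rewrite /= /lebesgue_rV_step /pushforward.
rewrite (_ : _ @^-1` _ = [set` `[a ord0, b ord0]] `*` rV_box a' b').
  rewrite product_measure1E//; last exact: measurable_rV_box.
  congr (_ * _)%E; transitivity (lebesgue_measure [set` `[a ord0, b ord0]]) => //.
  rewrite lebesgue_measure_itv /= lte_fin; case: ltP => [_|ba].
    by rewrite EFinB.
  by rewrite (_ : a ord0 = b ord0) ?subrr//; apply/le_anti; rewrite ab ba.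
apply/seteqP; split => -[x v] /=.
  move=> H; split; first by have := H ord0; rewrite mxE unlift_none.
  by move=> i; have := H (lift ord0 i); rewrite mxE liftK.
move=> [xab vab] i; rewrite mxE; case: unliftP => [k ->|->] //=; exact: vab.
Qed.
End lebesgue_rV.

(* Types carrying both a norm and a sigma-algebra: measurableTypeR R (the real
   line with its Borel sets), 'rV[R]_n, and their products. *)

#[short(type="measurableNormedModType")]
HB.structure Definition MeasurableNormedModule d (R : numDomainType) :=
  {T of Measurable d T & NormedModule R T}.

HB.instance Definition _ (R : realType) := Measurable.copy (measurableTypeR R)
  (g_sigma_algebraType R.-ocitv.-measurable).
HB.instance Definition _ (R : realType) :=
  NormedModule.copy (measurableTypeR R) R^o.
HB.instance Definition _ (R : realType) n := Measurable.on 'rV[R]_n.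
HB.instance Definition _ (R : realType) (d1 d2 : measure_display)
  (V : measurableNormedModType d1 R) (W : measurableNormedModType d2 R) :=
  Measurable.on (V * W)%type.

(* H^1(Omega) for an open set Omega of V, with respect to the measure mu; the
   gradient is taken along the vectors of dirs (the canonical basis). Functions
   are total and only their values on Omega matter. *)

Section sobolev.
Context {R : realType} {d : measure_display} {V : measurableNormedModType d R}.
Variables (mu : {measure set V -> \bar R}) (dirs : seq V).
Implicit Types (Omega : set V) (f g u phi : V -> R).

Definition L2sq Omega f : \bar R := (\int[mu]_(z in Omega) ((f z) ^+ 2)%:E)%E.

Definition L2 Omega f : Prop :=
  measurable_fun Omega f /\ (L2sq Omega f < +oo)%E.

Definition iter_derive (vs : seq V) phi : V -> R :=
  foldr (fun v psi => fun x => 'D_v psi x) phi vs.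

Definition smooth phi : Prop := forall vs : seq V,
  continuous (iter_derive vs phi) /\
  forall x v, derivable (iter_derive vs phi) x v.

Definition test_function Omega phi : Prop :=
  smooth phi /\
  exists K : set V, [/\ compact K, K `<=` Omega & forall x, ~ K x -> phi x = 0].

Definition weak_derivative Omega (v : V) u g : Prop :=
  forall phi, test_function Omega phi ->
    (\int[mu]_(z in Omega) (u z * 'D_v phi z)%:E =
     - \int[mu]_(z in Omega) (g z * phi z)%:E)%E.

Definition H1 Omega u : Prop :=
  L2 Omega u /\
  forall v, v \in dirs -> exists g, L2 Omega g /\ weak_derivative Omega v u g.

(* The weak derivative of u along v, defined up to null sets; 0 if u has no
   square-integrable one. *)
Definition wderive Omega (v : V) u : V -> R :=
  xget (fun=> 0) [set g | L2 Omega g /\ weak_derivative Omega v u g].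

Definition H1sq Omega u : \bar R :=
  (L2sq Omega u + \sum_(v <- dirs) L2sq Omega (wderive Omega v u))%E.

End sobolev.

Section euclidean_spaces.
Context {R : realType}.

Definition dirs_R : seq (measurableTypeR R) := [:: (1 : R)].

Definition dirs_rV N : seq 'rV[R]_N := [seq delta_mx 0 i | i : 'I_N].

Definition dirs_prod N : seq ('rV[R]_N * measurableTypeR R) :=
  [seq (v, 0 : R) | v <- dirs_rV N] ++ [:: (0, 1 : R)].

Definition lebesgue_prod N :
    {measure set ('rV[R]_N * measurableTypeR R) -> \bar R} :=
  (lebesgue_rV N \x lebesgue_measure)%E.

End euclidean_spaces.

(* The edge e is parametrized by [0, len e], or [0, +oo[ if len e = +oo. The
   point 0 is glued at the vertex esrc e; if len e is finite, the point len e is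
   glued at the vertex v such that etgt e = Some v. *)
Record metric_graph (R : realType) := MetricGraph {
  edge : countType;
  vertex : countType;
  len : edge -> \bar R;
  esrc : edge -> vertex;
  etgt : edge -> option vertex;
  len_gt0 : forall e, (0 < len e)%E;
  etgtE : forall e, (etgt e = None) <-> (len e = +oo%E)
}.

Section graph.
Context {R : realType} (G : metric_graph R).
Implicit Types (e : edge G) (v : vertex G) (p : R).

Definition edge_closed e : set R := [set y : R | 0 <= y /\ (y%:E <= len e)%E].

Definition edge_open e : set R := [set y : R | 0 < y /\ (y%:E < len e)%E].

Definition glued e p v : Prop :=
  (p = 0 /\ esrc e = v) \/ (p%:E = len e /\ etgt e = Some v).

Definition adjacent v1 v2 : Prop :=
  exists e p1 p2, glued e p1 v1 /\ glued e p2 v2.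

Definition connected_graph : Prop :=
  forall v1 v2, clos_refl_trans (vertex G) adjacent v1 v2.

Definition H1sq_edge e (w : R -> R) : \bar R :=
  H1sq (V := measurableTypeR R) lebesgue_measure dirs_R (edge_open e) w.

Definition H1sq_graph (w : edge G -> R -> R) : \bar R :=
  (\esum_(e in [set: edge G]) H1sq_edge e (w e))%E.

Definition continuous_graph (w : edge G -> R -> R) : Prop :=
  (forall e, {within edge_closed e, continuous (w e)}) /\
  (forall e1 e2 p1 p2 v, glued e1 p1 v -> glued e2 p2 v -> w e1 p1 = w e2 p2).

(* Since functions are identified almost everywhere, continuity is a property
   of the continuous representative. *)
Definition H1_graph (w : edge G -> R -> R) : Prop :=
  [/\ forall e, H1 (V := measurableTypeR R) lebesgue_measure dirs_R
        (edge_open e) (w e),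
      (H1sq_graph w < +oo)%E &
      exists2 wc : edge G -> R -> R, continuous_graph wc &
        forall e, {ae lebesgue_measure,
          forall y, edge_open e y -> wc e y = w e y}].

End graph.

Section product.
Context {R : realType} (G : metric_graph R) (N : nat).
Local Notation RN := 'rV[R]_N.
Local Notation RN1 := (RN * measurableTypeR R)%type.
Implicit Types (e : edge G) (p : R) (u : edge G -> RN1 -> R).

Definition cyl_open e : set RN1 := [set: RN] `*` edge_open e.

Definition cyl_closed e : set RN1 := [set: RN] `*` edge_closed e.

Definition H1_cyl e (f : RN1 -> R) : Prop :=
  H1 (lebesgue_prod N) (dirs_prod N) (cyl_open e) f.

Definition H1sq_cyl e (f : RN1 -> R) : \bar R :=
  H1sq (lebesgue_prod N) (dirs_prod N) (cyl_open e) f.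

(* T is the bounded linear operator from H^1(R^N x e) to L^2(R^N) which maps
   every f in H^1 that is continuous up to the boundary to f(., p). *)
Definition is_trace_operator e p (T : (RN1 -> R) -> RN -> R) : Prop :=
  [/\ forall f, H1_cyl e f -> L2 (lebesgue_rV N) setT (T f),
      forall (a : R) f g, H1_cyl e f -> H1_cyl e g ->
        {ae lebesgue_rV N,
          forall x, T (fun z => a * f z + g z) x = a * T f x + T g x},
      exists C : R, forall f, H1_cyl e f ->
        (L2sq (lebesgue_rV N) setT (T f) <= C%:E * H1sq_cyl e f)%E &
      forall f, H1_cyl e f -> {within cyl_closed e, continuous f} ->
        {ae lebesgue_rV N, forall x, T f x = f (x, p)}].

Definition trace e p : (RN1 -> R) -> RN -> R :=
  xget (fun _ _ => 0) [set T | is_trace_operator e p T].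

Definition H1_edgewise u : Prop :=
  [/\ (\esum_(e in [set: edge G])
         L2sq (lebesgue_prod N) (cyl_open e) (u e) < +oo)%E,
      forall e, H1_cyl e (u e),
      (\esum_(e in [set: edge G]) H1sq_cyl e (u e) < +oo)%E &
      forall e1 e2 p1 p2 v, glued e1 p1 v -> glued e2 p2 v ->
        {ae lebesgue_rV N,
          forall x, trace e1 p1 (u e1) x = trace e2 p2 (u e2) x}].

Definition H1_fiberwise u : Prop :=
  [/\ forall e, {ae lebesgue_measure, forall y, edge_open e y ->
        H1 (lebesgue_rV N) (dirs_rV N) setT (fun x => u e (x, y))},
      (\esum_(e in [set: edge G]) \int[lebesgue_measure]_(y in edge_open e)
         H1sq (lebesgue_rV N) (dirs_rV N) setT (fun x => u e (x, y)) < +oo)%E,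
      {ae lebesgue_rV N, forall x, H1_graph (fun e y => u e (x, y))} &
      (\int[lebesgue_rV N]_x H1sq_graph (fun e y => u e (x, y)) < +oo)%E].

End product.

(* Main.v *)
(* Weak derivatives are characterised by increments: along a direction v in which
   the open set is convex, g is the weak derivative of u if and only if
   u(x + s v) - u(x) = int_0^s g(x + r v) dr for almost every x. Unlike the
   definition by test functions, this restricts to almost every horizontal or
   vertical line by Fubini's theorem. Conversely, the weak derivatives of the slices
   are limits of difference quotients, hence jointly measurable, and integrating over
   the slices shows that they are a weak derivative on the cylinder.
   On a vertical slice u = c + int_0^y g. So u(., p) = c + int_0^p g is obtained from u
   and g by pairings with fixed square integrable kernels, which defines a bounded
   trace; averages over small horizontal boxes are continuous up to the boundary and
   approximate u in H^1, so no other trace operator exists. The traces therefore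
   agree at a vertex if and only if the continuous representatives of almost every
   vertical slice do. *)
Require Import Defs.
From HB Require Import structures.
From mathcomp Require Import all_boot all_order all_algebra.
From mathcomp Require Import all_classical all_reals all_analysis.
From mathcomp Require Import measurable_realfun ring lra.
Set Implicit Arguments.
Unset Strict Implicit.
Unset Printing Implicit Defensive.
Import Order.TTheory GRing.Theory Num.Theory.
Import numFieldNormedType.Exports.
Local Open Scope classical_set_scope.
Local Open Scope ring_scope.

(** * Square integrable functions *)

(** Two choices shape the argument: the norm of a slice uses a chosen weak derivative, so its
    measurability in the slice parameter is unknown, and [trace] is chosen among all trace
    operators. Hence integrals of nonnegative functions are compared almost everywhere without
    measurability, as suprema over simple functions, and a trace can only be computed once existence
    and uniqueness of the operator are settled. Functions are extended by 0 from the cylinder to the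
    whole space: test functions supported in the cylinder do not notice the jump, and every norm
    refers to one translation invariant measure. Increments are restricted to slices for the steps
    1/(n+1) only: these are countably many, so their null sets can be united, and they suffice
    because a compact subset of an open set tolerates short shifts. There is no vertical smoothing,
    since a vertical translation leaves the cylinder; c + int_0^p g is already continuous in p, so
    only the dependence on x has to be smoothed. *)

Lemma ae_mono d (T : measurableType d) (R : realType) (mu : {measure set T -> \bar R})
    (P Q : T -> Prop) : (forall x, P x -> Q x) ->
  {ae mu, forall x, P x} -> {ae mu, forall x, Q x}.
Proof. by move=> PQ; apply: filterS. Qed.

Lemma ae_mono2 d (T : measurableType d) (R : realType) (mu : {measure set T -> \bar R})
    (P Q S : T -> Prop) : (forall x, P x -> Q x -> S x) ->
  {ae mu, forall x, P x} -> {ae mu, forall x, Q x} -> {ae mu, forall x, S x}.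
Proof. by move=> PQ; apply: filterS2. Qed.

Section integral_layer.
Context d (T : measurableType d) (R : realType) (mu : {measure set T -> \bar R}).
Implicit Types (f g h : T -> R).

Import HBNNSimple.

(** The integral of a nonnegative function is the supremum over simple functions below it, so it
    suffices to cut such a function off on the null set. Neither [f] nor [g] is measurable here;
    this is how the norms of slices, built from chosen weak derivatives, are handled. *)
Lemma ae_le_nnintegral (f g : T -> \bar R) :
  (forall x, 0 <= f x)%E -> (forall x, 0 <= g x)%E ->
  {ae mu, forall x, (f x <= g x)%E} ->
  (\int[mu]_x f x <= \int[mu]_x g x)%E.
Proof.
move=> f0 g0 [N [mN N0 Nfg]].
rewrite (ge0_integralTE _ f0); apply: ge_ereal_sup => _ [h hf <-].
pose k := nnsfun0 ; pose h' := [the {nnsfun T >-> R} of mul_nnsfun h (indic_nnsfun R (measurableC mN))].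
have -> : sintegral mu h = sintegral mu h'.
  rewrite -!integralT_nnsfun; apply: ge0_ae_eq_integral => //.
  - exact/measurable_EFinP.
  - exact/measurable_EFinP.
  - by move=> x _; rewrite lee_fin.
  - by move=> x _; rewrite lee_fin.
  exists N; split => // x /= hx; apply: contrapT => Nx; apply: hx => _.
  by rewrite mindicE in_setC memNset// mulr1.
rewrite (ge0_integralTE _ g0); apply: ereal_sup_ubound; exists h' => //= x.
rewrite mindicE in_setC; have [xN|xN] := boolP (x \in N); rewrite /= ?mulr0 ?mulr1//.
apply: (le_trans (hf x)); apply: contrapT => xfg; move/negP: xN; apply.
by rewrite inE; apply: Nfg.
Qed.

Lemma ae_eq_nnintegral (f g : T -> \bar R) :
  (forall x, 0 <= f x)%E -> (forall x, 0 <= g x)%E ->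
  {ae mu, forall x, f x = g x} -> (\int[mu]_x f x = \int[mu]_x g x)%E.
Proof.
move=> f0 g0 fg; apply/le_anti/andP; split; apply: ae_le_nnintegral => //;
  by apply: filterS fg => x ->.
Qed.

Definition sqint f : \bar R := (\int[mu]_x ((f x) ^+ 2)%:E)%E.

Definition sqintegrable f : Prop := measurable_fun setT f /\ (sqint f < +oo)%E.

Lemma sqint_ge0 f : (0 <= sqint f)%E.
Proof. by apply: integral_ge0 => x _; rewrite lee_fin sqr_ge0. Qed.

Lemma sqint_fin f : sqintegrable f -> sqint f \is a fin_num.
Proof. by move=> [_ f2]; rewrite ge0_fin_numE// sqint_ge0. Qed.

Lemma measurable_sqr f : measurable_fun setT f ->
  measurable_fun setT (fun x => ((f x) ^+ 2)%:E).
Proof. by move=> mf; apply/measurable_EFinP; exact: measurable_funX. Qed.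

Lemma sqintegrable_sqr f : sqintegrable f ->
  mu.-integrable setT (fun x => ((f x) ^+ 2)%:E).
Proof.
move=> [mf f2]; apply/integrableP; split; first exact: measurable_sqr.
by under eq_integral do rewrite gee0_abs ?lee_fin ?sqr_ge0//.
Qed.

Lemma le_sqint f g : (forall x, `|f x| <= `|g x|) -> (sqint f <= sqint g)%E.
Proof.
move=> fg; apply: ae_le_nnintegral => [x|x|]; rewrite ?lee_fin ?sqr_ge0//.
apply: aeW => x; rewrite lee_fin -real_normK ?num_real// -[leRHS]real_normK ?num_real//.
by rewrite lerXn2r// nnegrE.
Qed.

Lemma le_sqintegrable f g : measurable_fun setT f ->
  (forall x, `|f x| <= `|g x|) -> sqintegrable g -> sqintegrable f.
Proof. by move=> mf fg [_ g2]; split => //; apply: le_lt_trans g2; exact: le_sqint. Qed.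

Lemma sqint_scale a f : measurable_fun setT f ->
  sqint (fun x => a * f x) = ((a ^+ 2)%:E * sqint f)%E.
Proof.
move=> mf; rewrite -ge0_integralZl//; last first.
- by rewrite lee_fin sqr_ge0.
- by move=> x _; rewrite lee_fin sqr_ge0.
- exact: measurable_sqr.
by apply: eq_integral => x _; rewrite exprMn EFinM.
Qed.

Lemma sqintN f : sqint (fun x => - f x) = sqint f.
Proof. by apply: eq_integral => x _; rewrite sqrrN. Qed.

(** The factor 2 stands in for the triangle inequality: all estimates are for squared norms, so that
    no square root of an extended real appears. *)
Lemma sqint_add f g : measurable_fun setT f -> measurable_fun setT g ->
  (sqint (fun x => f x + g x)%R <= 2%:E * sqint f + 2%:E * sqint g)%E.
Proof.
move=> mf mg.
rewrite -ge0_integralZl//; last by move=> x _; rewrite lee_fin sqr_ge0.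
  2: exact: measurable_sqr.
rewrite -ge0_integralZl//; last by move=> x _; rewrite lee_fin sqr_ge0.
  2: exact: measurable_sqr.
rewrite -ge0_integralD//.
- apply: ge0_le_integral => //.
  + by move=> x _; rewrite lee_fin sqr_ge0.
  + by apply: measurable_sqr; exact: measurable_funD.
  + by apply: emeasurable_funD; apply: measurable_funeM; exact: measurable_sqr.
  + move=> x _; rewrite -!EFinM -EFinD lee_fin.
    by have := sqr_ge0 (f x - g x); lra.
- by move=> x _; rewrite -EFinM lee_fin mulr_ge0// sqr_ge0.
- by apply: measurable_funeM; exact: measurable_sqr.
- by move=> x _; rewrite -EFinM lee_fin mulr_ge0// sqr_ge0.
- by apply: measurable_funeM; exact: measurable_sqr.
Qed.

Lemma sqint_sub f g : measurable_fun setT f -> measurable_fun setT g ->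
  (sqint (fun x => f x - g x)%R <= 2%:E * sqint f + 2%:E * sqint g)%E.
Proof.
move=> mf mg; rewrite -(sqintN g); apply: sqint_add => //.
exact: measurableT_comp.
Qed.

Lemma sqintegrableD f g : sqintegrable f -> sqintegrable g ->
  sqintegrable (fun x => f x + g x).
Proof.
move=> sf sg; split; first exact: measurable_funD sf.1 sg.1.
apply: le_lt_trans (sqint_add sf.1 sg.1) _.
by rewrite lte_add_pinfty// lte_mul_pinfty// ?sqint_fin//; [exact: sf.2|exact: sg.2].
Qed.

Lemma sqintegrableZ a f : sqintegrable f -> sqintegrable (fun x => a * f x).
Proof.
move=> sf; split; first by apply: measurable_funM => //; exact: sf.1.
by rewrite sqint_scale ?lte_mul_pinfty ?lee_fin ?sqr_ge0//; [exact: sf.2|exact: sf.1].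
Qed.

Lemma sqintegrableN f : sqintegrable f -> sqintegrable (fun x => - f x).
Proof.
by move=> sf; under eq_fun do rewrite -mulN1r; exact: sqintegrableZ.
Qed.

Lemma sqintegrableB f g : sqintegrable f -> sqintegrable g ->
  sqintegrable (fun x => f x - g x).
Proof. by move=> sf sg; apply: sqintegrableD => //; exact: sqintegrableN. Qed.

Lemma sqintegrableM f g : sqintegrable f -> sqintegrable g ->
  mu.-integrable setT (fun x => (f x * g x)%:E).
Proof.
move=> sf sg.
have := integrableD measurableT (sqintegrable_sqr sf) (sqintegrable_sqr sg).
apply: le_integrable => //.
  by apply/measurable_EFinP; apply: measurable_funM; [exact: sf.1|exact: sg.1].
move=> x _ /=; rewrite lee_fin [leRHS]ger0_norm ?addr_ge0 ?sqr_ge0//.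
rewrite normrM -(real_normK (num_real (f x))) -(real_normK (num_real (g x))).
by have := sqr_ge0 (`|f x| - `|g x|); have := normr_ge0 (f x); have := normr_ge0 (g x); nra.
Qed.

(* Cauchy-Schwarz: the quadratic polynomial [t |-> sqint (f + t g)] is nonnegative. *)
Lemma sqr_integral_le f g : sqintegrable f -> sqintegrable g ->
  (((\int[mu]_x (f x * g x)) ^+ 2)%:E <= sqint f * sqint g)%E.
Proof.
move=> sf sg.
have fE := fineK (sqint_fin sf); have gE := fineK (sqint_fin sg).
have fge0 : 0 <= fine (sqint f) by rewrite fine_ge0// sqint_ge0.
have gge0 : 0 <= fine (sqint g) by rewrite fine_ge0// sqint_ge0.
rewrite -fE -gE -EFinM lee_fin.
move: fE gE fge0 gge0; set A := fine _; set B := fine _ => fE gE A0 B0.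
set C := Rintegral _ _ _.
have fgE : (\int[mu]_x (f x * g x)%:E = C%:E)%E.
  by rewrite /C /Rintegral fineK// integrable_fin_num//; exact: sqintegrableM.
have key t : 0 <= A + t * (2 * C) + t ^+ 2 * B.
  rewrite -lee_fin; have := sqint_ge0 (fun x => f x + t * g x); congr (_ <= _)%E.
  transitivity (\int[mu]_x (((f x) ^+ 2)%:E + ((t * 2) * (f x * g x))%:E
     + (t ^+ 2 * (g x) ^+ 2)%:E))%E.
    by apply: eq_integral => x _; rewrite -!EFinD; congr EFin; ring.
  have i1 := sqintegrable_sqr sf.
  have i2 : mu.-integrable setT (fun x => ((t * 2) * (f x * g x))%:E).
    under eq_fun do rewrite EFinM; apply: integrableZl => //; exact: sqintegrableM.
  have i3 : mu.-integrable setT (fun x => (t ^+ 2 * (g x) ^+ 2)%:E).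
    under eq_fun do rewrite EFinM; apply: integrableZl => //; exact: sqintegrable_sqr.
  rewrite integralD//; last by have := integrableD measurableT i1 i2.
  rewrite integralD//.
  under [X in (_ + X + _)%E]eq_integral do rewrite EFinM.
  under [X in (_ + _ + X)%E]eq_integral do rewrite EFinM.
  rewrite integralZl//; last exact: sqintegrableM.
  rewrite integralZl//; last exact: sqintegrable_sqr.
  by rewrite fgE -/(sqint f) -/(sqint g) -fE -gE !EFinD !EFinM muleA.
have [B00|Bn0] := eqVneq B 0.
  rewrite B00 mulr0; have [->|Cn0] := eqVneq C 0; first by rewrite expr0n.
  (* For [B = 0] the polynomial is affine and this [t] gives it the value -1. Below, [- C / B] is
     its minimiser. *)
  have := key (- (A + 1) / (2 * C)); rewrite B00 mulr0 addr0 divfK ?mulf_neq0//.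
  by lra.
have Bp : 0 < B by rewrite lt_neqAle eq_sym Bn0.
have := key (- C / B); have -> : A + - C / B * (2 * C) + (- C / B) ^+ 2 * B =
   (A * B - C ^+ 2) / B by field.
by rewrite pmulr_lge0 ?invr_gt0// subr_ge0.
Qed.

Lemma sqint_eq0 f : measurable_fun setT f -> sqint f = 0%E ->
  {ae mu, forall x, f x = 0}.
Proof.
move=> mf f0.
have : (\int[mu]_x `|((f x) ^+ 2)%:E| = 0)%E.
  by rewrite -f0; apply: eq_integral => x _; rewrite gee0_abs// lee_fin sqr_ge0.
move/(ae_eq_integral_abs mu measurableT (measurable_sqr mf)).
by apply: filterS => x /(_ Logic.I)[] /eqP; rewrite sqrf_eq0 => /eqP.
Qed.

Lemma ae_eq_sqint f g : {ae mu, forall x, f x = g x} -> sqint f = sqint g.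
Proof.
move=> fg; apply: ae_eq_nnintegral => [x|x|]; rewrite ?lee_fin ?sqr_ge0//.
by apply: filterS fg => x ->.
Qed.

Lemma EFin_Rintegral f : mu.-integrable setT (EFin \o f) ->
  (\int[mu]_x f x)%:E = (\int[mu]_x (f x)%:E)%E.
Proof. by move=> fi; rewrite /Rintegral fineK// integrable_fin_num. Qed.

Lemma integrable_scale c f : mu.-integrable setT (EFin \o f) ->
  mu.-integrable setT (EFin \o (fun x => c * f x)).
Proof.
by move/(integrableZl measurableT c).
Qed.

Lemma ae_eq_Rintegral f g : measurable_fun setT f -> measurable_fun setT g ->
  {ae mu, forall x, f x = g x} -> \int[mu]_x f x = \int[mu]_x g x.
Proof.
move=> mf mg fg; congr fine; apply: ae_eq_integral => //.
- exact/measurable_EFinP.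
- exact/measurable_EFinP.
- by apply: filterS fg => x ->.
Qed.

Lemma sqintegrable_indic (A : set T) : measurable A -> (mu A < +oo)%E ->
  sqintegrable (\1_A : T -> R).
Proof.
move=> mA Aoo; split; first exact: measurable_indic.
rewrite /sqint; under eq_integral.
  move=> x _; rewrite (_ : _ ^+ 2 = \1_A x); last by rewrite indicE; case: (_ \in _); rewrite ?expr1n ?expr0n.
  over.
by rewrite integral_indic// setIT.
Qed.

End integral_layer.

(** * Null sets, square norms and integrals on the slices of a product *)

Section fubini_layer.
Context d1 d2 (T1 : measurableType d1) (T2 : measurableType d2) (R : realType).
Variables (m1 : {sigma_finite_measure set T1 -> \bar R})
          (m2 : {sigma_finite_measure set T2 -> \bar R}).
Local Notation m12 := (m1 \x m2)%E.
Implicit Types (f : T1 * T2 -> R) (P : T1 * T2 -> Prop) (k : T2 -> R).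

Lemma measurable_slice1 d3 (T3 : measurableType d3) (f : T1 * T2 -> T3) x :
  measurable_fun setT f -> measurable_fun setT (fun y => f (x, y)).
Proof. by move=> mf; apply: measurableT_comp => //; exact: pair1_measurable. Qed.

Lemma measurable_slice2 d3 (T3 : measurableType d3) (f : T1 * T2 -> T3) y :
  measurable_fun setT f -> measurable_fun setT (fun x => f (x, y)).
Proof. by move=> mf; apply: measurableT_comp => //; exact: pair2_measurable. Qed.

Lemma ae_slice1 P : {ae m12, forall z, P z} ->
  {ae m1, forall x, {ae m2, forall y, P (x, y)}}.
Proof.
move=> [A [mA A0 PA]].
have mx : measurable_fun setT (m2 \o xsection A) by exact: measurable_fun_xsection.
have : (\int[m1]_x `|(m2 \o xsection A) x| = 0)%E.
  by rewrite -A0 /product_measure1; apply: eq_integral => x _; rewrite gee0_abs.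
move/(ae_eq_integral_abs m1 measurableT mx).
apply: filterS => x /(_ Logic.I) /= xA0; exists (xsection A x); split => //.
  exact: measurable_xsection.
by move=> y /= Py; rewrite /xsection /= inE; apply: PA.
Qed.

(** The product measure is defined by integrating the sections at fixed first coordinate, so the
    sections in the other direction are reached through Tonelli for the indicator of the null
    set. *)
Lemma ae_slice2 P : {ae m12, forall z, P z} ->
  {ae m2, forall y, {ae m1, forall x, P (x, y)}}.
Proof.
move=> [A [mA A0 PA]].
have my : measurable_fun setT (m1 \o ysection A) by exact: measurable_fun_ysection.
have : (\int[m2]_y `|(m1 \o ysection A) y| = 0)%E.
  transitivity (\int[m2]_y \int[m1]_x (\1_A (x, y) : R)%:E)%E.
    apply: eq_integral => y _; rewrite gee0_abs//.
    by rewrite -/(fubini_G m1 (EFin \o \1_A) y) indic_fubini_tonelli_GE.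
  rewrite -(fubini_tonelli2 (m1:=m1) (m2:=m2) (EFin \o \1_A)).
  - by rewrite integral_indic// setIT.
  - by apply/measurable_EFinP; exact: measurable_indic.
  - by move=> z; rewrite lee_fin.
move/(ae_eq_integral_abs m2 measurableT my).
apply: filterS => y /(_ Logic.I) /= yA0; exists (ysection A y); split => //.
  exact: measurable_ysection.
by move=> x /= Px; rewrite /ysection /= inE; apply: PA.
Qed.

(** The null sets [B] on the slices are unrelated to each other. Measurability of the set where [P]
    fails is what allows its measure to be computed from its sections. *)
Lemma ae_prod1 P : measurable [set z | P z] ->
  {ae m1, forall x, {ae m2, forall y, P (x, y)}} -> {ae m12, forall z, P z}.
Proof.
move=> mP h; exists (~` [set z | P z]); split => //; first exact: measurableC.
rewrite /product_measure1 -[RHS](integral0 m1 setT).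
apply: ae_eq_integral => //; first by apply: measurable_fun_xsection; exact: measurableC.
apply: filterS h => x [B [mB B0 PB]] _ /=.
apply: (subset_measure0 _ mB _ B0); first by apply: measurable_xsection; exact: measurableC.
by move=> y; rewrite /xsection /= inE => /PB.
Qed.

Lemma ae_prod2 P : measurable [set z | P z] ->
  {ae m2, forall y, {ae m1, forall x, P (x, y)}} -> {ae m12, forall z, P z}.
Proof.
move=> mP h; have mA := measurableC mP.
exists (~` [set z | P z]); split => //; set A := ~` _ in mA *.
have -> : (m12 A = \int[m2]_y (m1 \o ysection A) y)%E.
  transitivity (\int[m12]_z (\1_A z : R)%:E)%E; first by rewrite integral_indic// setIT.
  rewrite (fubini_tonelli2 (m1:=m1) (m2:=m2) (EFin \o \1_A)).
  - by rewrite indic_fubini_tonelli_GE.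
  - by apply/measurable_EFinP; exact: measurable_indic.
  - by move=> z; rewrite lee_fin.
rewrite -[RHS](integral0 m2 setT).
apply: ae_eq_integral => //; first exact: measurable_fun_ysection.
apply: filterS h => y [B [mB B0 PB]] _ /=.
apply: (subset_measure0 _ mB _ B0); first exact: measurable_ysection.
by move=> x; rewrite /ysection /= inE => /PB.
Qed.

Lemma sqint_slice1 f : measurable_fun setT f ->
  sqint m12 f = (\int[m1]_x sqint m2 (fun y => f (x, y)))%E.
Proof.
move=> mf; rewrite /sqint (fubini_tonelli1 (m1:=m1) (m2:=m2) (fun z => ((f z) ^+ 2)%:E))//.
- exact: measurable_sqr.
- by move=> z; rewrite lee_fin sqr_ge0.
Qed.

Lemma sqint_slice2 f : measurable_fun setT f ->
  sqint m12 f = (\int[m2]_y sqint m1 (fun x => f (x, y)))%E.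
Proof.
move=> mf; rewrite /sqint (fubini_tonelli2 (m1:=m1) (m2:=m2) (fun z => ((f z) ^+ 2)%:E))//.
- exact: measurable_sqr.
- by move=> z; rewrite lee_fin sqr_ge0.
Qed.

Lemma measurable_sqint_slice1 f : measurable_fun setT f ->
  measurable_fun setT (fun x => sqint m2 (fun y => f (x, y))).
Proof.
move=> mf; apply: (measurable_fun_fubini_tonelli_F (m2:=m2) (fun z => ((f z) ^+ 2)%:E)).
- exact: measurable_sqr.
- by move=> z; rewrite lee_fin sqr_ge0.
Qed.

Lemma measurable_sqint_slice2 f : measurable_fun setT f ->
  measurable_fun setT (fun y => sqint m1 (fun x => f (x, y))).
Proof.
move=> mf; apply: (measurable_fun_fubini_tonelli_G (m1:=m1) (fun z => ((f z) ^+ 2)%:E)).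
- exact: measurable_sqr.
- by move=> z; rewrite lee_fin sqr_ge0.
Qed.

Lemma sqintegrable_slice1 f : sqintegrable m12 f ->
  {ae m1, forall x, sqintegrable m2 (fun y => f (x, y))}.
Proof.
move=> [mf f2]; have : m1.-integrable setT (fun x => sqint m2 (fun y => f (x, y))).
  apply/integrableP; split; first exact: measurable_sqint_slice1.
  by under eq_integral do rewrite gee0_abs ?sqint_ge0//; rewrite -sqint_slice1.
move/(integrable_ae measurableT); apply: filterS => x /(_ Logic.I) fx; split.
  exact: measurable_slice1.
by rewrite -ge0_fin_numE// sqint_ge0.
Qed.

Lemma sqintegrable_slice2 f : sqintegrable m12 f ->
  {ae m2, forall y, sqintegrable m1 (fun x => f (x, y))}.
Proof.
move=> [mf f2]; have : m2.-integrable setT (fun y => sqint m1 (fun x => f (x, y))).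
  apply/integrableP; split; first exact: measurable_sqint_slice2.
  by under eq_integral do rewrite gee0_abs ?sqint_ge0//; rewrite -sqint_slice2.
move/(integrable_ae measurableT); apply: filterS => y /(_ Logic.I) fy; split.
  exact: measurable_slice2.
by rewrite -ge0_fin_numE// sqint_ge0.
Qed.

(** Tonelli applies to the positive and the negative part separately, and [fine] is measurable and
    sends infinite values to 0; so slices which are not integrable do no harm. *)
Lemma measurable_Rintegral_slice1 f : measurable_fun setT f ->
  measurable_fun setT (fun x => \int[m2]_y f (x, y)).
Proof.
move=> mf; apply: measurableT_comp; first exact: fine_measurable.
have me : measurable_fun setT (EFin \o f) by exact/measurable_EFinP.
under eq_fun do rewrite integralE; apply: emeasurable_funB.
- rewrite (_ : (fun _ => _) = fubini_F m2 (EFin \o f)^\+%E).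
    by apply: measurable_fun_fubini_tonelli_F => //; exact: measurable_funepos.
  by apply/funext => x; apply: eq_integral => y _; rewrite !funeposE.
- rewrite (_ : (fun _ => _) = fubini_F m2 (EFin \o f)^\-%E).
    by apply: measurable_fun_fubini_tonelli_F => //; exact: measurable_funeneg.
  by apply/funext => x; apply: eq_integral => y _; rewrite !funenegE.
Qed.

Lemma Rintegral_slice1 f : m12.-integrable setT (EFin \o f) ->
  \int[m1]_x (\int[m2]_y f (x, y)) = \int[m12]_z f z.
Proof.
move=> fi; rewrite /Rintegral -(integral12_prod_meas1 fi); congr fine.
apply: ae_eq_integral => //.
- apply/measurable_EFinP; apply: measurable_Rintegral_slice1.
  by apply/measurable_EFinP; exact: measurable_int fi.
- exact: (measurable_fubini_F fi).
- have := ae_integrable1 fi; apply: filterS => x /(integrable_fin_num measurableT) xfi _.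
  by rewrite fineK.
Qed.

Lemma Rintegral_slice2 f : m12.-integrable setT (EFin \o f) ->
  \int[m2]_y (\int[m1]_x f (x, y)) = \int[m12]_z f z.
Proof.
move=> fi; rewrite /Rintegral -(integral21_prod_meas1 fi); congr fine.
have mf : measurable_fun setT (EFin \o f) := measurable_int _ fi.
apply: ae_eq_integral => //.
- apply: measurableT_comp => //; apply: measurableT_comp; first exact: fine_measurable.
  exact: (measurable_fubini_G fi).
- exact: (measurable_fubini_G fi).
- have := ae_integrable2 fi; apply: filterS => x /(integrable_fin_num measurableT) xfi _.
  by rewrite fineK.
Qed.

(** Integrals along rays, averages over boxes and traces are all of this form, for different kernels
    [k]. *)
Definition pairing k f (x : T1) : R := \int[m2]_y (k y * f (x, y)).

Lemma measurable_pairing k f : measurable_fun setT k -> measurable_fun setT f ->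
  measurable_fun setT (pairing k f).
Proof.
move=> mk mf; apply: (measurable_Rintegral_slice1 (f := fun z => k z.2 * f z)).
by apply: measurable_funM => //; apply: measurableT_comp => //; exact: measurable_snd.
Qed.

(** Cauchy-Schwarz on almost every slice, then integration over [x]: a fixed square integrable
    kernel is a bounded operator from L^2 of the product to L^2 of the base. *)
Lemma sqint_pairing k f : sqintegrable m2 k -> sqintegrable m12 f ->
  (sqint m1 (pairing k f) <= sqint m2 k * sqint m12 f)%E.
Proof.
move=> sk sf; rewrite (sqint_slice1 sf.1) -ge0_integralZl//; last first.
- exact: sqint_ge0.
- by move=> x _; exact: sqint_ge0.
- exact: (measurable_sqint_slice1 sf.1).
apply: ae_le_nnintegral => [x|x|].
- by rewrite lee_fin sqr_ge0.
- by rewrite mule_ge0// sqint_ge0.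
by apply: filterS (sqintegrable_slice1 sf) => x sfx; exact: sqr_integral_le.
Qed.

Lemma sqintegrable_pairing k f : sqintegrable m2 k -> sqintegrable m12 f ->
  sqintegrable m1 (pairing k f).
Proof.
move=> sk sf; split; first exact: measurable_pairing sk.1 sf.1.
by apply: le_lt_trans (sqint_pairing sk sf) _;
  rewrite lte_mul_pinfty ?sqint_ge0 ?sqint_fin//; exact: sf.2.
Qed.

End fubini_layer.

(** * Spaces with coordinates and an invariant measure *)

(* Abstracts what R, R^N and R^N x R have in common: finitely many linear coordinates
   which give the norm and the sigma-algebra, and a translation invariant measure. *)
Record coord_space (R : realType) d (V : measurableNormedModType d R)
    (mu : {sigma_finite_measure set V -> \bar R}) := CoordSpace {
  cidx : finType;
  coord : cidx -> V -> R;
  coord_lin : forall i a x y, coord i (a *: x + y) = a * coord i x + coord i y;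
  coord_norm : forall x (e : R), 0 <= e ->
    (`|x| <= e <-> forall i, `|coord i x| <= e);
  measurable_coord : forall i, measurable_fun setT (coord i);
  coord_gen : forall S : set (set V), sigma_algebra setT S ->
    (forall i (B : set (measurableTypeR R)), measurable B -> S (coord i @^-1` B)) ->
    measurable `<=` S;
  coord_compact : forall a b : cidx -> R,
    compact [set x | forall i, a i <= coord i x <= b i];
  coord_fin : forall M : R, (mu [set x | forall i, (`|coord i x| <= M)%R] < +oo)%E;
  coord_trans : forall v A, measurable A -> mu ((fun x => x + v) @^-1` A) = mu A
}.

Arguments coord {R d V mu} c _ _.
Arguments coord_lin {R d V mu} c _ _ _ _.
Arguments coord_norm {R d V mu} c _ _ _.
Arguments measurable_coord {R d V mu} c _.
Arguments coord_gen {R d V mu} c _ _ _.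
Arguments coord_compact {R d V mu} c _ _.
Arguments coord_fin {R d V mu} c _.
Arguments coord_trans {R d V mu} c _ _ _.

Lemma measurable_coord_cube (R : realType) d (V : measurableNormedModType d R)
    (mu : {sigma_finite_measure set V -> \bar R}) (C : coord_space mu) (M : R) :
  measurable [set x | forall i, `|coord C i x| <= M].
Proof.
rewrite (_ : mkset _ = \bigcap_(i in [set: cidx C]) (coord C i @^-1` `[-M, M]%classic)).
  apply: fin_bigcap_measurable => // i _; rewrite -[X in measurable X]setTI.
  by apply: measurable_coord => //; exact: measurable_itv.
apply/seteqP; split => x /= h i; first by move=> _ /=; rewrite in_itv/= -ler_norml.
by have := h i Logic.I; rewrite /= in_itv/= -ler_norml.
Qed.

Section coord_R.
Context (R : realType).
Local Notation leb := (@lebesgue_measure R).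

Lemma lebesgue_measure_shift (v : R) (A : set (measurableTypeR R)) : measurable A ->
  leb ((fun x => x + v) @^-1` A) = leb A.
Proof.
move=> mA; have ms : measurable_fun setT (fun x : measurableTypeR R => x + v).
  exact: measurable_funD.
transitivity (pushforward leb (fun x : measurableTypeR R => x + v) A) => //.
pose pf := measure_function_pushforward__canonical__measure_function_Measure leb ms.
transitivity (pf A) => //.
apply/esym/(@lebesgue_measure_unique R pf) => //= _ [[a b]] _ <-.
rewrite /pushforward (_ : _ @^-1` _ = `]a - v, b - v]%classic); last first.
  by apply/seteqP; split=> x /=; rewrite !in_itv/= ltrBlDr lerBrDr.
rewrite !lebesgue_measure_itv/= !lte_fin ltrD2r; case: ifP => // _.
by rewrite -!EFinD; congr EFin; ring.
Qed.

Definition coord_space_R : coord_space (V := measurableTypeR R) leb.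
Proof.
exists unit (fun _ x => x).
- by [].
- by move=> x e e0; split => [xe _|/(_ tt)].
- by move=> _; exact: measurable_id.
- by move=> S _ SB B mB; exact: (SB tt).
- move=> a b; rewrite (_ : mkset _ = `[a tt, b tt]%classic); first exact: segment_compact.
  by apply/seteqP; split=> x /=; rewrite in_itv/=; [move/(_ tt)|move=> ? []].
- move=> M; rewrite (_ : mkset _ = `[-M, M]%classic).
    suff : (leb `[(- M)%R, M]%classic < +oo)%E by [].
    by rewrite lebesgue_measure_itv/=; case: ifP => // _; rewrite -EFinB ltry.
  by apply/seteqP; split=> x /=; rewrite in_itv/= -ler_norml; [move/(_ tt)|move=> ? []].
- exact: lebesgue_measure_shift.
Defined.

End coord_R.

Section prod_sigma_finite.
Context (R : realType) d1 d2 (V : measurableType d1) (W : measurableType d2).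
Variables (mu : {sigma_finite_measure set V -> \bar R})
          (nu : {sigma_finite_measure set W -> \bar R}).

Lemma sigma_finite_product : sigma_finite setT (mu \x nu)%E.
Proof.
have [F FT Foo] := sigma_finiteT mu; have [H HT Hoo] := sigma_finiteT nu.
exists (fun n => if unpickle n is Some (i, j) then F i `*` H j else set0).
  rewrite -setXTT FT HT; apply/seteqP; split => [[x y] [[i _ Fx] [j _ Hy]]|[x y] [n _]].
    by exists (pickle (i, j)) => //; rewrite pickleK.
  by case: unpickle => // -[i j] [Fx Hy]; split; [exists i|exists j].
move=> n; case: unpickle => [[i j]|]; last by rewrite measure0.
have [mF Fi] := Foo i; have [mH Hj] := Hoo j.
split; first exact: measurableX.
by rewrite product_measure1E// lte_mul_pinfty// ge0_fin_numE.
Qed.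

(* The library declares a subprobability instance on [mu \x nu] first, which
   shadows the sigma-finite one. *)
Definition prod_measure : {sigma_finite_measure set (V * W)%type -> \bar R} :=
  HB.pack (mu \x nu)%E
    (Measure_isSigmaFinite.Build _ _ _ (mu \x nu)%E sigma_finite_product).

Lemma prod_measureE : prod_measure = (mu \x nu)%E :> (set (V * W)%type -> \bar R).
Proof. by []. Qed.

(** The section of the preimage at [x] is the [t]-preimage of the section at [s x]; the outer
    integral is then transported by the pushforward under [s]. *)
Lemma product_measure_preimage (s : V -> V) (t : W -> W) :
  measurable_fun setT s ->
  (forall A, measurable A -> mu (s @^-1` A) = mu A) ->
  (forall B, measurable B -> nu (t @^-1` B) = nu B) ->
  forall A, measurable A ->
    (mu \x nu)%E ((fun z => (s z.1, t z.2)) @^-1` A) = (mu \x nu)%E A.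
Proof.
move=> ms sE tE A mA; rewrite /product_measure1.
have mx : measurable_fun setT (nu \o xsection A) by exact: measurable_fun_xsection.
transitivity (\int[mu]_x ((nu \o xsection A) \o s) x)%E.
  apply: eq_integral => x _ /=; transitivity (nu (t @^-1` xsection A (s x))).
    by congr (nu _); apply/seteqP; split => y; rewrite /xsection /= !inE.
  by apply: tE; exact: measurable_xsection.
rewrite -(ge0_integral_pushforward ms mu (D := setT))//.
by apply: eq_measure_integral => B mB _; exact: sE.
Qed.

End prod_sigma_finite.

Section coord_prod.
Context (R : realType) d1 d2 (V : measurableNormedModType d1 R) (W : measurableNormedModType d2 R).
Variables (mu : {sigma_finite_measure set V -> \bar R}) (nu : {sigma_finite_measure set W -> \bar R}).
Variables (CV : coord_space mu) (CW : coord_space nu).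

(** The norm of a product is a maximum, so the coordinates of the factors together still determine
    it. *)
Definition coord_space_prod : coord_space (V := (V * W)%type) (prod_measure mu nu).
Proof.
exists (cidx CV + cidx CW)%type
  (fun i z => match i with inl i => coord CV i z.1 | inr j => coord CW j z.2 end).
- by move=> [i|j] a x y /=; rewrite coord_lin.
- move=> x e e0; rewrite /Num.norm/= ge_max; split.
    move=> /andP[/(coord_norm CV _ _ e0) h1 /(coord_norm CW _ _ e0) h2] [i|j] /=.
      exact: h1.
    exact: h2.
  move=> h; apply/andP; split.
    by apply/(coord_norm CV _ _ e0) => i; exact: (h (inl i)).
  by apply/(coord_norm CW _ _ e0) => i; exact: (h (inr i)).
- move=> [i|j].
    by apply: measurableT_comp; [exact: measurable_coord|exact: measurable_fst].
  by apply: measurableT_comp; [exact: measurable_coord|exact: measurable_snd].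
- move=> S sS SB; apply: smallest_sub => // A [[B mB <-]|[B mB <-]]; rewrite setTI.
  + suff : measurable `<=` [set B | S (fst @^-1` B)] by apply.
    apply: (coord_gen CV) => [|i C mC]; last exact: (SB (inl i)).
    split => [|C SC|F SF] /=; first by rewrite preimage_set0; case: sS.
      by rewrite setTD preimage_setC -setTD; case: sS => _ h _; apply: h.
    by rewrite preimage_bigcup; case: sS => _ _; apply.
  + suff : measurable `<=` [set B | S (snd @^-1` B)] by apply.
    apply: (coord_gen CW) => [|i C mC]; last exact: (SB (inr i)).
    split => [|C SC|F SF] /=; first by rewrite preimage_set0; case: sS.
      by rewrite setTD preimage_setC -setTD; case: sS => _ h _; apply: h.
    by rewrite preimage_bigcup; case: sS => _ _; apply.
- move=> a b.
  rewrite (_ : mkset _ = [set x | forall i, a (inl i) <= coord CV i x <= b (inl i)] `*`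
      [set y | forall j, a (inr j) <= coord CW j y <= b (inr j)]).
    by apply: compact_setX; exact: coord_compact.
  apply/seteqP; split => [[x y]/= h|[x y]/= [h1 h2] [i|j]]; [|exact: h1|exact: h2].
  by split => i; [exact: (h (inl i))|exact: (h (inr i))].
- move=> M.
  rewrite (_ : mkset _ = [set x | forall i, `|coord CV i x| <= M] `*`
      [set y | forall j, `|coord CW j y| <= M]); last first.
    apply/seteqP; split => [[x y]/= h|[x y]/= [h1 h2] [i|j]]; [|exact: h1|exact: h2].
    by split => i; [exact: (h (inl i))|exact: (h (inr i))].
  rewrite prod_measureE product_measure1E.
  + by rewrite lte_mul_pinfty// ?ge0_fin_numE//; exact: coord_fin.
  + exact: measurable_coord_cube.
  + exact: measurable_coord_cube.
- move=> [v w] A mA; rewrite prod_measureE.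
  apply: (product_measure_preimage (s := fun x => x + v) (t := fun y => y + w)) => //.
  + move=> _ Y mY; rewrite setTI; move: Y mY; apply: (coord_gen CV).
      split => [|C SC|F SF] /=; first by rewrite preimage_set0.
        by rewrite setTD preimage_setC; exact: measurableC.
      by rewrite preimage_bigcup; exact: bigcup_measurable.
    move=> i B mB /=; rewrite -comp_preimage -[X in measurable X]setTI.
    rewrite (_ : _ \o _ = (fun x => coord CV i x + coord CV i v)); last first.
      by apply/funext => x /=; rewrite -{1}[x]scale1r coord_lin mul1r.
    by have := measurable_funD (measurable_coord CV i) (measurable_cst (coord CV i v)); apply.
  + by move=> B mB; exact: (coord_trans CV).
  + by move=> B mB; exact: (coord_trans CW).
Defined.

End coord_prod.

Section coord_rV.
Context (R : realType).

Lemma rV_cons_trans n (v : 'rV[R]_n.+1) (p : measurableTypeR R * 'rV[R]_n) :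
  rV_cons p + v = rV_cons (p.1 + (rV_uncons v).1, p.2 + (rV_uncons v).2).
Proof.
apply/rowP => i; rewrite !mxE /=.
by case: unliftP => [k ->|->] /=; rewrite ?mxE.
Qed.

Lemma lebesgue_rV_shift n (v : 'rV[R]_n) (A : set 'rV[R]_n) : measurable A ->
  lebesgue_rV n ((fun x => x + v) @^-1` A) = lebesgue_rV n A.
Proof.
elim: n v A => [|n IHn] v A mA.
  by congr (lebesgue_rV _ _); apply/seteqP; split => x /=; rewrite (_ : x + v = x)//; apply/rowP => -[].
rewrite /= /lebesgue_rV_step /pushforward.
rewrite -[RHS](@product_measure_preimage R _ _ _ _ lebesgue_measure (lebesgue_rV n)
  (fun x => x + (rV_uncons v).1) (fun y => y + (rV_uncons v).2))//.
- by congr (product_measure1 _ _ _); apply/seteqP; split => p /=; rewrite rV_cons_trans.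
- by apply: (@measurable_funD _ (measurableTypeR R)) => //; exact: measurable_id.
- by move=> B mB; exact: lebesgue_measure_shift.
- by move=> B mB; exact: IHn.
- by rewrite -[X in measurable X]setTI; exact: measurable_rV_cons.
Qed.

Definition coord_space_rV n : coord_space (V := 'rV[R]_n) (lebesgue_rV n).
Proof.
exists 'I_n (fun i (x : 'rV[R]_n) => x ord0 i).
- by move=> i a x y; rewrite !mxE.
- move=> x e e0; rewrite {1}/Num.norm/= mx_normrE; split => [h i|h].
    by apply: le_trans h; apply: (le_bigmax _ (fun ij => `|x ij.1 ij.2|) (ord0, i)).
  by apply/bigmax_leP; split => // -[i j] _ /=; rewrite (ord1 i).
- by move=> i; exact: measurable_matrix_entry.
- move=> S sS SB; apply: smallest_sub => // A [[i j] _ [B mB <-]] /=; rewrite setTI.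
  by rewrite (ord1 i); exact: SB.
- move=> a b; rewrite (_ : mkset _ = [set v : 'rV[R]_n | forall i, `[a i, b i]%classic (v ord0 i)]).
    by apply: (@rV_compact _ _ (fun i => `[a i, b i]%classic)) => i; exact: segment_compact.
  by apply/seteqP; split => x /= h i; have := h i; rewrite /= in_itv.
(* For negative [M] the cube is empty, except in dimension 0, where there is no condition and it is
   the one-point space. *)
- move=> M; have [M0|M0] := leP 0 M; last first.
    case: n => [|n].
      by rewrite (_ : mkset _ = setT) /= ?diracE ?ltry//; apply/seteqP; split => // x _ [].
    rewrite (_ : mkset _ = set0) ?measure0//; apply/seteqP; split => // x /(_ ord0) /=.
    by apply/negP; rewrite -ltNge; apply: lt_le_trans M0 _.
  rewrite (_ : mkset _ = rV_box (fun=> -M) (fun=> M)).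
    by rewrite lebesgue_rV_box ?ltry// => i; lra.
  by apply/seteqP; split => x /= h i; have := h i; rewrite /= in_itv/= ler_norml.
- exact: lebesgue_rV_shift.
Defined.

End coord_rV.

(** * Integrating an L^2-valued function over a set of finite measure *)

Section set_integral.
Context d1 d2 (T1 : measurableType d1) (T2 : measurableType d2) (R : realType).
Variables (m1 : {sigma_finite_measure set T1 -> \bar R})
          (m2 : {sigma_finite_measure set T2 -> \bar R}).
Variables (B : set T2) (mB : measurable B) (B_fin : (m2 B < +oo)%E).
Implicit Types (h : T1 * T2 -> R).

Let sB : sqintegrable m2 (\1_B : T2 -> R).
Proof. exact: sqintegrable_indic. Qed.

Lemma sqint_indic : sqint m2 (\1_B : T2 -> R) = m2 B.
Proof.
rewrite /sqint; under eq_integral.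
  move=> x _; rewrite (_ : _ ^+ 2 = \1_B x); last by rewrite indicE; case: (_ \in _); rewrite ?expr1n ?expr0n.
  over.
by rewrite integral_indic// setIT.
Qed.

Lemma sqint_indicM h (M : \bar R) : measurable_fun setT h -> (0 <= M)%E ->
  {ae m2, forall z, B z -> (sqint m1 (fun x => h (x, z)) <= M)%E} ->
  (sqint (m1 \x m2)%E (fun p => \1_B p.2 * h p)%R <= M * m2 B)%E.
Proof.
move=> mh M0 hM.
have m1B : measurable_fun setT (fun p : T1 * T2 => \1_B p.2 : R).
  by apply: measurableT_comp; [exact: measurable_indic|exact: measurable_snd].
rewrite sqint_slice2; last exact: measurable_funM.
have <- : (\int[m2]_z (M * (\1_B z : R)%:E) = M * m2 B)%E.
  rewrite ge0_integralZl//; first by rewrite integral_indic// setIT.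
  by apply/measurable_EFinP; exact: measurable_indic.
apply: ae_le_nnintegral => [x|x|].
- exact: sqint_ge0.
- by rewrite mule_ge0// lee_fin.
apply: filterS hM => z hz /=.
rewrite sqint_scale; last exact: measurable_slice2.
rewrite muleC indicE; have [/set_mem/hz zB|zB] := boolP (z \in B).
  by rewrite /= expr1n !mule1.
by rewrite expr0n !mule0.
Qed.

Lemma sqintegrable_indicM h (M : \bar R) : measurable_fun setT h ->
  (0 <= M < +oo)%E ->
  {ae m2, forall z, B z -> (sqint m1 (fun x => h (x, z)) <= M)%E} ->
  sqintegrable (m1 \x m2)%E (fun p => \1_B p.2 * h p)%R.
Proof.
move=> mh /andP[M0 Moo] hM; split.
  apply: measurable_funM => //.
  by apply: measurableT_comp; [exact: measurable_indic|exact: measurable_snd].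
by apply: le_lt_trans (sqint_indicM mh M0 hM) _; rewrite lte_mul_pinfty ?ge0_fin_numE.
Qed.

(** The indicator is idempotent. This replaces [h], which is only controlled over [B], by a square
    integrable function on the product. *)
Lemma pairing_indicE h : pairing m2 \1_B h = pairing m2 \1_B (fun p => \1_B p.2 * h p).
Proof.
apply/funext => x; apply: eq_Rintegral => y _ /=.
by rewrite indicE; case: (_ \in _); rewrite ?mul1r ?mul0r.
Qed.

(** A form of Minkowski's inequality. One factor [m2 B] is the square norm of the kernel, the other
    comes from integrating the bound [M] over [B]. *)
Lemma sqint_set_integral h (M : \bar R) : measurable_fun setT h ->
  (0 <= M < +oo)%E ->
  {ae m2, forall z, B z -> (sqint m1 (fun x => h (x, z)) <= M)%E} ->
  (sqint m1 (pairing m2 \1_B h) <= m2 B * (M * m2 B))%E.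
Proof.
move=> mh /[dup] M0oo /andP[M0 Moo] hM; rewrite pairing_indicE.
have := sqint_pairing sB (sqintegrable_indicM mh M0oo hM); rewrite sqint_indic.
by move/le_trans; apply; rewrite lee_wpmul2l// sqint_indicM.
Qed.

Lemma set_integral_integrable h (M : \bar R) : measurable_fun setT h ->
  (0 <= M < +oo)%E ->
  {ae m2, forall z, B z -> (sqint m1 (fun x => h (x, z)) <= M)%E} ->
  {ae m1, forall x, m2.-integrable setT (fun z => (\1_B z * h (x, z))%:E)}.
Proof.
move=> mh M0oo hM; apply: filterS (sqintegrable_slice1 (sqintegrable_indicM mh M0oo hM)) => x.
move=> /(sqintegrableM sB) /=; congr (_.-integrable _ _).
apply/funext => z; congr EFin.
by rewrite indicE; case: (_ \in _); rewrite ?mul1r ?mul0r.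
Qed.

End set_integral.

Section lebesgue_ae.
Context (R : realType).
Local Notation leb := (@lebesgue_measure R).

Lemma ae_lebesgue_itv (P : R -> Prop) (a b : R) : a < b ->
  {ae leb, forall s, P s} -> exists2 s, a < s < b & P s.
Proof.
move=> ab [A [mA A0 PA]]; apply: contrapT => nP.
have : (leb `]a, b[%classic <= leb A)%E.
  apply: le_measure; rewrite ?inE//.
  by move=> s /=; rewrite in_itv /= => sab; apply: PA => /= Ps; apply: nP; exists s.
rewrite A0 lebesgue_measure_itv /= lte_fin ab -EFinB lee_fin subr_le0.
by rewrite leNgt ab.
Qed.

Lemma ae_neq (a : R) : {ae leb, forall s, s != a}.
Proof.
exists [set a]; split => //; first exact: lebesgue_measure_set1.
by move=> s /= /negP; rewrite negbK => /eqP.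
Qed.

Lemma indic_itvD (a b r : R) : 0 <= a -> a <= b -> r != a ->
  \1_`]0, b[ r = \1_`]0, a[ r + \1_`]a, b[ r :> R.
Proof.
move=> a0 ab ra; rewrite !indicE !mem_setE !in_itv/=.
have [r0|r0] := ltP 0 r; have [ra'|ra'] := ltP r a => /=.
- by rewrite (lt_le_trans ra')// ltNge (ltW ra') /= addr0.
- have ar : a < r by rewrite lt_neqAle eq_sym ra.
  by rewrite ar add0r.
- by rewrite ltNge (ltW ra') addr0.
- by rewrite ltNge (le_trans r0 a0) addr0.
Qed.

Lemma lebesgue_itvoo (a b : R) : a <= b -> (leb : measure (measurableTypeR R) R) `]a, b[%classic = (b - a)%:E.
Proof.
move=> ab; rewrite /= lebesgue_measure_itv/= lte_fin; case: ltP => [_|ba]; first by rewrite EFinB.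
by rewrite (_ : a = b) ?subrr//; apply/le_anti; rewrite ab ba.
Qed.

Lemma sqintegrable_itv (a b : R) : sqintegrable (leb : measure (measurableTypeR R) R) \1_`]a, b[%classic.
Proof.
apply: sqintegrable_indic => //.
by rewrite /= lebesgue_measure_itv/=; case: ifP => // _; rewrite -EFinB ltry.
Qed.

End lebesgue_ae.

Section coord_theory.
Context (R : realType) d (V : measurableNormedModType d R).
Variables (mu : {sigma_finite_measure set V -> \bar R}) (C : coord_space mu).
Local Notation leb := (@lebesgue_measure R : {sigma_finite_measure set (measurableTypeR R) -> \bar R}).
Implicit Types (f g : V -> R) (v w : V).

Lemma coordD i x y : coord C i (x + y) = coord C i x + coord C i y.
Proof. by rewrite -{1}[x]scale1r coord_lin mul1r. Qed.

Lemma coord0 i : coord C i 0 = 0.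
Proof. by apply: (addrI (coord C i 0)); rewrite -coordD !addr0. Qed.

Lemma coordZ i a x : coord C i (a *: x) = a * coord C i x.
Proof. by rewrite -[a *: x]addr0 coord_lin coord0 addr0. Qed.

Lemma measurable_coordP d' (S : measurableType d') (f : S -> V) :
  (forall i, measurable_fun setT (coord C i \o f)) -> measurable_fun setT f.
Proof.
move=> mf _ Y mY; rewrite setTI; move: Y mY; apply: (coord_gen C).
  split => [|A SA|F SF] /=; first by rewrite preimage_set0.
    by rewrite setTD preimage_setC; exact: measurableC.
  by rewrite preimage_bigcup; exact: bigcup_measurable.
move=> i A mA /=; rewrite -comp_preimage -[X in measurable X]setTI.
exact: mf.
Qed.

Lemma measurable_addv d' (S : measurableType d') (f g : S -> V) :
  measurable_fun setT f -> measurable_fun setT g ->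
  measurable_fun setT (fun x => f x + g x).
Proof.
move=> mf mg; apply: measurable_coordP => i.
rewrite (_ : _ \o _ = (fun x => coord C i (f x) + coord C i (g x))).
  by apply: measurable_funD; apply: measurableT_comp => //; exact: measurable_coord.
by apply/funext => x /=; rewrite coordD.
Qed.

Lemma measurable_scalev d' (S : measurableType d') (f : S -> R) v :
  measurable_fun setT f -> measurable_fun setT (fun x => f x *: v).
Proof.
move=> mf; apply: measurable_coordP => i.
rewrite (_ : _ \o _ = (fun x => f x * coord C i v)).
  by apply: measurable_funM.
by apply/funext => x /=; rewrite coordZ.
Qed.

Lemma measurable_shift v : measurable_fun setT (fun x : V => x + v).
Proof. by apply: measurable_addv; [exact: measurable_id|exact: measurable_cst]. Qed.

Lemma measurable_ray_point v :
  measurable_fun setT (fun p : V * measurableTypeR R => p.1 + p.2 *: v).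
Proof.
by apply: measurable_addv; [exact: measurable_fst|apply: measurable_scalev; exact: measurable_snd].
Qed.

Lemma integral_shift (f : V -> \bar R) v : measurable_fun setT f ->
  (forall x, 0 <= f x)%E -> (\int[mu]_x f (x + v)%R = \int[mu]_x f x)%E.
Proof.
move=> mf f0.
rewrite -[LHS](ge0_integral_pushforward (measurable_shift v) mu (D := setT) (f := f))//.
apply: eq_measure_integral; first exact: measurable_shift.
by move=> ms B mB _; exact: (coord_trans C).
Qed.

Lemma sqint_shift f v : measurable_fun setT f -> sqint mu (fun x => f (x + v)) = sqint mu f.
Proof.
move=> mf; apply: (@integral_shift (fun x => ((f x) ^+ 2)%:E)).
- exact: measurable_sqr.
- by move=> x; rewrite lee_fin sqr_ge0.
Qed.

Lemma sqintegrable_shift f v : sqintegrable mu f -> sqintegrable mu (fun x => f (x + v)).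
Proof.
move=> [mf f2]; split; last by rewrite sqint_shift.
by apply: measurableT_comp => //; exact: measurable_shift.
Qed.

Lemma Rintegral_shift f v : measurable_fun setT f ->
  \int[mu]_x f (x + v) = \int[mu]_x f x.
Proof.
move=> mf; rewrite /Rintegral integralE [in RHS]integralE; congr (fine (_ - _)%E).
- rewrite -(@integral_shift (fun x => (EFin \o f)^\+%E x) v)//.
    by apply: eq_integral => x _; rewrite !funeposE.
  by apply: measurable_funepos; exact/measurable_EFinP.
- rewrite -(@integral_shift (fun x => (EFin \o f)^\-%E x) v)//.
    by apply: eq_integral => x _; rewrite !funenegE.
  by apply: measurable_funeneg; exact/measurable_EFinP.
Qed.

Lemma ae_shift (P : V -> Prop) v :
  {ae mu, forall x, P x} -> {ae mu, forall x, P (x + v)}.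
Proof.
move=> [A [mA A0 PA]]; exists ((fun x => x + v) @^-1` A); split.
- by rewrite -[X in measurable X]setTI; exact: measurable_shift.
- by rewrite (coord_trans C).
- by move=> x /= Px; exact: PA.
Qed.

(** By Fubini some fixed [s] has the property that [P (x + s *: v)] holds for almost every [x];
    translating back by [s *: v] gives [P]. Statements about almost every line thus become
    statements about almost every point. *)
Lemma ae_ray (P : V -> Prop) v : measurable [set x | P x] ->
  {ae mu, forall x, {ae leb, forall s, s \in `]0, 1[ -> P (x + s *: v)}} ->
  {ae mu, forall x, P x}.
Proof.
move=> mP h.
have mQ : measurable [set p : V * measurableTypeR R | p.2 \in `]0, 1[ -> P (p.1 + p.2 *: v)].
  rewrite (_ : mkset _ = ~` (snd @^-1` `]0, 1[%classic) `|`
      (fun p : V * measurableTypeR R => p.1 + p.2 *: v) @^-1` [set x | P x]); last first.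
    apply/seteqP; split => p /=.
      by move=> hp; case: (boolP (p.2 \in `]0, 1[)) => [/hp|/negP]; [right|left].
    by case=> // np /np.
  apply: measurableU.
    apply: measurableC; rewrite -[X in measurable X]setTI.
    by apply: measurable_snd => //; exact: measurable_itv.
  by rewrite -[X in measurable X]setTI; exact: measurable_ray_point.
have := ae_prod1 (m1 := mu) (m2 := leb) mQ h.
move/ae_slice2 => /(ae_lebesgue_itv (@ltr01 R)) [s s01] /(ae_shift (- (s *: v))).
by apply: filterS => x /=; rewrite in_itv /= s01 subrK; apply.
Qed.

Definition ray v s f (x : V) : R := \int[leb]_r (\1_`]0, s[ r * f (x + r *: v)).

Lemma rayE v s f : ray v s f =
  pairing leb \1_`]0, s[%classic (fun p => f (p.1 + p.2 *: v)).
Proof. by []. Qed.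

Lemma measurable_comp_ray v f : measurable_fun setT f ->
  measurable_fun setT (fun p : V * measurableTypeR R => f (p.1 + p.2 *: v)).
Proof. by move=> mf; apply: measurableT_comp => //; exact: measurable_ray_point. Qed.

Lemma sqint_ray v s f : 0 <= s -> sqintegrable mu f ->
  (sqint mu (ray v s f) <= (s ^+ 2)%:E * sqint mu f)%E.
Proof.
move=> s0 sf; rewrite rayE.
apply: (@le_trans _ _ (leb `]0%R, s[%classic * (sqint mu f * leb `]0%R, s[%classic))%E).
  apply: sqint_set_integral => //.
  - by rewrite lebesgue_itvoo// ltry.
  - exact: measurable_comp_ray sf.1.
  - by rewrite sqint_ge0; exact: sf.2.
  - by apply: aeW => r _; rewrite /= sqint_shift//; exact: sf.1.
by rewrite lebesgue_itvoo// subr0 muleCA -EFinM muleC expr2.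
Qed.

Lemma sqintegrable_ray v s f : 0 <= s -> sqintegrable mu f -> sqintegrable mu (ray v s f).
Proof.
move=> s0 sf; split.
  by rewrite rayE; apply: measurable_pairing; [exact: measurable_indic|exact: measurable_comp_ray sf.1].
by apply: le_lt_trans (sqint_ray v s0 sf) _; rewrite lte_mul_pinfty ?lee_fin ?sqr_ge0//; exact: sf.2.
Qed.

Lemma ae_ray_sqintegrable v a b f : sqintegrable mu f ->
  {ae mu, forall x, sqintegrable leb
     (fun r => \1_`]a, b[ r * f (x + r *: v))}.
Proof.
move=> sf.
apply: (sqintegrable_slice1 (m1 := mu) (m2 := leb)
  (f := fun p => \1_`]a, b[ p.2 * f (p.1 + p.2 *: v))).
apply: (@sqintegrable_indicM _ _ _ _ _ _ _ _ _ _ _ (sqint mu f)) => //.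
- by rewrite /= lebesgue_measure_itv/=; case: ifP => // _; rewrite -EFinB ltry.
- exact: measurable_comp_ray sf.1.
- by rewrite sqint_ge0; exact: sf.2.
- by apply: aeW => r _; rewrite /= sqint_shift//; exact: sf.1.
Qed.

Lemma integrable_of_sqintegrable_itv (a b : R) (h : R -> R) :
  sqintegrable leb (fun r => \1_`]a, b[ r * h r) ->
  leb.-integrable setT (fun r => (\1_`]a, b[ r * h r)%:E).
Proof.
move=> /(sqintegrableM (sqintegrable_itv a b)); congr (_.-integrable _ _).
apply/funext => z; congr EFin.
by rewrite indicE; case: (_ \in _); rewrite ?mul1r ?mul0r.
Qed.

End coord_theory.

(** * Averages along rays and continuity of translations *)

Section lebesgue_points.
Context (R : realType).
Local Notation leb := (@lebesgue_measure R : {sigma_finite_measure set (measurableTypeR R) -> \bar R}).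

Lemma nicely_shrinking_right (t : R) :
  nicely_shrinking t (fun n => `]t, t + n.+1%:R^-1[%classic).
Proof.
split => [n|]; first exact: measurable_itv.
(* The ball of radius 1/(n+1) is twice as long as the one-sided interval. *)
exists (2, fun n => (PosNum (ltac:(by []) : 0 < n.+1%:R^-1 :> R))) => /=; split => //.
- exact: cvg_harmonic.
- move=> n r; rewrite /ball /= in_itv /= => /andP[tr rt].
  have n0 : 0 < n.+1%:R^-1 :> R by [].
  by rewrite ltr_distl ltrBlDr rt (lt_trans tr)// ltrDl.
- move=> n; rewrite lebesgue_measure_ball ?invr_ge0//.
  have n0 : 0 < n.+1%:R^-1 :> R by [].
  rewrite /= lebesgue_measure_itv/= lte_fin ltrDl n0 -EFinB -EFinM lee_fin.
  by rewrite [t + _]addrC addrK mulr_natl.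
Qed.

(** Lebesgue differentiation along one-sided intervals. A function on a line is only locally square
    integrable here; the window from -1 to 3 contains every [t + r] with [t] in the unit interval
    and [r] at most 1. *)
Lemma right_average_cvg (h : R -> R) :
  sqintegrable leb (fun r => \1_`]-1, 3[ r * h r) ->
  {ae leb, forall t, t \in `]0, 1[ ->
    n.+1%:R * (\int[leb]_r (\1_`]0, n.+1%:R^-1[ r * h (t + r))) @[n --> \oo] --> h t}.
Proof.
move=> sh; pose H r := \1_`]-1, 3[ r * h r.
have iH := integrable_of_sqintegrable_itv sh.
have : {ae leb, forall t, lebesgue_pt H t}.
  exact: (lebesgue_differentiation (open_integrable_locally openT iH)).
apply: ae_mono => t tH t01.
have := nice_lebesgue_differentiation nicely_shrinking_right
  (open_integrable_locally openT iH) tH.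
have -> : \1_`](-1), 3[ t * h t = h t.
  by rewrite indicE mem_set ?mul1r//= in_itv/=; move: t01; rewrite in_itv/= => /andP[? ?]; apply/andP; split; lra.
move/fine_cvg; rewrite /=; apply: cvg_trans; apply: near_eq_cvg; near=> n.
have n0 : 0 < n.+1%:R^-1 :> R by [].
have n1 : n.+1%:R^-1 <= 1 :> R by rewrite invf_le1// ler1n.
set e := n.+1%:R^-1 in n0 n1 *; pose g y := \1_`]t, t + e[ y * H y.
have mg : measurable_fun setT g by apply: measurable_funM => //; exact: sh.1.
have ig : leb.-integrable setT (EFin \o g).
  by apply: (sqintegrableM (sqintegrable_itv _ _) sh).
have gE r : g (r + t) = \1_`]0, e[ r * h (t + r).
  rewrite /g /H !indicE !mem_setE !in_itv /= [r + t]addrC ltrDl ltrD2l.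
  have [/andP[r0 re]|] := boolP (0 < r < e); last by rewrite !mul0r.
  rewrite !mul1r; move: t01; rewrite in_itv/= => /andP[t0 t1].
  by rewrite (_ : -1 < t + r < 3) ?mul1r//; apply/andP; split; lra.
have IE : (\int[leb]_(y in `]t, (t + e)%R[%classic) (H y)%:E = (\int[leb]_y g y)%:E)%E.
  rewrite (EFin_Rintegral ig) [LHS]integral_mkcond; congr (integral _ _ _); apply/funext => y.
  by rewrite patchE /g indicE; case: (y \in _); rewrite ?mul1r ?mul0r.
rewrite -(_ : \int[leb]_y g y = \int[leb]_r (\1_`]0, e[ r * h (t + r))); last first.
  rewrite -(Rintegral_shift (coord_space_R R) t mg).
  by apply: eq_Rintegral => r _; exact: gE.
rewrite [LHS]/= -/e IE lebesgue_measure_itv/= lte_fin ltrDl n0 -EFinB addrAC subrr add0r.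
by rewrite inver gt_eqF// -EFinM /= /e invrK.
Unshelve. all: by end_near.
Qed.

End lebesgue_points.

Section steklov.
Context (R : realType) d (V : measurableNormedModType d R).
Variables (mu : {sigma_finite_measure set V -> \bar R}) (C : coord_space mu).
Local Notation leb := (@lebesgue_measure R : {sigma_finite_measure set (measurableTypeR R) -> \bar R}).
Implicit Types (f g : V -> R) (v w : V).

Lemma measurable_cvg_set (u : nat -> V -> R) f : (forall n, measurable_fun setT (u n)) ->
  measurable_fun setT f -> measurable [set x | u n x @[n --> \oo] --> f x].
Proof.
move=> mu' mf.
rewrite (_ : mkset _ = \bigcap_k \bigcup_N \bigcap_(n in [set n | (N <= n)%N])
   ((fun x => `|f x - u n x|) @^-1` `]-oo, k.+1%:R^-1[%classic)); last first.
  apply/seteqP; split => x /=.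
    move=> /cvgrPdist_lt ux k _; have k0 : 0 < k.+1%:R^-1 :> R by [].
    have [N _ Nu] := ux _ k0; by exists N.
  move=> h; apply/cvgrPdist_lt => e e0.
  have [k _ ke] := near_infty_natSinv_lt (PosNum e0).
  have [N _ Nu] := h k Logic.I; exists N => // n /= Nn.
  by have := Nu n Nn; rewrite /= in_itv/= => /lt_trans; apply; exact: (ke k (leqnn k)).
apply: bigcap_measurable => // k _; apply: bigcup_measurable => N _.
apply: bigcap_measurable => [|n _]; first by exists N => /=.
rewrite -[X in measurable X]setTI.
have : measurable_fun setT (fun x => `|f x - u n x|).
  by apply: measurableT_comp => //; exact: measurable_funB.
by apply => //; exact: measurable_itv.
Qed.

Lemma measurable_ray v s f : measurable_fun setT f -> measurable_fun setT (ray v s f).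
Proof.
move=> mf; rewrite rayE.
by apply: measurable_pairing; [exact: measurable_indic|exact: (measurable_comp_ray C)].
Qed.

(** One-dimensional differentiation on almost every line with direction [v], spread to almost every
    point by [ae_ray]. No differentiation theorem in several variables is involved. *)
Lemma ray_average_cvg v f : sqintegrable mu f ->
  {ae mu, forall x, n.+1%:R * ray v n.+1%:R^-1 f x @[n --> \oo] --> f x}.
Proof.
move=> sf; apply: (ae_ray C (v := v)).
  apply: measurable_cvg_set; last exact: sf.1.
  by move=> n; apply: measurable_funM => //; apply: measurable_ray; exact: sf.1.
apply: filterS (ae_ray_sqintegrable C v (-1) 3 sf) => x /right_average_cvg.
apply: ae_mono => s h /h; apply: cvg_trans; apply: near_eq_cvg; apply: nearW => n.
congr (_ * _); apply: eq_Rintegral => r _.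
by rewrite scalerDl addrA.
Qed.

End steklov.

Section L2_convergence.
Context d (T : measurableType d) (R : realType) (mu : {measure set T -> \bar R}).

(* Parallelogram identity plus Fatou: almost everywhere convergence without loss of
   norm is strong convergence. *)
Lemma sqint_cvg (u : nat -> T -> R) f : (forall n, sqintegrable mu (u n)) -> sqintegrable mu f ->
  (forall n, (sqint mu (u n) <= sqint mu f)%E) ->
  {ae mu, forall x, u n x @[n --> \oo] --> f x} ->
  forall e : R, 0 < e -> exists n, (sqint mu (fun x => u n x - f x)%R <= e%:E)%E.
Proof.
move=> su sf uf cuf e e0; apply: contrapT => /forallNP ne.
pose A := fine (sqint mu f); have AE : sqint mu f = A%:E by rewrite /A fineK// sqint_fin.
(* If every [u n] stayed away from [f], the parallelogram identity would push [u n + f] below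
   [4 * A - e], whereas Fatou gives at least [4 * A] in the limit. *)
have bnd n : (sqint mu (fun x => u n x + f x)%R <= (4 * A - e)%:E)%E.
  have sD := sqintegrableD (su n) sf; have sB := sqintegrableB (su n) sf.
  have := ne n; move/negP; rewrite -ltNge => en.
  have : (sqint mu (fun x => u n x + f x)%R + sqint mu (fun x => u n x - f x)%R <= (4 * A)%:E)%E.
    rewrite -ge0_integralD//; last first.
    - exact: measurable_sqr sB.1.
    - by move=> x _; rewrite lee_fin sqr_ge0.
    - exact: measurable_sqr sD.1.
    - by move=> x _; rewrite lee_fin sqr_ge0.
    rewrite (_ : (\int[mu]_x _)%E = (2%:E * sqint mu (u n) + 2%:E * sqint mu f)%E).
      rewrite AE (_ : 4 * A = 2 * A + 2 * A)%R; last by ring.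
      by rewrite [leRHS]EFinD EFinM leeD2r// lee_wpmul2l// -AE.
    rewrite -!ge0_integralZl//; try exact: measurable_sqr (su n).1;
      try exact: measurable_sqr sf.1; try by move=> x _; rewrite lee_fin sqr_ge0.
    rewrite -ge0_integralD//; first by apply: eq_integral => x _; rewrite -!EFinM -!EFinD; congr EFin; ring.
    - by move=> x _; rewrite -EFinM lee_fin mulr_ge0// sqr_ge0.
    - by apply: measurable_funeM; exact: measurable_sqr (su n).1.
    - by move=> x _; rewrite -EFinM lee_fin mulr_ge0// sqr_ge0.
    - by apply: measurable_funeM; exact: measurable_sqr sf.1.
  move: en; rewrite -(fineK (sqint_fin sD)) -(fineK (sqint_fin sB)) -EFinD !lee_fin lte_fin.
  lra.
have mS n : measurable_fun setT (fun x => ((u n x + f x) ^+ 2)%:E).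
  by apply: measurable_sqr; exact: measurable_funD (su n).1 sf.1.
have S0 n x : setT x -> (0 <= ((u n x + f x) ^+ 2)%:E)%E by rewrite lee_fin sqr_ge0.
have := fatou mu measurableT mS S0.
have einf0 (v : (\bar R)^nat) : (forall n, 0 <= v n)%E -> (0 <= limn_einf v)%E.
  move=> v0; rewrite limn_einf_lim; apply: lime_ge; first exact: is_cvg_einfs.
  by apply: nearW => n; apply: le_ereal_inf_tmp => _ [m _ <-].
have h1 : ((4 * A)%:E <= \int[mu]_x limn_einf (fun n => ((u n x + f x) ^+ 2)%:E))%E.
  have -> : ((4 * A)%:E = \int[mu]_x ((2 * f x) ^+ 2)%:E)%E.
    rewrite -/(sqint mu (fun x => 2 * f x)) sqint_scale; last exact: sf.1.
    by rewrite AE -EFinM; congr EFin; ring.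
  apply: ae_le_nnintegral => [x|x|]; first by rewrite lee_fin sqr_ge0.
    by apply: einf0 => n; rewrite lee_fin sqr_ge0.
  apply: filterS cuf => x ux.
  have : (fun n => ((u n x + f x) ^+ 2)%:E) @ \oo --> ((2 * f x) ^+ 2)%:E.
    apply: cvg_EFin; first exact: nearW.
    rewrite (_ : fine \o _ = (fun n => (u n x + f x) * (u n x + f x))); last first.
      by apply/funext => n /=; rewrite expr2.
    rewrite (_ : (2 * f x) ^+ 2 = (f x + f x) * (f x + f x)); last by ring.
    by apply: cvgM; apply: cvgD => //; exact: cvg_cst.
  by case/cvg_limn_einf_sup => ->.
have h2 : (limn_einf (fun n => sqint mu (fun x => u n x + f x)%R) <= (4 * A - e)%:E)%E.
  rewrite limn_einf_lim; apply: lime_le; first exact: is_cvg_einfs.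
  apply: nearW => n; apply: le_trans (bnd n).
  by apply: ereal_inf_lbound; exists n => /=.
move=> h3; have := le_trans h1 (le_trans h3 h2); rewrite lee_fin; lra.
Qed.

End L2_convergence.

Section translation_continuity.
Context (R : realType) d (V : measurableNormedModType d R).
Variables (mu : {sigma_finite_measure set V -> \bar R}) (C : coord_space mu).
Local Notation leb := (@lebesgue_measure R : {sigma_finite_measure set (measurableTypeR R) -> \bar R}).
Implicit Types (f g : V -> R) (v w : V).

Lemma sqintegrable_subitv (a b c e : R) (h : R -> R) : c <= a -> b <= e ->
  sqintegrable leb (fun r => \1_`]c, e[ r * h r) ->
  sqintegrable leb (fun r => \1_`]a, b[ r * h r).
Proof.
move=> ca be sh.
have hE r : \1_`]a, b[ r * h r = \1_`]a, b[ r * (\1_`]c, e[ r * h r).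
  rewrite !indicE !mem_setE !in_itv/=; have [/andP[ar rb]|] := boolP (a < r < b).
    by rewrite (le_lt_trans ca ar) (lt_le_trans rb be) !mul1r.
  by rewrite !mul0r.
apply: (le_sqintegrable _ _ sh); first by under eq_fun do rewrite hE; apply: measurable_funM => //; exact: sh.1.
move=> r; rewrite hE indicE; case: (_ \in _); rewrite ?mul1r// mul0r normr0.
exact: normr_ge0.
Qed.

Lemma rayD v a b f : 0 <= a -> 0 <= b -> sqintegrable mu f ->
  {ae mu, forall x, ray v (a + b) f x = ray v a f x + ray v b f (x + a *: v)}.
Proof.
move=> a0 b0 sf; apply: filterS (ae_ray_sqintegrable C v 0 (a + b) sf) => x sx.
pose h r := f (x + r *: v).
have s1 : sqintegrable leb (fun r => \1_`]0, a[ r * h r).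
  by apply: (sqintegrable_subitv (c := 0) (e := a + b)) => //; rewrite lerDl.
have s2 : sqintegrable leb (fun r => \1_`]a, a + b[ r * h r).
  by apply: (sqintegrable_subitv (c := 0) (e := a + b)).
have i1 := integrable_of_sqintegrable_itv s1; have i2 := integrable_of_sqintegrable_itv s2.
transitivity (\int[leb]_r (\1_`]0, a[ r * h r) + \int[leb]_r (\1_`]a, a + b[ r * h r)).
  rewrite -RintegralD//; apply: ae_eq_Rintegral; first exact: sx.1.
    by apply: measurable_funD; [exact: s1.1|exact: s2.1].
  apply: (ae_mono _ (ae_neq a)) => r ra; rewrite -mulrDl; congr (_ * _).
  by rewrite -indic_itvD// lerDl.
congr (_ + _); rewrite -(Rintegral_shift (coord_space_R R) a s2.1).
apply: eq_Rintegral => r _.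
by rewrite !indicE !mem_setE !in_itv/= [r + a]addrC ltrDl ltrD2l /h scalerDl addrA.
Qed.

(** Splitting the ray of length [s + e] in both orders exchanges the roles: shifting the integral of
    length [e] by [s] changes it exactly as shifting the integral of length [s] by [e]. The latter
    is small with [s], uniformly in [e]. *)
Lemma sqint_ray_diff v s e f : 0 <= s -> 0 <= e -> sqintegrable mu f ->
  (sqint mu (fun x => ray v e f (x + s *: v) - ray v e f x)%R <=
   (4 * s ^+ 2)%:E * sqint mu f)%E.
Proof.
move=> s0 e0 sf; have srs := sqintegrable_ray C v s0 sf.
rewrite (_ : sqint _ _ = sqint mu (fun x => ray v s f (x + e *: v) - ray v s f x)); last first.
  apply: ae_eq_sqint; move: (rayD v s0 e0 sf) (rayD v e0 s0 sf).
  by apply: filterS2 => x h1; rewrite addrC h1 => h2; lra.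
apply: (le_trans (sqint_sub mu _ _)).
- exact: (sqintegrable_shift C (e *: v) srs).1.
- exact: srs.1.
rewrite (sqint_shift C); last exact: srs.1.
have h := sqint_ray C v s0 sf.
apply: (@le_trans _ _ (2%:E * ((s ^+ 2)%:E * sqint mu f) + 2%:E * ((s ^+ 2)%:E * sqint mu f))%E).
  by apply: leeD; rewrite lee_wpmul2l ?lee_fin.
rewrite -(fineK (sqint_fin sf)) -!EFinM -EFinD lee_fin le_eqVlt; apply/orP; left.
by apply/eqP; ring.
Qed.

(** A multiple [g] of a ray integral approximates [f] in L^2: it converges almost everywhere and
    does not increase the norm, so [sqint_cvg] applies. For [g] itself the continuity is
    quantitative by [sqint_ray_diff]. *)
Lemma translation_continuity v f : sqintegrable mu f -> forall e : R, 0 < e ->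
  exists2 r : R, 0 < r & forall s, `|s| < r ->
    (sqint mu (fun x => f (x + s *: v) - f x)%R <= e%:E)%E.
Proof.
move=> sf e e0; pose A := fine (sqint mu f).
have AE : sqint mu f = A%:E by rewrite /A fineK// sqint_fin.
have A0 : 0 <= A by rewrite fine_ge0// sqint_ge0.
have su n : sqintegrable mu (fun x => n.+1%:R * ray v n.+1%:R^-1 f x).
  by apply: sqintegrableZ; exact: (sqintegrable_ray C).
(* The final estimate costs 2 (2 + 2) + 2 = 10 times this quantity. *)
have e12 : 0 < e / 12 by rewrite divr_gt0.
have [n hn] : exists n, (sqint mu (fun x => n.+1%:R * ray v n.+1%:R^-1 f x - f x)%R <= (e / 12)%:E)%E.
  apply: sqint_cvg => //; last exact: (ray_average_cvg C).
  move=> n; rewrite sqint_scale; last by apply: (measurable_ray C); exact: sf.1.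
  apply: (@le_trans _ _ ((n.+1%:R ^+ 2)%:E * ((n.+1%:R^-1 ^+ 2)%:E * sqint mu f))%E).
    by rewrite lee_wpmul2l ?lee_fin ?sqr_ge0// (sqint_ray C).
  by rewrite muleA -EFinM -exprMn divff// expr1n mul1e.
pose g x := n.+1%:R * ray v n.+1%:R^-1 f x.
have {}hn : (sqint mu (fun x => g x - f x)%R <= (e / 12)%:E)%E by exact: hn.
(* The bound obtained for a shift by [s < 1] is [s ^+ 2 * (K - 1)], which is at most [s * K], hence
   at most [e / 12]. *)
pose m : R := n.+1%:R; pose K := 4 * m ^+ 2 * A + 1.
have m0 : 0 < m by rewrite ltr0n.
have K0 : 0 < K by rewrite ltr_wpDl// !mulr_ge0.
have sg : sqintegrable mu g by exact: su.
pose r0 := Num.min 1 (e / 12 / K).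
have r00 : 0 < r0 by rewrite lt_min ltr01/= divr_gt0.
have step s : 0 <= s < r0 -> (sqint mu (fun x => g (x + s *: v) - g x)%R <= (e / 12)%:E)%E.
  move=> /andP[s0 sr].
  rewrite (_ : sqint _ _ = ((m ^+ 2)%:E * sqint mu (fun x => ray v m^-1 f (x + s *: v) - ray v m^-1 f x)%R)%E); last first.
    rewrite -sqint_scale; last first.
      have srm : sqintegrable mu (ray v m^-1 f) by apply: (sqintegrable_ray C); rewrite ?invr_ge0 ?ltW.
      by apply: measurable_funB; [exact: (sqintegrable_shift C (s *: v) srm).1|exact: srm.1].
    by congr sqint; apply/funext => x; rewrite mulrBr.
  apply: (@le_trans _ _ ((m ^+ 2)%:E * ((4 * s ^+ 2)%:E * sqint mu f))%E).
    by rewrite lee_wpmul2l ?lee_fin ?sqr_ge0// sqint_ray_diff// invr_ge0 ltW.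
  rewrite AE -!EFinM lee_fin.
  have s1 : s < 1 by apply: (lt_le_trans sr); rewrite ge_min lexx.
  have s2 : s * K <= e / 12.
    by rewrite -ler_pdivlMr//; apply/ltW/(lt_le_trans sr); rewrite ge_min lexx orbT.
  apply: le_trans s2; rewrite /K.
  have -> : m ^+ 2 * (4 * s ^+ 2 * A) = s * s * (4 * m ^+ 2 * A) by ring.
  have : 0 <= 4 * m ^+ 2 * A by rewrite !mulr_ge0// ltW.
  move: (4 * m ^+ 2 * A) => P P0; rewrite mulrDr mulr1 ler_wpDr//.
  by rewrite ler_wpM2r// ler_piMl// ltW.
have step' s : `|s| < r0 -> (sqint mu (fun x => g (x + s *: v) - g x)%R <= (e / 12)%:E)%E.
  have [s0|s0] := leP 0 s; first by rewrite ger0_norm// => sr; apply: step; rewrite s0.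
  rewrite ltr0_norm// => sr.
  (* A negative shift is reduced to a positive one by translating the whole difference. *)
  rewrite -(sqint_shift C (- s *: v)); last first.
    by apply: measurable_funB; [exact: (sqintegrable_shift C (s *: v) sg).1|exact: sg.1].
  rewrite (_ : sqint _ _ = sqint mu (fun x => g (x + - s *: v) - g x)); last first.
    rewrite -sqintN; congr sqint; apply/funext => x.
    by rewrite -addrA -scalerDl addNr scale0r addr0 opprB.
  by apply: step; rewrite oppr_ge0 ltW.
exists r0 => // s sr.
rewrite (_ : (fun x => _) = (fun x => - ((g (x + s *: v) - f (x + s *: v)) - (g x - f x))
   + (g (x + s *: v) - g x))); last by apply/funext => x; ring.
have sgf := sqintegrableB sg sf.
have sgfs := sqintegrable_shift C (s *: v) sgf.
have sgs := sqintegrableB (sqintegrable_shift C (s *: v) sg) sg.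
have sd := sqintegrableB sgfs sgf.
apply: (le_trans (sqint_add mu (sqintegrableN sd).1 sgs.1)); rewrite sqintN.
apply: (@le_trans _ _ (2%:E * (2%:E * (e / 12)%:E + 2%:E * (e / 12)%:E) + 2%:E * (e / 12)%:E)%E).
  apply: leeD; last by rewrite lee_wpmul2l ?lee_fin//; exact: step'.
  rewrite lee_wpmul2l ?lee_fin//; apply: (le_trans (sqint_sub mu sgfs.1 sgf.1)).
  rewrite (sqint_shift C (f := fun x => g x - f x)); last exact: sgf.1.
  by apply: leeD; rewrite lee_wpmul2l ?lee_fin.
by rewrite -!EFinM -EFinD lee_fin; lra.
Qed.

End translation_continuity.

(** * Test functions *)

Section bump.
Context (R : realType).
Implicit Types (p : {poly R}) (t : R).

Definition bump p t : R := if 0 < t then p.[t^-1] * expR (- t^-1) else 0.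

(** The term of degree k+1 of the exponential series. With [s] equal to 1/t it shows that [bump p]
    is bounded by a multiple of t near 0. *)
Lemma expRN_le_inv k (s : R) : 0 < s -> s ^+ k * expR (- s) <= (k.+1)`!%:R / s.
Proof.
move=> s0; have f0 : 0 < (k.+1)`!%:R :> R by rewrite ltr0n fact_gt0.
rewrite expRN ler_pdivrMr ?expR_gt0// mulrAC ler_pdivlMr// -exprSr mulrC -ler_pdivrMr//.
by apply: le_trans (expR_ge1Dxn k (ltW s0)); rewrite lerDr.
Qed.

Lemma bump_linear_bound p : exists2 K, 0 <= K & forall t, 0 < t -> `|bump p t| <= K * t.
Proof.
exists (\sum_(i < size p) `|p`_i| * (i.+1)`!%:R).
  by apply: sumr_ge0 => i _; rewrite mulr_ge0.
move=> t t0; rewrite /bump t0 horner_coef mulr_suml mulr_suml.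
apply: (le_trans (ler_norm_sum _ _ _)); apply: ler_sum => i _.
have ti : 0 < t^-1 by rewrite invr_gt0.
rewrite -mulrA normrM -mulrA ler_wpM2l// ger0_norm ?mulr_ge0 ?expR_ge0 ?exprn_ge0 ?(ltW ti)//.
by rewrite -[X in _ <= _ * X]invrK; exact: expRN_le_inv.
Qed.

Lemma is_derive_bump p t : is_derive t (1 : R) (bump p) (bump ('X^2 * (p - p^`())) t).
Proof.
have [t0|t0] := ltP 0 t.
  pose F : R -> R := fun s => p.[s^-1] * expR (- s^-1).
  apply: (@near_eq_is_derive _ _ _ F).
    near=> s; rewrite /bump ifT//; near: s; exact: lt_nbhsr.
  have tn0 : t != 0 by rewrite gt_eqF.
  have dV : is_derive t (1 : R) (fun s : R => s^-1) (- t ^- 2 *: (1 : R)).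
    exact: is_deriveV.
  have d1 : is_derive t (1 : R) (fun s : R => p.[s^-1]) (p^`().[t^-1] * (- t ^- 2 *: (1 : R))).
    by apply: (@is_derive1_comp _ (horner p) (fun s : R => s^-1)).
  have d2 : is_derive t (1 : R) (fun s : R => expR (- s^-1)) (expR (- t^-1) * - (- t ^- 2 *: (1 : R))).
    by apply: (@is_derive1_comp _ expR (fun s : R => - s^-1)).
  have d3 : is_derive t (1 : R) F _ := is_deriveM d1 d2.
  apply: is_derive_eq.
  rewrite /bump t0 !hornerE /GRing.scale /=; field.
  done.
have [K K0 hK] := bump_linear_bound p.
move: t0; rewrite le_eqVlt => /predU1P[->|t0]; last first.
  rewrite {2}/bump ltNge (ltW t0) /=.
  have hc : is_derive t (1 : R) (cst (0 : R)) 0 := is_derive_cst _ _ _.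
  apply: (near_eq_is_derive _ hc).
  near=> s; rewrite /bump ifF//; apply/negbTE; rewrite -leNgt ltW//; near: s; exact: lt_nbhsl.
rewrite {2}/bump ltxx.
(* The difference quotient at 0 is again a bump, with the polynomial multiplied by ['X]; the same
   linear bound makes it tend to 0. *)
have [L L0 hL] := bump_linear_bound ('X * p).
have cv : (fun h => h^-1 *: ((bump p \o shift 0) (h *: 1) - bump p 0)) @ (0 : R)^' --> (0 : R).
  apply/cvgrPdist_le => e e0; near=> h.
  rewrite sub0r normrN /= addr0 /GRing.scale /= mulr1 {2}/bump ltxx subr0.
  have [h0|h0] := ltP 0 h; last by rewrite /bump ltNge h0 /= mulr0 normr0 ltW.
  have -> : h^-1 * bump p h = bump ('X * p) h.
    by rewrite /bump h0 hornerM hornerX mulrA.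
  apply: le_trans (hL h h0) _.
  have he : `|h| < e / (L + 1) by near: h; apply: dnbhs0_lt; rewrite divr_gt0// ltr_wpDl.
  have L1 : 0 < L + 1 by rewrite ltr_wpDl.
  move: he; rewrite ltr_pdivlMr// gtr0_norm// => he; apply: le_trans (ltW he).
  by rewrite mulrC ler_wpM2l ?(ltW h0)// lerDl.
apply: DeriveDef; first by apply/cvg_ex; exists 0.
by rewrite /derive; apply/cvg_lim.
Unshelve. all: by end_near.
Qed.

Lemma derive_bump_affine p a b :
  derivable (bump p) a b /\ 'D_b (bump p) a = b * bump ('X^2 * (p - p^`())) a.
Proof.
have [db bE] := is_derive_bump p a.
have dif : differentiable (bump p) a by exact/derivable1_diffP.
split; first exact: diff_derivable.
by rewrite deriveE// -[b in LHS]mulr1 linearZ -deriveE// bE.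
Qed.

Lemma continuous_bump p : continuous (bump p).
Proof.
by move=> t; apply: differentiable_continuous; apply/derivable1_diffP;
  have [] := is_derive_bump p t.
Qed.

Lemma bump1E t : bump 1 t = if 0 < t then expR (- t^-1) else 0.
Proof. by rewrite /bump hornerC mul1r. Qed.

Lemma bump1_ge0 t : 0 <= bump 1 t.
Proof. by rewrite bump1E; case: ifP => // _; exact: expR_ge0. Qed.

Lemma bump1_le1 t : bump 1 t <= 1.
Proof.
rewrite bump1E; case: ifP => // t0; rewrite -[leRHS]expR0 ler_expR oppr_le0 invr_ge0.
exact: ltW.
Qed.

Lemma bump1_cvg t : bump 1 (n.+1%:R * t) @[n --> \oo] --> (if 0 < t then 1 else 0 : R).
Proof.
case: ifPn => t0; last first.
  rewrite (_ : (fun n => _) = (fun=> 0)); first exact: cvg_cst.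
  by apply/funext => n; rewrite bump1E pmulr_rgt0// (negbTE t0).
rewrite (_ : (fun n => _) = (fun n => expR (- (n.+1%:R^-1 * t^-1)))); last first.
  by apply/funext => n; rewrite bump1E pmulr_rgt0// t0 invfM.
rewrite -[X in _ --> X]expR0; apply: (@cvg_comp _ _ _ _ expR); last exact: continuous_expR.
rewrite -oppr0 -(mul0r t^-1); apply: cvgN; apply: cvgMl.
exact: cvg_harmonic.
Qed.

End bump.

Section coord_topology.
Context (R : realType) d (V : measurableNormedModType d R).
Variables (mu : {sigma_finite_measure set V -> \bar R}) (C : coord_space mu).
Implicit Types (f g phi : V -> R) (v w x : V) (a b : cidx C -> R).

Definition openbox a b : set V := [set x | forall i, a i < coord C i x < b i].
Definition closedbox a b : set V := [set x | forall i, a i <= coord C i x <= b i].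

Lemma coordB i x y : coord C i (x - y) = coord C i x - coord C i y.
Proof. by rewrite coordD -scaleN1r coordZ mulN1r. Qed.

Lemma normr_coord i x : `|coord C i x| <= `|x|.
Proof. by have [+ _] := coord_norm C x _ (normr_ge0 x); apply. Qed.

Lemma continuous_coord i : continuous (coord C i).
Proof.
move=> x; apply/cvgrPdist_lt => e e0; near=> y.
rewrite -coordB; apply: le_lt_trans (normr_coord _ _) _.
by near: y; apply: cvgr_dist_lt.
Unshelve. all: by end_near.
Qed.

Lemma measurable_coord_preimage i (B : set (measurableTypeR R)) : measurable B ->
  measurable (coord C i @^-1` B).
Proof. by move=> mB; rewrite -[X in measurable X]setTI; exact: measurable_coord. Qed.

Lemma measurable_openbox a b : measurable (openbox a b).
Proof.
rewrite (_ : openbox a b = \bigcap_(i in [set: cidx C]) (coord C i @^-1` `]a i, b i[%classic)).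
  by apply: fin_bigcap_measurable => // i _; exact: measurable_coord_preimage.
by apply/seteqP; split => x h i; have := h i; rewrite /= in_itv/= => hi; [|exact: hi].
Qed.

Lemma measurable_closedbox a b : measurable (closedbox a b).
Proof.
rewrite (_ : closedbox a b = \bigcap_(i in [set: cidx C]) (coord C i @^-1` `[a i, b i]%classic)).
  by apply: fin_bigcap_measurable => // i _; exact: measurable_coord_preimage.
by apply/seteqP; split => x h i; have := h i; rewrite /= in_itv/= => hi; [|exact: hi].
Qed.

Lemma openbox_sub_closedbox a b : openbox a b `<=` closedbox a b.
Proof. by move=> x h i; have /andP[/ltW -> /ltW ->] := h i. Qed.

(** Boxes with rational corners are countable. Those whose closure stays in [A] are kept, because
    the closed box will be the compact support of a test function in [A]. *)
Lemma open_box_cover (A : set V) : open A ->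
  exists (D : set nat) (a b : nat -> cidx C -> R),
    A = \bigcup_(n in D) openbox (a n) (b n) /\
    forall n, D n -> closedbox (a n) (b n) `<=` A.
Proof.
move=> oA; pose I := ({ffun cidx C -> rat} * {ffun cidx C -> rat})%type.
pose lo (n : nat) (i : cidx C) : R := if (unpickle n : option I) is Some p then ratr (p.1 i) else 0.
pose hi (n : nat) (i : cidx C) : R := if (unpickle n : option I) is Some p then ratr (p.2 i) else 0.
exists [set n | closedbox (lo n) (hi n) `<=` A], lo, hi; split => //.
apply/seteqP; split => [x Ax|x [n nA /openbox_sub_closedbox]]; last exact: nA.
have /nbhs_ballP [e /= e0 xe] : nbhs x A by apply: open_nbhs_nbhs.
have e20 : 0 < e / 2 by rewrite divr_gt0.
have hl i : exists q, coord C i x - e / 2 < ratr q < coord C i x.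
  by have [q] := @rat_in_itvoo R (coord C i x - e / 2) (coord C i x) (ltac:(lra)); rewrite in_itv/=; exists q.
have hr i : exists q, coord C i x < ratr q < coord C i x + e / 2.
  by have [q] := @rat_in_itvoo R (coord C i x) (coord C i x + e / 2) (ltac:(lra)); rewrite in_itv/=; exists q.
pose p := [ffun i => projT1 (cid (hl i))]; pose q := [ffun i => projT1 (cid (hr i))].
exists (pickle (p, q)); last first.
  move=> i; rewrite /lo /hi pickleK /= !ffunE.
  by case: (cid (hl i)) (cid (hr i)) => l /= /andP[_ ->] [r /= /andP[-> _]].
move=> y /= hy; apply: xe; rewrite -ball_normE /=.
apply: (@le_lt_trans _ _ (e / 2)); last by lra.
apply/(coord_norm C _ _ (ltW e20)) => i; rewrite coordB.
have := hy i; rewrite /lo /hi pickleK /= !ffunE.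
case: (cid (hl i)) (cid (hr i)) => l /= /andP[hl1 hl2] [r /= /andP[hr1 hr2]] /andP[h1 h2].
by rewrite ler_distl; apply/andP; split; lra.
Qed.

Lemma coord_open_measurable (A : set V) : open A -> measurable A.
Proof.
move=> /open_box_cover[D [a [b [-> _]]]].
rewrite bigcup_mkcond; apply: bigcup_measurable => n _; case: ifP => // _.
exact: measurable_openbox.
Qed.

Lemma coord_continuous_measurable f : continuous f -> measurable_fun setT f.
Proof.
move=> cf; apply: (measurability _ (RGenOInfty.measurableE R)).
move=> /= _ [_ [a ->]] <-; rewrite setTI; apply: coord_open_measurable.
by apply: open_comp => [x _|]; [exact: cf|exact: interval_open].
Qed.

Lemma compact_sub_closedbox (K : set V) : compact K ->
  exists M, K `<=` closedbox (fun=> - M) (fun=> M).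
Proof.
move=> /compact_bounded[M [_ hM]]; exists (M + 1) => x Kx i.
rewrite -ler_norml; apply: le_trans (normr_coord i x) _.
by apply: (hM (M + 1)) => //; rewrite ltrDl.
Qed.

Lemma closedbox_fin a b : (mu (closedbox a b) < +oo)%E.
Proof.
have [M hM] := compact_sub_closedbox (coord_compact C a b).
apply: le_lt_trans (coord_fin C M); apply: le_measure; rewrite ?inE.
- exact: measurable_closedbox.
- rewrite (_ : mkset _ = closedbox (fun=> - M) (fun=> M)); first exact: measurable_closedbox.
  by apply/seteqP; split => x h i; have := h i; rewrite /= ler_norml.
- by move=> x /hM h i; have := h i; rewrite ler_norml.
Qed.

Lemma compact_support_sqintegrable f (K : set V) : continuous f -> compact K ->
  (forall x, ~ K x -> f x = 0) -> sqintegrable mu f.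
Proof.
move=> cf cK f0; have mf := coord_continuous_measurable cf.
have [M hM] := compact_sub_closedbox cK.
have : compact (f @` K) by apply: continuous_compact => //; apply: continuous_subspaceT.
move=> /compact_bounded[B [_ hB]].
have mB := measurable_closedbox (fun=> - M) (fun=> M).
have sI : sqintegrable mu (fun x => (B + 1) * \1_(closedbox (fun=> - M) (fun=> M)) x).
  by apply: sqintegrableZ; apply: sqintegrable_indic => //; exact: closedbox_fin.
apply: (le_sqintegrable mf _ sI) => x; have [Kx|Kx] := pselect (K x).
  rewrite indicE mem_set ?mulr1; last exact: hM.
  apply: (@le_trans _ _ (B + 1)); last exact: ler_norm.
  by apply: (hB (B + 1)); [rewrite ltrDl|exists x].
by rewrite f0// normr0.
Qed.

End coord_topology.

Section smooth_functions.
Context (R : realType) d (V : measurableNormedModType d R).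
Variables (mu : {sigma_finite_measure set V -> \bar R}) (C : coord_space mu).
Implicit Types (f g phi : V -> R) (v w x : V) (a b : cidx C -> R).

Lemma derive_comp_coord (F : R -> R) i (c k : R) x v :
  derivable F (c * coord C i x + k) (c * coord C i v) ->
  derivable (fun y => F (c * coord C i y + k)) x v /\
  'D_v (fun y => F (c * coord C i y + k)) x = 'D_(c * coord C i v) F (c * coord C i x + k).
Proof.
have E : (fun h : R => h^-1 *: (((fun y => F (c * coord C i y + k)) \o shift x) (h *: v)
     - F (c * coord C i x + k))) =
  (fun h : R => h^-1 *: ((F \o shift (c * coord C i x + k)) (h *: (c * coord C i v))
     - F (c * coord C i x + k))).
  apply/funext => h /=; congr (_ *: (F _ - _)).
  by rewrite coord_lin mulrDr addrA /GRing.scale /= mulrCA.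
by rewrite /derivable /derive E.
Qed.

(* Functions obtained from the bumps of the coordinates form an algebra which is
   stable under directional derivatives, hence consist of smooth functions. *)
Inductive bump_algebra : (V -> R) -> Prop :=
| bump_algebra_bump p i c k : bump_algebra (fun x => bump p (c * coord C i x + k))
| bump_algebra_cst c : bump_algebra (fun=> c)
| bump_algebra_add f g : bump_algebra f -> bump_algebra g -> bump_algebra (fun x => f x + g x)
| bump_algebra_mul f g : bump_algebra f -> bump_algebra g -> bump_algebra (fun x => f x * g x).

Lemma bump_algebra_continuous f : bump_algebra f -> continuous f.
Proof.
elim=> {f} [p i c k|c|f g _ cf _ cg|f g _ cf _ cg] x.
- apply: (@continuous_comp _ _ _ (fun x => c * coord C i x + k) (bump p)).
    apply: cvgD; last exact: cvg_cst.
    by apply: cvgMr; exact: continuous_coord.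
  exact: continuous_bump.
- exact: cvg_cst.
- by apply: cvgD; [exact: cf|exact: cg].
- by apply: cvgM; [exact: cf|exact: cg].
Qed.

Lemma bump_algebra_derive f v : bump_algebra f ->
  (forall x, derivable f x v) /\ bump_algebra ('D_v f).
Proof.
elim=> {f} [p i c k|c|f g bf [df Df] bg [dg Dg]|f g bf [df Df] bg [dg Dg]].
- have h x := derive_comp_coord (derive_bump_affine p (c * coord C i x + k) (c * coord C i v)).1.
  split => [x|]; first exact: (h x).1.
  rewrite (_ : 'D_v _ = fun x => (c * coord C i v) * bump ('X^2 * (p - p^`())) (c * coord C i x + k)).
    by apply: bump_algebra_mul; [exact: bump_algebra_cst|exact: bump_algebra_bump].
  by apply/funext => x; rewrite (h x).2 (derive_bump_affine p _ _).2.
- split => [x|]; first exact: derivable_cst.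
  rewrite (_ : 'D_v _ = fun=> 0); first exact: bump_algebra_cst.
  by apply/funext => x; exact: derive_cst.
- split => [x|]; first exact: derivableD.
  rewrite (_ : 'D_v _ = fun x => 'D_v f x + 'D_v g x); first exact: bump_algebra_add.
  by apply/funext => x; exact: deriveD.
- split => [x|]; first exact: derivableM.
  rewrite (_ : 'D_v _ = fun x => f x * 'D_v g x + g x * 'D_v f x).
    by apply: bump_algebra_add; exact: bump_algebra_mul.
  by apply/funext => x; exact: deriveM.
Qed.

Lemma bump_algebra_smooth f : bump_algebra f -> smooth f.
Proof.
move=> bf vs; have {bf} : bump_algebra (iter_derive vs f).
  by elim: vs => //= v vs; case/(bump_algebra_derive v).
move=> bf; split; first exact: bump_algebra_continuous.
by move=> x v; exact: (bump_algebra_derive v bf).1.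
Qed.

(** Smooth functions between 0 and the indicator of the open box, which they approach pointwise as
    [n] grows. *)
Definition boxbump n a b x : R :=
  \prod_(i : cidx C) (bump 1 (n.+1%:R * (coord C i x - a i)) * bump 1 (n.+1%:R * (b i - coord C i x))).

Lemma boxbump_smooth n a b : smooth (boxbump n a b).
Proof.
apply: bump_algebra_smooth; rewrite /boxbump.
elim: (index_enum _) => [|i s IHs].
  by under eq_fun do rewrite big_nil; exact: bump_algebra_cst.
under eq_fun do rewrite big_cons; apply: bump_algebra_mul => //.
apply: bump_algebra_mul.
  under eq_fun do rewrite mulrBr; exact: bump_algebra_bump.
rewrite (_ : (fun x => _) = fun x => bump 1 (- n.+1%:R * coord C i x + n.+1%:R * b i)).
  exact: bump_algebra_bump.
by apply/funext => x; rewrite mulrBr addrC mulNr.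
Qed.

Lemma boxbump_out n a b x : ~ openbox a b x -> boxbump n a b x = 0.
Proof.
move=> /existsNP[i hi]; rewrite /boxbump (bigD1 i)//= !bump1E.
have n0 : 0 < n.+1%:R :> R by [].
rewrite !pmulr_rgt0// !subr_gt0; move/negP: hi; rewrite negb_and => /orP[] /negbTE ->;
by rewrite ?mul0r ?mulr0 ?mul0r.
Qed.

Lemma boxbump_ge0 n a b x : 0 <= boxbump n a b x.
Proof. by apply: prodr_ge0 => i _; rewrite mulr_ge0// bump1_ge0. Qed.

Lemma boxbump_le1 n a b x : boxbump n a b x <= 1.
Proof. by apply: prodr_ile1 => i _; rewrite mulr_ge0 ?mulr_ile1 ?bump1_ge0 ?bump1_le1. Qed.

Lemma boxbump_cvg a b x : boxbump n a b x @[n --> \oo] --> (\1_(openbox a b) x : R).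
Proof.
have [hx|hx] := pselect (openbox a b x); last first.
  rewrite indicE memNset// (_ : (fun n => _) = fun=> 0); first exact: cvg_cst.
  by apply/funext => n; exact: boxbump_out.
rewrite indicE mem_set//= (_ : 1 = \prod_(i : cidx C) (1 : R)); last by rewrite big1.
apply: cvg_big; first exact: mul_continuous.
move=> i _; rewrite -[X in _ --> X]mulr1; have /andP[h1 h2] := hx i; apply: cvgM.
  by have := @bump1_cvg R (coord C i x - a i); rewrite subr_gt0 h1.
by have := @bump1_cvg R (b i - coord C i x); rewrite subr_gt0 h2.
Qed.

Lemma boxbump_test (Omega : set V) n a b : closedbox a b `<=` Omega ->
  test_function Omega (boxbump n a b).
Proof.
move=> abO; split; first exact: boxbump_smooth.
exists (closedbox a b); split => //; first exact: coord_compact.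
by move=> x hx; apply: boxbump_out => /openbox_sub_closedbox.
Qed.

End smooth_functions.

(** * The fundamental lemma of the calculus of variations *)

Section fundamental_lemma.
Context (R : realType) d (V : measurableNormedModType d R).
Variables (mu : {sigma_finite_measure set V -> \bar R}) (C : coord_space mu).
Implicit Types (f g h phi : V -> R) (v w x : V) (a b : cidx C -> R).

Lemma openbox_fin a b : (mu (openbox a b) < +oo)%E.
Proof.
apply: le_lt_trans (closedbox_fin a b); apply: le_measure; rewrite ?inE.
- exact: measurable_openbox.
- exact: measurable_closedbox.
- exact: openbox_sub_closedbox.
Qed.

Lemma sqintegrable_box a b : sqintegrable mu (\1_(openbox a b) : V -> R).
Proof. by apply: sqintegrable_indic; [exact: measurable_openbox|exact: openbox_fin]. Qed.

Lemma boxbump_le_indic n a b x : boxbump n a b x <= \1_(openbox a b) x.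
Proof.
rewrite indicE; have [hx|hx] := pselect (openbox a b x).
  by rewrite mem_set// boxbump_le1.
by rewrite memNset// boxbump_out.
Qed.

Lemma measurable_boxbump n a b : measurable_fun setT (boxbump n a b).
Proof.
apply: (coord_continuous_measurable C).
by have [] := boxbump_smooth n a b [::].
Qed.

Lemma integral_openbox_eq0 (Omega : set V) h a b : sqintegrable mu h ->
  (forall phi, test_function Omega phi -> \int[mu]_x (h x * phi x) = 0) ->
  closedbox a b `<=` Omega ->
  (\int[mu]_x (h x * \1_(openbox a b) x)%:E = 0)%E.
Proof.
move=> sh h0 abO.
have : (\int[mu]_x (h x * boxbump n a b x)%:E @[n --> \oo] -->
        \int[mu]_x (h x * \1_(openbox a b) x)%:E)%E.
  apply: (@dominated_cvg _ _ _ _ _ measurableT _ _ (fun x => (`|h x * \1_(openbox a b) x|)%:E)) => //.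
  - by move=> n; apply/measurable_EFinP; apply: measurable_funM; [exact: sh.1|exact: measurable_boxbump].
  - move=> x _; apply: cvg_EFin; first exact: nearW.
    by apply: cvgMr; exact: boxbump_cvg.
  - by apply: integrable_norm; exact: (sqintegrableM sh (sqintegrable_box a b)).
  - move=> n x _; rewrite lee_fin !normrM ler_wpM2l// ger0_norm ?boxbump_ge0//.
    by apply: le_trans (boxbump_le_indic _ _ _ _) _; exact: ler_norm.
rewrite (_ : (fun n => _) = fun=> 0%E); first by move/cvg_lim => <-//; rewrite lim_cst.
apply/funext => n; rewrite -EFin_Rintegral; last first.
  apply: sqintegrableM => //; apply: le_sqintegrable (sqintegrable_box a b).
    exact: measurable_boxbump.
  by move=> x; rewrite !ger0_norm ?boxbump_ge0// boxbump_le_indic.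
by rewrite h0//; exact: boxbump_test.
Qed.

Lemma openboxI a b a' b' : openbox a b `&` openbox a' b' =
  openbox (fun i => Num.max (a i) (a' i)) (fun i => Num.min (b i) (b' i)).
Proof.
apply/seteqP; split => x.
  by move=> [h h'] i; have /andP[? ?] := h i; have /andP[? ?] := h' i;
    rewrite lt_min gt_max; apply/andP; split; apply/andP; split.
move=> h; split => i; have := h i; rewrite lt_min gt_max => /andP[/andP[? ?] /andP[? ?]];
  by apply/andP; split.
Qed.

Definition openboxes : set (set V) := [set A | exists a b, A = openbox a b].

Lemma measurable_openboxes : @measurable _ V = <<s openboxes >>.
Proof.
apply/seteqP; split; last first.
  apply: smallest_sub; first exact: sigma_algebra_measurable.
  by move=> _ [a [b ->]]; exact: measurable_openbox.
apply: (coord_gen C); first exact: smallest_sigma_algebra.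
move=> i B mB; have {mB} : (@RGenOInfty.G R).-sigma.-measurable B.
  by rewrite -RGenOInfty.measurableE.
suff : <<s @RGenOInfty.G R >> `<=` [set B | <<s openboxes >> (coord C i @^-1` B)] by apply.
apply: smallest_sub.
  split => [|A|F] /=.
  - by rewrite preimage_set0; exact: sigma_algebra0.
  - by rewrite setTD preimage_setC; exact: sigma_algebraC.
  - by rewrite preimage_bigcup; exact: sigma_algebra_bigcup.
move=> _ [c ->] /=.
(* A half-space in one coordinate is a countable union of boxes whose other sides grow with [k]. *)
rewrite (_ : _ @^-1` _ = \bigcup_k openbox (fun j => if j == i then c else - k%:R) (fun=> k%:R)).
  apply: sigma_algebra_bigcup => k; apply: sub_sigma_algebra.
  by exists (fun j => if j == i then c else - k%:R), (fun=> k%:R).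
apply/seteqP; split => x /=; rewrite in_itv/= andbT.
  move=> cx; exists (Num.truncn `|x|).+1 => // j.
  have : `|coord C j x| < (Num.truncn `|x|).+1%:R.
    by apply: le_lt_trans (normr_coord j x) _; exact: truncnS_gt.
  rewrite ltr_norml => /andP[h1 h2]; rewrite h2 andbT.
  by case: eqP => [->|_].
by move=> [k _ /(_ i)]; rewrite eqxx => /andP[].
Qed.

(** Test functions increase no further than the indicators of boxes, so [h] has integral 0 over each
    box with closure in [Omega]. Inside one such box, Dynkin's argument extends this to all
    measurable sets: boxes are stable under intersection, and the vanishing total integral takes
    care of complements. *)
Lemma fundamental_lemma (Omega : set V) h : open Omega -> sqintegrable mu h ->
  (forall phi, test_function Omega phi -> \int[mu]_x (h x * phi x) = 0) ->
  {ae mu, forall x, Omega x -> h x = 0}.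
Proof.
move=> oO sh h0; have [D [a [b [OE abO]]]] := open_box_cover C oO.
suff key n : D n -> {ae mu, forall x, openbox (a n) (b n) x -> h x = 0}.
  have : {ae mu, forall x n, D n -> openbox (a n) (b n) x -> h x = 0}.
    apply: ae_foralln => n; have [Dn|nDn] := pselect (D n); last by apply: aeW.
    by apply: filterS (key n Dn) => x hx _ /hx.
  by apply: filterS => x hx; rewrite OE => -[n Dn]; exact: hx.
move=> Dn; have {}abO := abO n Dn.
pose w x : R := h x * \1_(openbox (a n) (b n)) x.
have iw : mu.-integrable setT (EFin \o w) := sqintegrableM sh (sqintegrable_box _ _).
have PT : (\int[mu]_x (w x)%:E = 0)%E by exact: (integral_openbox_eq0 sh h0).
have wbox A : <<s openboxes >> A -> (\int[mu]_(x in A) (w x)%:E = 0)%E.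
  move: A; apply: (@dynkin_induction _ _ openboxes (fun A => (\int[mu]_(x in A) (w x)%:E = 0)%E)).
  - exact: measurable_openboxes.
  - move=> _ _ [a1 [b1 ->]] [a2 [b2 ->]]; rewrite openboxI.
    by exists (fun i => Num.max (a1 i) (a2 i)), (fun i => Num.min (b1 i) (b2 i)).
  - exact: PT.
  - move=> _ [a1 [b1 ->]].
    transitivity (\int[mu]_x (h x * \1_(openbox (a n) (b n) `&` openbox a1 b1) x)%:E)%E.
      rewrite integral_mkcond; apply: eq_integral => x _; rewrite patchE /w.
      rewrite !indicE in_setI; case: (x \in openbox a1 b1); first by rewrite andbT.
      by rewrite andbF mulr0.
    rewrite openboxI; apply: (integral_openbox_eq0 sh h0).
    apply: subset_trans abO => x hx i; have := hx i.
    by rewrite le_min ge_max => /andP[/andP[? ?] /andP[? ?]]; apply/andP; split.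
  - move=> A mA PA; move: PT; rewrite -(setUv A) integral_setU//.
    + by rewrite PA add0e.
    + exact: measurableC.
    + by rewrite setUv; exact: measurable_int iw.
    + by apply/disj_setPLR; rewrite setCK.
  - move=> F mF tF PF; rewrite integral_bigcup//; last first.
      apply: integrableS iw => //; exact: bigcup_measurable.
    by apply: eseries0 => k _ _; exact: PF.
have : ae_eq mu setT (EFin \o w) (cst 0%E).
  apply: integral_ae_eq => // E _ mE; rewrite integral_cst// mul0e.
  by apply: wbox; rewrite -measurable_openboxes.
apply: filterS => x /(_ Logic.I)[]; rewrite /w => hx xab.
by move: hx; rewrite indicE mem_set// mulr1.
Qed.

End fundamental_lemma.

(** * Weak derivatives and increments *)

Section weak_derivatives.
Context (R : realType) d (V : measurableNormedModType d R).
Variables (mu : {sigma_finite_measure set V -> \bar R}) (C : coord_space mu).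
Local Notation leb := (@lebesgue_measure R : {sigma_finite_measure set (measurableTypeR R) -> \bar R}).
Implicit Types (f g h phi U G : V -> R) (v w x : V) (Omega : set V).

Lemma test_function_derive Omega phi v : test_function Omega phi ->
  test_function Omega ('D_v phi).
Proof.
move=> [sphi [K [cK KO phi0]]]; split.
  move=> vs; have := sphi (vs ++ [:: v]).
  by rewrite /iter_derive foldr_cat.
exists K; split => // x Kx.
have oK : open (~` K) := closed_openC (compact_closed (@norm_hausdorff R V) cK).
rewrite (@near_eq_derive _ _ _ _ (cst (0 : R)) x v) ?derive_cst//.
have : nbhs x (~` K) by apply: open_nbhs_nbhs.
by apply: filterS => y; exact: phi0.
Qed.

Lemma test_function_continuous Omega phi : test_function Omega phi -> continuous phi.
Proof. by move=> [/(_ [::])[]]. Qed.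

Lemma test_function_sqintegrable Omega phi : test_function Omega phi -> sqintegrable mu phi.
Proof.
move=> tphi; have [_ [K [cK _ phi0]]] := tphi.
exact: (compact_support_sqintegrable C (test_function_continuous tphi) cK).
Qed.

Lemma derive_shift_arg phi v w x :
  (derivable (fun x => phi (x + w)) x v <-> derivable phi (x + w) v) /\
  'D_v (fun x => phi (x + w)) x = 'D_v phi (x + w).
Proof.
have E : (fun h : R => h^-1 *: (((fun y => phi (y + w)) \o shift x) (h *: v) - phi (x + w)))
   = (fun h : R => h^-1 *: ((phi \o shift (x + w)) (h *: v) - phi (x + w))).
  by apply/funext => h /=; rewrite addrA.
by rewrite /derivable /derive E.
Qed.

Lemma iter_derive_shift vs phi w :
  iter_derive vs (fun x => phi (x + w)) = (fun x => iter_derive vs phi (x + w)).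
Proof.
by elim: vs => //= v vs ->; apply/funext => x; exact: (derive_shift_arg _ _ _ _).2.
Qed.

Lemma smooth_shift phi w : smooth phi -> smooth (fun x => phi (x + w)).
Proof.
move=> sphi vs; rewrite iter_derive_shift; have [cphi dphi] := sphi vs; split.
  move=> x; apply: (@continuous_comp _ _ _ (fun x => x + w) (iter_derive vs phi)); last exact: cphi.
  by apply: cvgD => //; exact: cvg_cst.
by move=> x v; apply: (derive_shift_arg _ _ _ _).1.2.
Qed.

Lemma test_function_shift Omega Omega' phi w : test_function Omega phi ->
  (forall x, Omega x -> Omega' (x - w)) -> test_function Omega' (fun x => phi (x + w)).
Proof.
move=> [sphi [K [cK KO phi0]]] OO'; split; first exact: smooth_shift.
exists ((fun x => x - w) @` K); split.
- apply: continuous_compact => //; apply: continuous_subspaceT => x.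
  by apply: cvgD => //; exact: cvg_cst.
- by move=> _ [x Kx <-]; apply: OO'; exact: KO.
- move=> x hx; apply: phi0 => Kxw; apply: hx; exists (x + w) => //.
  by rewrite addrK.
Qed.

Lemma derivable_line phi x v r : derivable phi (x + r *: v) v ->
  is_derive r (1 : R) (fun t : R => phi (x + t *: v)) ('D_v phi (x + r *: v)).
Proof.
have E : (fun h : R => h^-1 *: (((fun t : R => phi (x + t *: v)) \o shift r) (h *: 1) - phi (x + r *: v)))
   = (fun h : R => h^-1 *: ((phi \o shift (x + r *: v)) (h *: v) - phi (x + r *: v))).
  apply/funext => h /=; congr (_ *: (phi _ - _)).
  by rewrite scaler1 scalerDl addrCA.
by move=> dphi; apply: DeriveDef; rewrite /derivable /derive E.
Qed.

Lemma integral_line_derive Omega phi x v s : test_function Omega phi -> 0 <= s ->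
  \int[leb]_r (\1_`]0, s[ r * 'D_v phi (x - r *: v)) = phi x - phi (x - s *: v).
Proof.
move=> tphi; rewrite le_eqVlt => /predU1P[<-|s0].
  rewrite scale0r subr0 subrr.
  transitivity (\int[leb]_r (0 : R)); last by rewrite Rintegral_cst// mul0r.
  by apply: eq_Rintegral => r _; rewrite set_itvoo0 indic0 mul0r.
have dphi y := (tphi.1 [::]).2 y v.
pose F (t : R) := - phi (x - t *: v).
have dF t : is_derive t (1 : R) F ('D_v phi (x - t *: v)).
  have h1 := derivable_line (dphi (x + (- t) *: v)).
  have h2 : is_derive t (1 : R) (fun t : R => - t) (- (1 : R)) := is_deriveN (is_derive_id _ _).
  have := is_deriveN (is_derive1_comp h1 h2); rewrite mulrN1 opprK scaleNr.
  by congr is_derive; apply/funext => z; rewrite /F /= -scaleNr.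
have cD : continuous (fun r : R => 'D_v phi (x - r *: v)).
  move=> r; apply: (@continuous_comp _ _ _ (fun r : R => x - r *: v) ('D_v phi)).
    apply: cvgB; first exact: cvg_cst.
    by apply: cvgZr_tmp; exact: cvg_id.
  exact: (test_function_continuous (test_function_derive v tphi)).
have cF : continuous F.
  by move=> t; apply/differentiable_continuous/derivable1_diffP; have [] := dF t.
have FTC := @continuous_FTC2 R (fun r : R => 'D_v phi (x - r *: v)) F 0 s s0.
transitivity (fine ((F s)%:E - (F 0)%:E)%E); last first.
  by rewrite -EFinB /= /F scale0r subr0 opprK addrC.
rewrite -FTC; last 3 first.
- exact: continuous_subspaceT.
- split => [t _||]; first by have [] := dF t.
  + exact/cvg_at_right_filter/cF.
  + exact/cvg_at_left_filter/cF.
- by move=> t _; rewrite derive1E; have [] := dF t.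
congr fine; rewrite integral_itv_bndoo; last first.
  by apply: measurable_funTS; apply/measurable_EFinP; exact: continuous_measurable_fun.
rewrite [RHS]integral_mkcond; congr (integral _ _ _); apply/funext => r.
by rewrite patchE indicE; case: (_ \in _); rewrite ?mul1r ?mul0r.
Qed.

End weak_derivatives.

Section integrable_slices.
Context d1 d2 (T1 : measurableType d1) (T2 : measurableType d2) (R : realType).
Variables (m1 : {sigma_finite_measure set T1 -> \bar R})
          (m2 : {sigma_finite_measure set T2 -> \bar R}).

Lemma integrable_Rintegral_slice2 (f : T1 * T2 -> R) :
  (m1 \x m2)%E.-integrable setT (EFin \o f) ->
  m2.-integrable setT (fun y => (\int[m1]_x f (x, y))%:E).
Proof.
move=> fi; apply/integrableP; split.
  apply: measurableT_comp => //; apply: measurableT_comp; first exact: fine_measurable.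
  exact: (measurable_fubini_G fi).
have mf : measurable_fun setT (EFin \o f) := measurable_int _ fi.
have := (integrable21ltyP m1 m2 mf).1 fi; apply: le_lt_trans.
apply: ae_le_nnintegral => [y|y|]; [by []|by apply: integral_ge0|].
apply: filterS (ae_integrable2 fi) => y yi; rewrite EFin_Rintegral//.
by apply: le_abse_integral => //; exact: measurable_int yi.
Qed.

End integrable_slices.

Section increments.
Context (R : realType) d (V : measurableNormedModType d R).
Variables (mu : {sigma_finite_measure set V -> \bar R}) (C : coord_space mu).
Local Notation leb := (@lebesgue_measure R : {sigma_finite_measure set (measurableTypeR R) -> \bar R}).
Implicit Types (f g h phi psi U G : V -> R) (v w x : V) (Omega : set V).

Lemma itv_fin (a b : R) : (leb `]a, b[%classic < +oo)%E.
Proof. by rewrite /= lebesgue_measure_itv/=; case: ifP => // _; rewrite -EFinB ltry. Qed.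

Lemma sqintegrable_itv_ray (a b : R) f v : sqintegrable mu f ->
  sqintegrable (mu \x leb)%E (fun p => \1_`]a, b[ p.2 * f (p.1 + p.2 *: v)).
Proof.
move=> sf; apply: (@sqintegrable_indicM _ _ _ _ _ _ _ _ _ _ _ (sqint mu f)) => //.
- exact: itv_fin.
- exact: (measurable_comp_ray C v sf.1).
- by rewrite sqint_ge0; exact: sf.2.
- by apply: aeW => r _; rewrite /= (sqint_shift C)//; exact: sf.1.
Qed.

Lemma sqintegrable_itv_cst (a b : R) f : sqintegrable mu f ->
  sqintegrable (mu \x leb)%E (fun p => \1_`]a, b[ p.2 * f p.1).
Proof.
move=> sf; apply: (@sqintegrable_indicM _ _ _ _ _ _ _ _ _ _ _ (sqint mu f)) => //.
- exact: itv_fin.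
- by apply: measurableT_comp; [exact: sf.1|exact: measurable_fst].
- by rewrite sqint_ge0; exact: sf.2.
- exact: aeW.
Qed.

Lemma integrable_itv_ray (s : R) U psi v : sqintegrable mu U -> sqintegrable mu psi ->
  (mu \x leb)%E.-integrable setT
    (EFin \o (fun p => \1_`]0, s[ p.2 * (U p.1 * psi (p.1 + p.2 *: v)))).
Proof.
move=> sU spsi.
have := sqintegrableM (sqintegrable_itv_cst 0 s sU) (sqintegrable_itv_ray 0 s v spsi).
congr (_.-integrable _ _); apply/funext => p /=; congr EFin.
by rewrite !indicE; case: (_ \in _); rewrite ?mul1r ?mul0r.
Qed.

(** The cross-correlation of [U] and [psi] along [v]. At [r = 0] it is the pairing in the definition
    of the weak derivative. *)
Definition shift_pairing U psi v r : R := \int[mu]_x (U x * psi (x + r *: v)).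

Lemma itv_shift_pairingE s U psi v r : sqintegrable mu U -> sqintegrable mu psi ->
  \int[mu]_x (\1_`]0, s[ r * (U x * psi (x + r *: v))) = \1_`]0, s[ r * shift_pairing U psi v r.
Proof.
move=> sU spsi; rewrite RintegralZl//.
by apply: sqintegrableM => //; exact: (sqintegrable_shift C).
Qed.

Lemma integrable_shift_pairing s U psi v : sqintegrable mu U -> sqintegrable mu psi ->
  leb.-integrable setT (fun r => (\1_`]0, s[ r * shift_pairing U psi v r)%:E).
Proof.
move=> sU spsi; have := integrable_Rintegral_slice2 (integrable_itv_ray s v sU spsi).
congr (_.-integrable _ _); apply/funext => r; congr EFin; exact: itv_shift_pairingE.
Qed.

Lemma ray_fubini s U psi v : sqintegrable mu U -> sqintegrable mu psi ->
  \int[leb]_r (\1_`]0, s[ r * shift_pairing U psi v r) =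
  \int[mu]_x (U x * ray v s psi x).
Proof.
move=> sU spsi; have i := integrable_itv_ray s v sU spsi.
transitivity (\int[leb]_r \int[mu]_x (\1_`]0, s[ r * (U x * psi (x + r *: v)))).
  by apply: eq_Rintegral => r _; rewrite itv_shift_pairingE.
rewrite (Rintegral_slice2 i) -(Rintegral_slice1 i) /=.
apply: ae_eq_Rintegral.
- apply: (@measurable_Rintegral_slice1 _ _ _ _ _ leb (fun p => \1_`]0, s[ p.2 * (U p.1 * psi (p.1 + p.2 *: v)))).
  by apply/measurable_EFinP; exact: measurable_int i.
- by apply: measurable_funM; [exact: sU.1|apply: (measurable_ray C); exact: spsi.1].
apply: filterS (ae_ray_sqintegrable C v 0 s spsi) => x /integrable_of_sqintegrable_itv ix.
rewrite -RintegralZl//; apply: eq_Rintegral => r _; exact: mulrCA.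
Qed.

Lemma shift_pairing_sym U psi v r : sqintegrable mu U -> sqintegrable mu psi ->
  shift_pairing U psi v r = shift_pairing psi U (- v) r.
Proof.
move=> sU spsi; rewrite /shift_pairing -(Rintegral_shift C (f := fun x => psi x * U (x + r *: - v)) (r *: v)).
  by apply: eq_Rintegral => x _; rewrite scalerN addrK mulrC.
by apply: measurable_funM; [exact: spsi.1|exact: (sqintegrable_shift C _ sU).1].
Qed.

(* Integrating the weak derivative relation for the translates of [phi] along [v]. *)
Lemma integral_increment Omega s U G v phi : 0 <= s ->
  sqintegrable mu U -> sqintegrable mu G -> test_function Omega phi ->
  \int[leb]_r (\1_`]0, s[ r * (shift_pairing U ('D_v phi) (- v) r + shift_pairing G phi (- v) r)) =
  - \int[mu]_x ((U (x + s *: v) - U x - ray v s G x) * phi x).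
Proof.
move=> s0 sU sG tphi; have sphi := test_function_sqintegrable C tphi.
have sD := test_function_sqintegrable C (test_function_derive v tphi).
have sUs := sqintegrable_shift C (s *: v) sU; have sr := sqintegrable_ray C v s0 sG.
under eq_Rintegral do rewrite mulrDr.
rewrite RintegralD//; last 2 first.
- exact: integrable_shift_pairing.
- exact: integrable_shift_pairing.
rewrite ray_fubini//.
under [X in _ + X]eq_Rintegral do rewrite shift_pairing_sym// opprK.
rewrite ray_fubini//.
transitivity (\int[mu]_x (U x * phi x) - \int[mu]_x (U (x + s *: v) * phi x) + \int[mu]_x (phi x * ray v s G x)).
  congr (_ + _).
  rewrite -[X in _ - X](Rintegral_shift C (- (s *: v))); last first.
    by apply: measurable_funM; [exact: sUs.1|exact: sphi.1].
  under [X in _ - X]eq_Rintegral do rewrite subrK.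
  rewrite -RintegralB//; last 2 first.
  - exact: sqintegrableM.
  - by apply: sqintegrableM => //; exact: (sqintegrable_shift C).
  apply: eq_Rintegral => x _; rewrite -mulrBr; congr (_ * _).
  transitivity (\int[leb]_r (\1_`]0, s[ r * 'D_v phi (x - r *: v))).
    by apply: eq_Rintegral => r _; rewrite scalerN.
  exact: (integral_line_derive x v tphi s0).
have i1 := sqintegrableM sUs sphi; have i2 := sqintegrableM sU sphi; have i3 := sqintegrableM sr sphi.
have -> : \int[mu]_x ((U (x + s *: v) - U x - ray v s G x) * phi x) =
    \int[mu]_x (U (x + s *: v) * phi x) - \int[mu]_x (U x * phi x) - \int[mu]_x (ray v s G x * phi x).
  rewrite -RintegralB// -RintegralB//; last by have := integrableB measurableT i1 i2.
  by apply: eq_Rintegral => x _; rewrite !mulrBl.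
under [X in _ + X]eq_Rintegral do rewrite mulrC.
by rewrite !opprB addrC.
Qed.

(** A tube lemma at [s = 0]: compactness makes the admissible shift uniform over [K]. *)
Lemma compact_open_ray Omega (K : set V) v : open Omega -> compact K -> K `<=` Omega ->
  exists2 r : R, 0 < r & forall s x, `|s| < r -> K x -> Omega (x + s *: v).
Proof.
move=> oO /compact_near_coveringP cK KO.
have := cK R (nbhs (0 : R)) (fun s x => Omega (x + s *: v)) _.
case.
  move=> x Kx; have cont : (fun p : V * R => p.1 + p.2 *: v) @ (x, (0 : R)) --> x + 0 *: v.
    by apply: cvgD; [exact: cvg_fst|apply: cvgZr_tmp; exact: cvg_snd].
  have nO : nbhs (x + (0 : R) *: v) Omega.
    by rewrite scale0r addr0; apply: open_nbhs_nbhs; split => //; exact: KO.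
  exact: cont nO.
move=> e /= e0 he; exists e => // s x se Kx; apply: he => //.
by rewrite /ball /= sub0r normrN.
Qed.

Lemma shift_pairing_continuous U psi v : sqintegrable mu U -> sqintegrable mu psi ->
  forall e : R, 0 < e -> exists2 r : R, 0 < r & forall s, `|s| < r ->
    `|shift_pairing U psi v s - shift_pairing U psi v 0| <= e.
Proof.
move=> sU spsi e e0; pose A := fine (sqint mu U).
have AE : sqint mu U = A%:E by rewrite /A fineK// sqint_fin.
have A0 : 0 <= A by rewrite fine_ge0// sqint_ge0.
(* Adding 1 keeps the quotient meaningful when [U] vanishes. *)
have A1 : 0 < A + 1 by rewrite ltr_wpDl.
have eA : 0 < e ^+ 2 / (A + 1) by rewrite divr_gt0// exprn_gt0.
have [r r0 hr] := translation_continuity C v spsi eA.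
exists r => // s sr; have ss := sqintegrable_shift C (s *: v) spsi.
have sB := sqintegrableB ss spsi.
have E : shift_pairing U psi v s - shift_pairing U psi v 0 = \int[mu]_x (U x * (psi (x + s *: v) - psi x)).
  rewrite /shift_pairing -RintegralB//; last 2 first.
  - exact: sqintegrableM.
  - by under eq_fun do rewrite scale0r addr0; exact: sqintegrableM.
  by apply: eq_Rintegral => x _; rewrite scale0r addr0 mulrBr.
have := sqr_integral_le sU sB; rewrite -E AE => h.
have : (((shift_pairing U psi v s - shift_pairing U psi v 0) ^+ 2)%:E <= (e ^+ 2)%:E)%E.
  apply: (le_trans h); apply: (@le_trans _ _ (A%:E * (e ^+ 2 / (A + 1))%:E)%E).
    by rewrite lee_wpmul2l ?lee_fin//; exact: hr.
  rewrite -EFinM lee_fin mulrCA ler_piMr ?sqr_ge0// ler_pdivrMr// mul1r; lra.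
by rewrite lee_fin -real_normK ?num_real// ler_pXn2r// nnegrE ltW.
Qed.

(** This undoes [integral_increment]: vanishing integrals over arbitrarily short intervals give the
    weak derivative relation for [phi] itself, which is the value at 0 of the correlation. *)
Lemma right_continuous_average0 (q : R -> R) :
  (forall s, leb.-integrable setT (fun r => (\1_`]0, s[ r * q r)%:E)) ->
  (forall e : R, 0 < e -> exists2 r : R, 0 < r & forall s, `|s| < r -> `|q s - q 0| <= e) ->
  (forall r : R, 0 < r -> exists s, 0 < s < r /\ \int[leb]_r (\1_`]0, s[ r * q r) = 0) ->
  q 0 = 0.
Proof.
move=> iq cq q0; apply/eqP; rewrite -normr_le0; apply/ler_addgt0Pr => e e0; rewrite add0r.
have [r r0 hr] := cq e e0; have [s [/andP[s0 sr] hs]] := q0 r r0.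
have ic (c : R) : leb.-integrable setT (EFin \o (fun r => \1_`]0, s[ r * c)).
  have := integrableZl measurableT c (integrable_indic_itv 0 s false true).
  by congr (_.-integrable _ _); apply/funext => t /=; rewrite mulrC EFinM.
have isE (c : R) : \int[leb]_r (\1_`]0, s[ r * c) = s * c.
  rewrite RintegralZr//; last exact: (integrable_indic_itv 0 s false true).
  by congr (_ * _); rewrite /Rintegral integral_indic// setIT; rewrite -[RHS]subr0; exact: (congr1 fine (lebesgue_itvoo (ltW s0))).
have iB : leb.-integrable setT (EFin \o (fun r => \1_`]0, s[ r * q 0 - \1_`]0, s[ r * q r)).
  by have := integrableB measurableT (ic (q 0)) (iq s).
have sqE : s * q 0 = \int[leb]_r (\1_`]0, s[ r * q 0 - \1_`]0, s[ r * q r).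
  have i1 := ic (q 0).
  have i2 : leb.-integrable setT (EFin \o (fun r => \1_`]0, s[ r * q r)) := iq s.
  rewrite (RintegralB measurableT i1 i2) isE -[LHS]subr0; congr (_ - _); exact/esym/hs.
rewrite -(ler_pM2l s0) -{1}(ger0_norm (ltW s0)) -normrM -(isE e) sqE.
apply: (le_trans (le_normr_Rintegral measurableT iB)).
apply: le_Rintegral => //; first exact: integrable_norm.
move=> t _; rewrite -mulrBr indicE mem_setE in_itv/=.
have [/andP[t0 ts]|_] := boolP (0 < t < s); last by rewrite !mul0r normr0.
by rewrite !mul1r distrC hr// gtr0_norm// (lt_trans ts).
Qed.

End increments.

Section weak_iff_increments.
Context (R : realType) d (V : measurableNormedModType d R).
Variables (mu : {sigma_finite_measure set V -> \bar R}) (C : coord_space mu).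
Local Notation leb := (@lebesgue_measure R : {sigma_finite_measure set (measurableTypeR R) -> \bar R}).
Implicit Types (f g h phi psi u U G : V -> R) (v w x : V) (Omega : set V).

(** Real-valued form of [weak_derivative], with integrals over the whole space. By
    [weak_derivativeP] both agree once functions are extended by 0 outside [Omega]. *)
Definition weakly Omega v U G := forall phi, test_function Omega phi ->
  \int[mu]_x (U x * 'D_v phi x) = - \int[mu]_x (G x * phi x).

Definition increments Omega v s U G := {ae mu, forall x, Omega x -> Omega (x + s *: v) ->
  U (x + s *: v) - U x = ray v s G x}.

Definition convex_along Omega v := forall x s r, 0 <= r <= s -> Omega x ->
  Omega (x + s *: v) -> Omega (x + r *: v).

Lemma open_shift Omega w : open Omega -> open [set x | Omega (x + w)].
Proof.
move=> oO; apply: (@open_comp _ _ (fun x => x + w) Omega) => // x _.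
by apply: cvgD => //; exact: cvg_cst.
Qed.

Lemma shift_pairing0 U psi v : shift_pairing mu U psi v 0 = \int[mu]_x (U x * psi x).
Proof. by apply: eq_Rintegral => x _; rewrite scale0r addr0. Qed.

(** A test function supported where both [x] and [x + s *: v] lie in [Omega] stays admissible when
    translated by any [r] between 0 and [s]; this is where convexity enters. The integrand of
    [integral_increment] then vanishes identically, and the fundamental lemma on the intersection
    concludes. *)
Lemma weakly_increments Omega v U G : open Omega -> convex_along Omega v ->
  sqintegrable mu U -> sqintegrable mu G -> weakly Omega v U G ->
  forall s, 0 <= s -> increments Omega v s U G.
Proof.
move=> oO cO sU sG wUG s s0.
pose O' := Omega `&` [set x | Omega (x + s *: v)].
have sH : sqintegrable mu (fun x => U (x + s *: v) - U x - ray v s G x).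
  apply: sqintegrableB; last exact: (sqintegrable_ray C).
  by apply: sqintegrableB => //; exact: (sqintegrable_shift C).
have oO' : open O' by apply: openI => //; exact: open_shift.
have h : {ae mu, forall x, O' x -> U (x + s *: v) - U x - ray v s G x = 0}.
  apply: (fundamental_lemma C oO' sH) => phi tphi.
  apply/eqP; rewrite -oppr_eq0 -(integral_increment C v s0 sU sG tphi).
  apply/eqP; transitivity (\int[leb]_r (0 : R)); last by rewrite Rintegral_cst// mul0r.
  apply: eq_Rintegral => r _; rewrite indicE mem_setE in_itv/=.
  have [/andP[r0 rs]|_] := boolP (0 < r < s); last by rewrite mul0r.
  have tr : test_function Omega (fun x => phi (x + r *: - v)).
    apply: (test_function_shift tphi) => x [Ox Oxs].
    by rewrite scalerN opprK; apply: (cO x s r) => //; rewrite !ltW.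
  have := wUG _ tr; under eq_Rintegral do rewrite (derive_shift_arg _ _ _ _).2.
  by rewrite mul1r /shift_pairing => ->; exact: addNr.
by apply: filterS h => x hx Ox Oxs; apply/eqP; rewrite -subr_eq0; apply/eqP/hx.
Qed.

(** Only short increments starting in the support of [phi] matter, and these remain in [Omega] by
    [compact_open_ray]. The steps 1/(n+1) are enough, since the correlation is continuous at 0. *)
Lemma increments_weakly Omega v U G : open Omega ->
  sqintegrable mu U -> sqintegrable mu G ->
  (forall n, increments Omega v n.+1%:R^-1 U G) -> weakly Omega v U G.
Proof.
move=> oO sU sG hUG phi tphi; have [_ [K [cK KO phi0]]] := tphi.
have sphi := test_function_sqintegrable C tphi.
have sD := test_function_sqintegrable C (test_function_derive v tphi).
pose q r := shift_pairing mu U ('D_v phi) (- v) r + shift_pairing mu G phi (- v) r.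
suff : q 0 = 0.
  rewrite /q !shift_pairing0 => /eqP; rewrite addr_eq0 => /eqP -> //.
apply: right_continuous_average0.
- move=> s; have := integrableD measurableT (integrable_shift_pairing C s (- v) sU sD)
    (integrable_shift_pairing C s (- v) sG sphi).
  by congr (_.-integrable _ _); apply/funext => r; rewrite /= -EFinD -mulrDr.
- move=> e e0; have e20 : 0 < e / 2 by rewrite divr_gt0.
  have [r1 r10 h1] := shift_pairing_continuous C (- v) sU sD e20.
  have [r2 r20 h2] := shift_pairing_continuous C (- v) sG sphi e20.
  exists (Num.min r1 r2); first by rewrite lt_min r10.
  move=> s; rewrite lt_min => /andP[/h1 {}h1 /h2 {}h2].
  rewrite /q opprD addrACA; apply: le_trans (ler_normD _ _) _.
  by apply: le_trans (lerD h1 h2) _; lra.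
- move=> r r0; have [e e0 he] := compact_open_ray v oO cK KO.
  have [n _ hn] := near_infty_natSinv_lt (PosNum (ltac:(by rewrite lt_min e0 r0) : 0 < Num.min e r)).
  have := hn n (leqnn n); rewrite /= lt_min => /andP[ne nr].
  have n0 : 0 < n.+1%:R^-1 :> R by [].
  exists n.+1%:R^-1; split; first by rewrite n0.
  rewrite (integral_increment C v (ltW n0) sU sG tphi); apply/eqP; rewrite oppr_eq0; apply/eqP.
  have sH : sqintegrable mu (fun x => U (x + n.+1%:R^-1 *: v) - U x - ray v n.+1%:R^-1 G x).
    apply: sqintegrableB; last exact: (sqintegrable_ray C).
    by apply: sqintegrableB => //; exact: (sqintegrable_shift C).
  transitivity (\int[mu]_x (0 : R)); last by rewrite Rintegral_cst// mul0r.
  apply: ae_eq_Rintegral => //; first by apply: measurable_funM; [exact: sH.1|exact: sphi.1].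
  apply: filterS (hUG n) => x hx; have [Kx|Kx] := pselect (K x).
    rewrite hx ?subrr ?mul0r//; first exact: KO.
    by apply: he => //; rewrite gtr0_norm.
  by rewrite phi0// mulr0.
Qed.

Lemma weakly_unique Omega v U G1 G2 : open Omega -> sqintegrable mu G1 -> sqintegrable mu G2 ->
  weakly Omega v U G1 -> weakly Omega v U G2 -> {ae mu, forall x, Omega x -> G1 x = G2 x}.
Proof.
move=> oO s1 s2 w1 w2.
have h : {ae mu, forall x, Omega x -> G1 x - G2 x = 0}.
  apply: (fundamental_lemma C oO (sqintegrableB s1 s2)) => phi tphi.
  have sphi := test_function_sqintegrable C tphi.
  under eq_Rintegral do rewrite mulrBl.
  rewrite RintegralB//; [|exact: sqintegrableM|exact: sqintegrableM].
  by apply/eqP; rewrite subr_eq0 -eqr_opp -w1// -w2.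
by apply: filterS h => x hx Ox; apply/eqP; rewrite -subr_eq0; apply/eqP/hx.
Qed.

Lemma ae_weakly Omega v U G U' G' : measurable_fun setT U' -> measurable_fun setT G' ->
  sqintegrable mu U -> sqintegrable mu G ->
  {ae mu, forall x, Omega x -> U x = U' x} -> {ae mu, forall x, Omega x -> G x = G' x} ->
  weakly Omega v U G -> weakly Omega v U' G'.
Proof.
move=> mU' mG' sU sG hU hG w phi tphi.
have tD := test_function_derive v tphi.
have phi0 psi x : test_function Omega psi -> ~ Omega x -> psi x = 0.
  by move=> [_ [K [_ KO psi0]]] Ox; apply: psi0 => /KO.
have mphi := (test_function_sqintegrable C tphi).1.
have mD := (test_function_sqintegrable C tD).1.
rewrite -(ae_eq_Rintegral (mu := mu) (f := fun x => U x * 'D_v phi x)); first rewrite w//; last 3 first.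
- by apply: measurable_funM => //; exact: sU.1.
- exact: measurable_funM.
- apply: filterS hU => x hx; have [/hx ->//|Ox] := pselect (Omega x).
  by rewrite (phi0 _ _ tD Ox) !mulr0.
congr (- _); apply: ae_eq_Rintegral.
- by apply: measurable_funM => //; exact: sG.1.
- exact: measurable_funM.
- apply: filterS hG => x hx; have [/hx ->//|Ox] := pselect (Omega x).
  by rewrite (phi0 _ _ tphi Ox) !mulr0.
Qed.

Lemma L2sqE Omega f : L2sq mu Omega f = sqint mu (f \_ Omega).
Proof.
rewrite /L2sq /sqint [LHS]integral_mkcond; congr (integral _ _ _); apply/funext => x; rewrite !patchE.
by case: (x \in Omega); rewrite ?expr0n.
Qed.

Lemma L2P Omega f : measurable Omega -> L2 mu Omega f <-> sqintegrable mu (f \_ Omega).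
Proof.
by move=> mO; rewrite /L2 /sqintegrable L2sqE (measurable_restrictT f mO).
Qed.

Lemma weak_derivativeP Omega v u g : measurable Omega -> L2 mu Omega u -> L2 mu Omega g ->
  weak_derivative mu Omega v u g <-> weakly Omega v (u \_ Omega) (g \_ Omega).
Proof.
move=> mO /(L2P _ mO) su /(L2P _ mO) sg.
have E f psi : sqintegrable mu (f \_ Omega) -> sqintegrable mu psi ->
    (\int[mu]_(z in Omega) (f z * psi z)%:E)%E = (\int[mu]_z ((f \_ Omega) z * psi z))%:E.
  move=> sf spsi; rewrite EFin_Rintegral; last exact: sqintegrableM.
  rewrite [LHS]integral_mkcond; congr (integral _ _ _); apply/funext => x; rewrite !patchE.
  by case: (x \in Omega); rewrite ?mul0r.
split=> h phi tphi; have := h phi tphi;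
  have sphi := test_function_sqintegrable C tphi;
  have sD := test_function_sqintegrable C (test_function_derive v tphi).
  by rewrite !E// -EFinN => -[].
by rewrite !E// -EFinN => ->.
Qed.

End weak_iff_increments.

(** * Slices *)

(* Both fibrations of a product, by horizontal and by vertical lines. *)
Record slicing (R : realType) dX dY dZ (X : measurableNormedModType dX R)
    (Y : measurableType dY) (Z : measurableNormedModType dZ R)
    (mu : {sigma_finite_measure set X -> \bar R})
    (lam : {sigma_finite_measure set Y -> \bar R})
    (nu : {sigma_finite_measure set Z -> \bar R}) := Slicing {
  slice : Y -> Z -> X;
  incl : Z -> X;
  proj : X -> Z;
  slice_ray : forall y z s v, slice y (z + s *: v) = slice y z + s *: incl v;
  proj_slice : forall y z, proj (slice y z) = z;
  proj_continuous : continuous proj;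
  slice_continuous : forall y, continuous (slice y);
  slice_measurable : forall d (T : measurableType d) (f : X -> T) y,
    measurable_fun setT f -> measurable_fun setT (fun z => f (slice y z));
  slice_ae : forall P : X -> Prop, {ae mu, forall x, P x} ->
    {ae lam, forall y, {ae nu, forall z, P (slice y z)}};
  slice_ae_inv : forall P : X -> Prop, measurable [set x | P x] ->
    {ae lam, forall y, {ae nu, forall z, P (slice y z)}} -> {ae mu, forall x, P x};
  slice_sqint : forall f : X -> R, measurable_fun setT f ->
    sqint mu f = (\int[lam]_y sqint nu (fun z => f (slice y z)))%E;
  slice_measurable_sqint : forall f : X -> R, measurable_fun setT f ->
    measurable_fun setT (fun y => sqint nu (fun z => f (slice y z)));
  slice_measurable_Rintegral : forall f : X -> R, measurable_fun setT f ->
    measurable_fun setT (fun y => \int[nu]_z f (slice y z));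
  slice_fubini : forall f : X -> R, mu.-integrable setT (EFin \o f) ->
    \int[lam]_y (\int[nu]_z f (slice y z)) = \int[mu]_x f x
}.
Arguments slice {R dX dY dZ X Y Z mu lam nu} _ _ _.
Arguments incl {R dX dY dZ X Y Z mu lam nu} _ _.
Arguments proj {R dX dY dZ X Y Z mu lam nu} _ _.

Section slicing_prod.
Context (R : realType) d1 d2 (V : measurableNormedModType d1 R) (W : measurableNormedModType d2 R).
Variables (mu : {sigma_finite_measure set V -> \bar R}) (nu : {sigma_finite_measure set W -> \bar R}).

Lemma cvg_pair_l (y : W) (x : V) : (fun x => (x, y)) @ x --> (x, y).
Proof. by apply: cvg_pair; [exact: cvg_id|exact: cvg_cst]. Qed.

Lemma cvg_pair_r (y : W) (x : V) : (fun y => (x, y)) @ y --> (x, y).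
Proof. by apply: cvg_pair; [exact: cvg_cst|exact: cvg_id]. Qed.

Definition slicing_h : slicing (X := (V * W)%type) (prod_measure mu nu) nu mu.
Proof.
exists (fun y x => (x, y)) (fun v => (v, 0)) fst.
- by move=> y z s v; congr pair; rewrite /= scaler0 addr0.
- by [].
- by move=> x; exact: cvg_fst.
- by move=> y x; exact: cvg_pair_l.
- by move=> d T f y; exact: measurable_slice2.
- exact: ae_slice2.
- by move=> P mP; apply: ae_prod2.
- exact: sqint_slice2.
- exact: measurable_sqint_slice2.
- move=> f mf; apply: (@measurable_Rintegral_slice1 _ _ _ _ _ mu (fun p => f (p.2, p.1))).
  apply: measurableT_comp => //.
  by apply: measurable_fun_pair; [exact: measurable_snd|exact: measurable_fst].
- exact: Rintegral_slice2.
Defined.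

Definition slicing_v : slicing (X := (V * W)%type) (prod_measure mu nu) mu nu.
Proof.
exists (fun x y => (x, y)) (fun w => (0, w)) snd.
- by move=> y z s v; congr pair; rewrite /= scaler0 addr0.
- by [].
- by move=> x; exact: cvg_snd.
- by move=> x y; exact: cvg_pair_r.
- by move=> d T f y; exact: measurable_slice1.
- exact: ae_slice1.
- by move=> P mP; apply: ae_prod1.
- exact: sqint_slice1.
- exact: measurable_sqint_slice1.
- exact: measurable_Rintegral_slice1.
- exact: Rintegral_slice1.
Defined.

End slicing_prod.

Section slice_derivatives.
Context (R : realType) dX dY dZ (X : measurableNormedModType dX R)
  (Y : measurableType dY) (Z : measurableNormedModType dZ R).
Variables (mu : {sigma_finite_measure set X -> \bar R})
  (lam : {sigma_finite_measure set Y -> \bar R})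
  (nu : {sigma_finite_measure set Z -> \bar R}).
Variables (CX : coord_space mu) (CZ : coord_space nu) (S : slicing mu lam nu).
Local Notation sl := (slice S).
Implicit Types (f g U G phi : X -> R) (v : Z) (Omega : set X).

Lemma slice_sqintegrable f : sqintegrable mu f ->
  {ae lam, forall y, sqintegrable nu (fun z => f (sl y z))}.
Proof.
move=> [mf f2]; have ms := slice_measurable_sqint S mf.
have : lam.-integrable setT (fun y => sqint nu (fun z => f (sl y z))).
  apply/integrableP; split; first exact: ms.
  by under eq_integral do rewrite gee0_abs ?sqint_ge0//; rewrite -(slice_sqint S).
move/(integrable_ae measurableT); apply: filterS => y /(_ Logic.I) fy; split.
  exact: (slice_measurable S).
by rewrite -ge0_fin_numE// sqint_ge0.
Qed.

Lemma slice_derive phi y z v :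
  (derivable (fun z => phi (sl y z)) z v <-> derivable phi (sl y z) (incl S v)) /\
  'D_v (fun z => phi (sl y z)) z = 'D_(incl S v) phi (sl y z).
Proof.
have E : (fun h : R => h^-1 *: (((fun z => phi (sl y z)) \o shift z) (h *: v) - phi (sl y z)))
   = (fun h : R => h^-1 *: ((phi \o shift (sl y z)) (h *: incl S v) - phi (sl y z))).
  by apply/funext => h /=; congr (_ *: (phi _ - _)); rewrite addrC slice_ray addrC.
by rewrite /derivable /derive E.
Qed.

Lemma slice_iter_derive (vs : seq Z) phi y :
  iter_derive vs (fun z => phi (sl y z)) = (fun z => iter_derive [seq incl S v | v <- vs] phi (sl y z)).
Proof.
by elim: vs => //= v vs ->; apply/funext => z; exact: (slice_derive _ _ _ _).2.
Qed.

Lemma slice_test Omega (Omega1 : set Z) phi y : test_function Omega phi ->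
  (forall x, Omega x -> Omega1 (proj S x)) -> test_function Omega1 (fun z => phi (sl y z)).
Proof.
move=> [sphi [K [cK KO phi0]]] OO1; split.
  move=> vs; rewrite slice_iter_derive.
  have [cphi dphi] := sphi [seq incl S v | v <- vs]; split.
    move=> z; apply: (@continuous_comp _ _ _ (sl y) (iter_derive [seq incl S v | v <- vs] phi)).
      exact: slice_continuous.
    exact: cphi.
  by move=> z v; apply: (slice_derive _ _ _ _).1.2.
exists (proj S @` K); split.
- by apply: continuous_compact => //; apply: continuous_subspaceT; exact: proj_continuous.
- by move=> _ [x Kx <-]; apply: OO1; exact: KO.
- move=> z hz; apply: phi0 => Kz; apply: hz; exists (sl y z) => //; exact: proj_slice.
Qed.

Lemma slice_weakly Omega (Omega1 : set Z) (Omega2 : set Y) v U G :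
  open Omega -> convex_along Omega (incl S v) -> open Omega1 ->
  (forall y z, Omega2 y -> Omega1 z -> Omega (sl y z)) ->
  sqintegrable mu U -> sqintegrable mu G -> weakly mu Omega (incl S v) U G ->
  {ae lam, forall y, Omega2 y ->
    weakly nu Omega1 v (fun z => U (sl y z)) (fun z => G (sl y z))}.
Proof.
move=> oO cO oO1 O21 sU sG w.
have inc : {ae lam, forall y, forall n, {ae nu, forall z, Omega (sl y z) ->
   Omega (sl y z + n.+1%:R^-1 *: incl S v) ->
   U (sl y z + n.+1%:R^-1 *: incl S v) - U (sl y z) = ray (incl S v) n.+1%:R^-1 G (sl y z)}}.
  (* For almost every slice, all countably many steps are good at the same time; test functions on
     the slice come in only afterwards. *)
  apply: ae_foralln => n; have n0 : 0 <= n.+1%:R^-1 :> R by [].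
  exact: (slice_ae S (weakly_increments CX oO cO sU sG w n0)).
move: (slice_sqintegrable sU) (slice_sqintegrable sG).
apply: filterS3 inc => y hy sUy sGy y2.
apply: (increments_weakly CZ oO1 sUy sGy) => n.
apply: filterS (hy n) => z hz z1 z1n.
rewrite slice_ray hz; last by rewrite -slice_ray; exact: O21.
  by apply: eq_Rintegral => r _; rewrite slice_ray.
exact: O21.
Qed.

Lemma weakly_of_slices Omega (Omega1 : set Z) (Omega2 : set Y) v U G :
  (forall y z, Omega (sl y z) -> Omega2 y) -> (forall x, Omega x -> Omega1 (proj S x)) ->
  sqintegrable mu U -> sqintegrable mu G ->
  {ae lam, forall y, Omega2 y ->
    weakly nu Omega1 v (fun z => U (sl y z)) (fun z => G (sl y z))} ->
  weakly mu Omega (incl S v) U G.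
Proof.
move=> OO2 OO1 sU sG w phi tphi.
have tD := test_function_derive (incl S v) tphi.
have sphi := test_function_sqintegrable CX tphi; have sD := test_function_sqintegrable CX tD.
have i1 := sqintegrableM sU sD; have i2 := sqintegrableM sG sphi.
apply/eqP; rewrite -subr_eq0 opprK -RintegralD//; apply/eqP.
rewrite -(slice_fubini S); last by have := integrableD measurableT i1 i2.
transitivity (\int[lam]_y (0 : R)); last by rewrite Rintegral_cst// mul0r.
have phi0 psi y : test_function Omega psi -> ~ Omega2 y -> forall z, psi (sl y z) = 0.
  move=> [_ [K [_ KO psi0]]] y2 z; apply: psi0 => /KO Oz; apply: y2.
  exact: OO2 Oz.
apply: ae_eq_Rintegral => //.
  apply: (slice_measurable_Rintegral S (f := fun x => U x * 'D_(incl S v) phi x + G x * phi x)).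
  by apply: measurable_funD; apply: measurable_funM; [exact: sU.1|exact: sD.1|exact: sG.1|exact: sphi.1].
move: (slice_sqintegrable sU) (slice_sqintegrable sG); apply: filterS3 w => y wy sUy sGy.
have [y2|y2] := pselect (Omega2 y); last first.
  transitivity (\int[nu]_z (0 : R)); last by rewrite Rintegral_cst// mul0r.
  by apply: eq_Rintegral => z _; rewrite (phi0 _ _ tphi)// (phi0 _ _ tD)// !mulr0 addr0.
have t1 := slice_test y tphi OO1.
have := wy y2 _ t1; under eq_Rintegral do rewrite (slice_derive _ _ _ _).2.
have s1 := test_function_sqintegrable CZ t1.
have s2 := test_function_sqintegrable CZ (slice_test y tD OO1).
rewrite RintegralD//; [|exact: sqintegrableM|exact: sqintegrableM].
by move=> ->; exact: addNr.
Qed.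

(* A jointly measurable weak derivative is the upper limit of difference quotients. *)
Lemma joint_weak_derivative Omega (Omega1 : set Z) (Omega2 : set Y) v U (B : Y -> \bar R) :
  open Omega -> open Omega1 -> convex_along Omega1 v ->
  (forall y z, Omega (sl y z) <-> Omega2 y /\ Omega1 z) ->
  (forall x, Omega x -> Omega1 (proj S x)) ->
  sqintegrable mu U -> (forall y, 0 <= B y)%E -> (\int[lam]_y B y < +oo)%E ->
  {ae lam, forall y, Omega2 y -> exists g : Z -> R, [/\ sqintegrable nu g,
     weakly nu Omega1 v (fun z => U (sl y z)) g & (sqint nu g <= B y)%E]} ->
  exists G, sqintegrable mu G /\ weakly mu Omega (incl S v) U G.
Proof.
move=> oO oO1 cO1 OE OO1 sU B0 Boo hB.
have mO : measurable Omega := coord_open_measurable CX oO.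
pose q n x := n.+1%:R * (U (x + n.+1%:R^-1 *: incl S v) - U x).
pose L x := limn_esup (fun n => (q n x)%:E).
(* A measurable function defined everywhere. On a good slice the upper limit is a finite limit, so
   [fine] loses nothing there. *)
pose G := (fine \o L) \_ Omega.
have mq n : measurable_fun setT (q n).
  apply: measurable_funM => //; apply: measurable_funB; last exact: sU.1.
  exact: (sqintegrable_shift CX _ sU).1.
have mG : measurable_fun setT G.
  apply/(measurable_restrictT _ mO); apply: measurable_funTS.
  apply: measurableT_comp; first exact: fine_measurable.
  by apply: measurable_fun_limn_esup => n; exact/measurable_EFinP.
have good : {ae lam, forall y, Omega2 y -> exists g : Z -> R, [/\ sqintegrable nu g,
     weakly nu Omega1 v (fun z => U (sl y z)) g, (sqint nu g <= B y)%E &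
     {ae nu, forall z, Omega1 z -> G (sl y z) = g z}]}.
  apply: filterS2 hB (slice_sqintegrable sU) => y hy sUy /[dup] y2 /hy[g [sg wg gB]].
  exists g; split => //.
  have inc : {ae nu, forall z, forall n, Omega1 z -> Omega1 (z + n.+1%:R^-1 *: v) ->
     U (sl y (z + n.+1%:R^-1 *: v)) - U (sl y z) = ray v n.+1%:R^-1 g z}.
    apply: ae_foralln => n; have n0 : 0 <= n.+1%:R^-1 :> R by [].
    exact: (weakly_increments CZ oO1 cO1 sUy sg wg n0).
  apply: filterS2 inc (ray_average_cvg CZ v sg) => z incz rz z1.
  rewrite /G patchE mem_set; last by apply/OE.
  suff : (fun n => (q n (sl y z))%:E) @ \oo --> (g z)%:E.
    by case/cvg_limn_einf_sup => _; rewrite /= /L => ->.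
  apply: cvg_EFin; first by apply: nearW.
  (* As [Omega1] is open, [z + n.+1%:R^-1 *: v] eventually belongs to it, and from then on the
     difference quotient of [U] is the ray average of [g]. *)
  apply: cvg_trans rz; apply: near_eq_cvg.
  have nO : nbhs z Omega1 by apply: open_nbhs_nbhs.
  have cv : (fun n => z + n.+1%:R^-1 *: v) @ \oo --> z.
    rewrite -[X in _ --> X]addr0 -(scale0r v); apply: cvgD; first exact: cvg_cst.
    by apply: cvgZr_tmp; exact: cvg_harmonic.
  have [M _ hM] := cv _ nO; exists M => // n Mn.
  by rewrite /= /q -slice_ray incz//; exact: (hM n Mn).
have sG : sqintegrable mu G.
  (* [B] carries no measurability, so the slices are compared by [ae_le_nnintegral]. *)
  split => //; rewrite (slice_sqint S mG); apply: le_lt_trans Boo.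
  apply: ae_le_nnintegral => [y|//|]; first exact: sqint_ge0.
  apply: filterS good => y hy; have [y2|y2] := pselect (Omega2 y); last first.
    rewrite (_ : sqint _ _ = 0%E) ?B0//; rewrite /sqint integral0_eq// => z _.
    rewrite /G patchE memNset ?expr0n//.
    by move=> /OE[].
  have [g [sg _ gB hg]] := hy y2; apply: le_trans gB.
  apply: ae_le_nnintegral => [z|z|]; rewrite ?lee_fin ?sqr_ge0//.
  apply: filterS hg => z hz; have [z1|z1] := pselect (Omega1 z); first by rewrite hz.
  rewrite /G patchE memNset ?expr0n ?lee_fin ?sqr_ge0//.
  by move=> /OE[].
exists G; split => //.
apply: (@weakly_of_slices Omega Omega1 Omega2) => //.
  by move=> y z /OE[].
apply: filterS2 good (slice_sqintegrable sU) => y hy sUy y2; have [g [sg wg _ hg]] := hy y2.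
apply: (@ae_weakly _ _ _ _ CZ Omega1 v (fun z => U (sl y z)) g) => //.
- exact: sUy.1.
- exact: (slice_measurable S).
- exact: aeW.
- by apply: filterS hg => z hz /hz.
Qed.

End slice_derivatives.

(** * Functions on an interval *)

Section primitive.
Context (R : realType).
Local Notation leb := (@lebesgue_measure R : {sigma_finite_measure set (measurableTypeR R) -> \bar R}).
Implicit Types (h k : R -> R) (a b c y s t : R).

Definition prim k y : R := \int[leb]_r (\1_`]0, y[ r * k r).

Lemma integrable_itvM a b k : sqintegrable leb k ->
  leb.-integrable setT (EFin \o (fun r => \1_`]a, b[ r * k r)).
Proof. by move=> sk; exact: (sqintegrableM (sqintegrable_itv a b) sk). Qed.

Lemma primB k a b : sqintegrable leb k -> 0 <= a <= b ->
  prim k b - prim k a = \int[leb]_r (\1_`]a, b[ r * k r).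
Proof.
move=> sk /andP[a0 ab]; apply/eqP; rewrite subr_eq addrC; apply/eqP.
have i1 := integrable_itvM 0 a sk; have i2 := integrable_itvM a b sk.
rewrite /prim -(RintegralD measurableT i1 i2); apply: ae_eq_Rintegral.
- by apply: measurable_funM => //; exact: sk.1.
- by apply: measurable_funD; apply: measurable_funM => //; exact: sk.1.
by apply: (ae_mono _ (ae_neq a)) => r ra; rewrite -mulrDl -indic_itvD.
Qed.

Lemma prim_neg k y : y <= 0 -> prim k y = 0.
Proof.
move=> y0; rewrite /prim; transitivity (\int[leb]_r (0 : R)); last by rewrite Rintegral_cst// mul0r.
apply: eq_Rintegral => r _; rewrite indicE mem_setE in_itv/=.
by have [/andP[r0 ry]|_] := boolP (0 < r < y); rewrite ?mul0r//; move: (lt_trans r0 ry); rewrite ltNge y0.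
Qed.

Lemma sqr_integral_itv_le a b k : sqintegrable leb k -> a <= b ->
  (\int[leb]_r (\1_`]a, b[ r * k r)) ^+ 2 <= (b - a) * fine (sqint leb k).
Proof.
move=> sk ab; have := sqr_integral_le (sqintegrable_itv a b) sk.
rewrite sqint_indic// (lebesgue_itvoo ab) -{1}(fineK (sqint_fin sk)) -EFinM.
by rewrite lee_fin.
Qed.

(** Cauchy-Schwarz on the interval gives Hölder continuity of exponent 1/2. Since [prim] is constant
    on the negative half-line, an interval that starts there is shortened. *)
Lemma prim_dist k a b : sqintegrable leb k ->
  (prim k b - prim k a) ^+ 2 <= `|b - a| * fine (sqint leb k).
Proof.
move=> sk; have s0 : 0 <= fine (sqint leb k) by rewrite fine_ge0// sqint_ge0.
wlog ab : a b / a <= b.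
  move=> hw; have [ab|/ltW ba] := leP a b; first exact: hw.
  by rewrite -sqrrN opprB distrC; exact: hw.
rewrite ger0_norm ?subr_ge0//.
have [a0|a0] := leP 0 a; first by rewrite primB// ?a0//; exact: sqr_integral_itv_le.
rewrite (prim_neg _ (ltW a0)) subr0; have [b0|b0] := leP b 0.
  by rewrite prim_neg// expr0n mulr_ge0// subr_ge0.
apply: (@le_trans _ _ ((b - 0) * fine (sqint leb k))).
  by apply: sqr_integral_itv_le => //; exact: ltW.
by rewrite ler_wpM2r// lerD2l lerN2 ltW.
Qed.

Lemma continuous_prim k : sqintegrable leb k -> continuous (prim k).
Proof.
move=> sk y; pose A := fine (sqint leb k).
have A0 : 0 <= A by rewrite fine_ge0// sqint_ge0.
have A1 : 0 < A + 1 by rewrite ltr_wpDl.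
apply/cvgrPdist_le => e e0; near=> z.
have he : `|y - z| < e ^+ 2 / (A + 1).
  by near: z; apply: cvgr_dist_lt => //; rewrite divr_gt0// exprn_gt0.
have h := prim_dist z y sk.
have : `|prim k y - prim k z| ^+ 2 <= e ^+ 2.
  rewrite real_normK ?num_real//; apply: (le_trans h).
  move: he; rewrite ltr_pdivlMr// => he; apply: le_trans (ltW he).
  by rewrite ler_wpM2l// lerDl.
by rewrite ler_pXn2r// nnegrE ltW.
Unshelve. all: by end_near.
Qed.

(** For [l = len e] this is convertible to [edge_open e], so statements about intervals apply to
    edges directly. *)
Definition left_interval (l : \bar R) : set (measurableTypeR R) := [set y | 0 < y /\ (y%:E < l)%E].

Lemma open_left_interval l : open (left_interval l).
Proof.
rewrite (_ : left_interval l = [set y : R | 0 < y] `&` [set y : R | (y%:E < l)%E]).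
  apply: openI; first exact: open_gt.
  by case: l => [r| |]; [rewrite (_ : mkset _ = [set y | y < r])|rewrite (_ : mkset _ = setT)|
    rewrite (_ : mkset _ = set0)]; [exact: open_lt| |exact: openT| |exact: open0|];
    apply/seteqP; split => y //=; rewrite ?ltry.
by [].
Qed.

Lemma scaler1R s : s *: (1 : measurableTypeR R) = s.
Proof. exact: mulr1. Qed.

Lemma convex_left_interval l : convex_along (left_interval l) (1 : R).
Proof.
move=> y s r /andP[r0 rs]; rewrite /left_interval /= !scaler1R => -[y0 yl] [ys0 ysl].
by split; [rewrite ltr_wpDr|apply: le_lt_trans ysl; rewrite lee_fin lerD2l].
Qed.

Lemma left_interval_lt l : (0 < l)%E -> exists2 a, 0 < a & `]0, a[ `<=` left_interval l.
Proof.
case: l => [r| |//].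
  rewrite lte_fin => r0; exists r => // y /=; rewrite in_itv/= => /andP[y0 yr].
  by split => //; rewrite lte_fin.
by exists 1 => // y /=; rewrite in_itv/= => /andP[y0 _]; split => //; rewrite ltry.
Qed.

(** The difference [u] of [h] and [prim k] satisfies [u (y + s) = u y] for almost every [y], with a
    null set depending on [s]. Fubini turns this into equality for almost all pairs of points, and
    the constant is the value of [u] at one good point. *)
Lemma interval_representation l h k : (0 < l)%E -> sqintegrable leb h -> sqintegrable leb k ->
  weakly (V := measurableTypeR R) leb (left_interval l) (1 : R) h k ->
  exists c, {ae leb, forall y, left_interval l y -> h y = c + prim k y}.
Proof.
move=> l0 sh sk w; pose CR := coord_space_R R; pose E := left_interval l.
pose u y := h y - prim k y.
have mu' : measurable_fun setT u.
  by apply: measurable_funB; [exact: sh.1|exact: continuous_measurable_fun (continuous_prim sk)].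
have inc s : 0 <= s -> {ae leb, forall y, E y -> E (y + s) -> u (y + s) = u y}.
  move=> s0; have := weakly_increments CR (@open_left_interval l) (@convex_left_interval l) sh sk w s0.
  apply: ae_mono => y hy Ey Eys.
  have := hy Ey; rewrite scaler1R => /(_ Eys) /eqP.
  rewrite subr_eq => /eqP; rewrite /u => ->.
  suff : ray (1 : measurableTypeR R) s k y = prim k (y + s) - prim k y by lra.
  rewrite primB//; last by rewrite (ltW Ey.1) lerDl.
  rewrite -(Rintegral_shift CR y (f := fun r => \1_`]y, y + s[ r * k r)).
    apply: eq_Rintegral => r _; rewrite !indicE !mem_setE !in_itv/= scaler1R.
    by rewrite [r + y]addrC ltrDl ltrD2l.
  by apply: measurable_funM => //; exact: sk.1.
have mE : measurable E := coord_open_measurable CR (@open_left_interval l).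
have mI : measurable_fun setT (\1_E : R -> R) by exact: measurable_indic.
have mN : measurable_fun setT (\1_(`[0, +oo[) : R -> R) by exact: measurable_indic.
(* The relation between two points of the interval is encoded as the vanishing of a measurable
   function, so that the set of good pairs is measurable. The first indicator keeps the pairs in
   increasing order, as increments run forward. *)
pose F (p : R * R) : R := \1_`[0, +oo[ (p.2 - p.1) * \1_E p.1 * \1_E p.2 * (u p.2 - u p.1).
have m1 : measurable_fun setT (fst : measurableTypeR R * measurableTypeR R -> measurableTypeR R) by exact: measurable_fst.
have m2 : measurable_fun setT (snd : measurableTypeR R * measurableTypeR R -> measurableTypeR R) by exact: measurable_snd.
have mF : measurable_fun setT (F : measurableTypeR R * measurableTypeR R -> R).
  apply: measurable_funM; [apply: measurable_funM; [apply: measurable_funM|]|].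
  - by apply: measurableT_comp => //; exact: measurable_funB.
  - exact: measurableT_comp.
  - exact: measurableT_comp.
  - by apply: measurable_funB; exact: measurableT_comp.
have mP0 (H : measurableTypeR R * measurableTypeR R -> R) : measurable_fun setT H -> measurable [set p | H p = 0].
  move=> mH; rewrite (_ : mkset _ = H @^-1` [set 0])//.
  by rewrite -[X in measurable X]setTI; exact: mH.
have aeF : {ae leb, forall y, {ae leb, forall t, F (y, t) = 0}}.
  pose F' (p : measurableTypeR R * measurableTypeR R) := F (p.1, p.1 + p.2).
  have mF' : measurable_fun setT F'.
    apply: measurableT_comp => //; apply: measurable_fun_pair => //.
    exact: measurable_funD.
  have : {ae (leb \x leb)%E, forall p, F' p = 0}.
    apply: (@ae_prod2 _ _ _ _ _ leb leb (fun p => F' p = 0)); first exact: mP0.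
    apply: aeW => s; have [s0|s0] := leP 0 s; last first.
      apply: aeW => y; rewrite /F' /F /= addrAC subrr add0r indicE memNset ?mul0r//=.
      by rewrite in_itv/= andbT; apply/negP; rewrite -ltNge.
    apply: ae_mono (inc s s0) => y hy; rewrite /F' /F /=.
    rewrite !indicE; have [/set_mem Ey|] := boolP (y \in E); last by rewrite mulr0 !mul0r.
    have [/set_mem Eys|] := boolP (y + s \in E); last by rewrite mulr0 !mul0r.
    by rewrite hy// subrr mulr0.
  move/ae_slice1; apply: ae_mono => y /(ae_shift CR (- y)); apply: ae_mono => t.
  by rewrite /F' /= addrC subrK.
have aeF' : {ae leb, forall t, {ae leb, forall y, F (y, t) = 0}}.
  apply: (@ae_slice2 _ _ _ _ _ leb leb (fun p => F p = 0)).
  apply: (@ae_prod1 _ _ _ _ _ leb leb (fun p => F p = 0)) => //; exact: mP0.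
have [a a0 aE] := left_interval_lt l0.
have aeFF : {ae leb, forall y, {ae leb, forall t, F (y, t) = 0} /\ {ae leb, forall t, F (t, y) = 0}}.
  by move: aeF aeF'; apply: ae_mono2 => y.
(* Both orders of slicing are required at [y]: one reaches the points above it, the other the points
   below. *)
have [y /andP[y0 ya] [Fy Fy']] := ae_lebesgue_itv a0 aeFF.
have Ey : E y by apply: aE; rewrite /= in_itv/= y0.
exists (u y); apply: ae_mono2 Fy Fy' => t; rewrite /F /= => h1 h2 Et.
suff : u t = u y by rewrite /u; lra.
move: h1 h2; rewrite !indicE !(mem_set Ey) !(mem_set Et) !mulr1 !mem_setE !in_itv/= !andbT !subr_ge0.
have [yt|/ltW ty] := leP y t; first by rewrite mul1r; lra.
by rewrite ty mul1r; lra.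
Qed.

End primitive.

Section trace_kernel.
Context (R : realType).
Local Notation leb := (@lebesgue_measure R : {sigma_finite_measure set (measurableTypeR R) -> \bar R}).
Implicit Types (h k : R -> R) (a b c y s t : R).

Definition mean_kernel a r : R := a^-1 * \1_`]0, a[ r.
(** If h = c + prim k, then c is the mean of h over ]0, a[ minus the mean of prim k. By Fubini that
    last mean is 1/a times the integral of (a - r) k(r); subtracting it and adding prim k p gives
    this kernel. *)
Definition ramp_kernel a (p r : R) : R := a^-1 * (\1_`]0, a[ r * (r - a)) + \1_`]0, p[ r.

Lemma sqintegrable_mean_kernel a : sqintegrable leb (mean_kernel a).
Proof. by apply: sqintegrableZ; exact: sqintegrable_itv. Qed.

Lemma sqintegrable_ramp a : sqintegrable leb (fun r => \1_`]0, a[ r * (r - a)).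
Proof.
have := sqintegrableZ a (sqintegrable_itv 0 a).
apply: le_sqintegrable; first by apply: measurable_funM => //; exact: measurable_funB.
move=> r; rewrite !normrM indicE mem_setE in_itv/=.
have [/andP[r0 ra]|_] := boolP (0 < r < a); last by rewrite /= normr0 mul0r mulr0.
rewrite normr1 mul1r mulr1 ler0_norm ?subr_le0 ?ltW// ger0_norm ?(ltW (lt_trans r0 ra))//.
by rewrite opprB; lra.
Qed.

Lemma sqintegrable_ramp_kernel a p : sqintegrable leb (ramp_kernel a p).
Proof.
apply: sqintegrableD; last exact: sqintegrable_itv.
by apply: sqintegrableZ; exact: sqintegrable_ramp.
Qed.

Lemma Rintegral_itv_indic a b : a <= b -> \int[leb]_r (\1_`]a, b[ r) = b - a.
Proof.
move=> ab; rewrite /Rintegral integral_indic// setIT.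
by rewrite -[X in fine X]/(leb `]a, b[%classic) lebesgue_itvoo.
Qed.

Lemma sqintegrable_itv_prim a k : sqintegrable leb k ->
  sqintegrable leb (fun r => \1_`]0, a[ r * prim k r).
Proof.
move=> sk; pose S := fine (sqint leb k).
have S0 : 0 <= S by rewrite fine_ge0// sqint_ge0.
(* The square of [prim k r] is at most [a * S], and any real is bounded in absolute value by 1 plus
   its square; this avoids a square root. *)
apply: le_sqintegrable (sqintegrableZ (1 + a * S) (sqintegrable_itv 0 a)).
  by apply: measurable_funM => //; exact: continuous_measurable_fun (continuous_prim sk).
move=> r; rewrite !normrM mulrC indicE mem_setE in_itv/=.
have [/andP[r0 ra]|_] := boolP (0 < r < a); last by rewrite /= normr0 !mulr0.
rewrite ler_wpM2r//; have := prim_dist 0 r sk.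
rewrite (prim_neg _ (lexx 0)) !subr0 (gtr0_norm r0) -/S => h.
apply: (@le_trans _ _ (1 + a * S)); last exact: ler_norm.
have h2 : prim k r ^+ 2 <= a * S by apply: (le_trans h); rewrite ler_wpM2r// ltW.
have [p1|/ltW p1] := leP `|prim k r| 1.
  by apply: (le_trans p1); rewrite lerDl (le_trans _ h2)// sqr_ge0.
apply: (@le_trans _ _ (prim k r ^+ 2)); last by apply: (le_trans h2); rewrite lerDr.
by rewrite -[leRHS]real_normK ?num_real// expr2 ler_peMl.
Qed.

(** Fubini on the triangle 0 < r < y < a. *)
Lemma integral_prim a k : 0 <= a -> sqintegrable leb k ->
  \int[leb]_y (\1_`]0, a[ y * prim k y) = \int[leb]_r (\1_`]0, a[ r * (a - r) * k r).
Proof.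
move=> a0 sk;
pose f (p : measurableTypeR R * measurableTypeR R) : R := \1_`]0, a[ p.2 * (\1_`]0, p.2[ p.1 * k p.1).
have m1 : measurable_fun setT (fst : measurableTypeR R * measurableTypeR R -> measurableTypeR R) by exact: measurable_fst.
have m2 : measurable_fun setT (snd : measurableTypeR R * measurableTypeR R -> measurableTypeR R) by exact: measurable_snd.
(* The indicator of the triangle. Its measurability is read off from the form in [gE], where the
   condition r < y is a condition on the difference. *)
pose g (p : measurableTypeR R * measurableTypeR R) : R := \1_`]0, a[ p.2 * \1_`]0, p.2[ p.1.
have gE (p : measurableTypeR R * measurableTypeR R) : g p = \1_`]0, a[ p.2 * (\1_`]0, +oo[ p.1 * \1_`]0, +oo[ (p.2 - p.1)).
  congr (_ * _); rewrite !indicE !mem_setE !in_itv/= !andbT subr_gt0.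
  by case: (0 < p.1); case: (p.1 < p.2); rewrite /= ?mulr1 ?mulr0.
have mg : measurable_fun setT g.
  rewrite (_ : g = fun p => \1_`]0, a[ p.2 * (\1_`]0, +oo[ p.1 * \1_`]0, +oo[ (p.2 - p.1))); last by apply/funext => p; exact: gE.
  apply: measurable_funM; first exact: measurableT_comp.
  apply: measurable_funM; first exact: measurableT_comp.
  by apply: measurableT_comp => //; exact: measurable_funB.
have sg : sqintegrable (leb \x leb)%E g.
  have sgg := sqintegrable_itv_cst 0 a (sqintegrable_itv 0 a).
  apply: (le_sqintegrable mg _ sgg).
  move=> [r y]; rewrite /g /= !normrM !indicE !mem_setE !in_itv/=.
  have [/andP[y0 ya]|_] := boolP (0 < y < a); last by rewrite /= normr0 !mul0r.
  rewrite ler_wpM2l// !ger0_norm// ler_nat.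
  have [/andP[r0 ry]|_] := boolP (0 < r < y) => //=.
  by rewrite r0 (lt_trans ry ya).
have sf := sqintegrableM sg (sqintegrable_itv_cst 0 a sk).
have fE (p : measurableTypeR R * measurableTypeR R) : f p = g p * (\1_`]0, a[ p.2 * k p.1).
  rewrite /f /g !indicE; case: (p.2 \in _); rewrite ?mul1r// !mul0r//.
have fi : (leb \x leb)%E.-integrable setT (EFin \o f).
  by rewrite (_ : EFin \o f = EFin \o (fun p => g p * (\1_`]0, a[ p.2 * k p.1)))//; apply/funext => p /=; rewrite fE.
transitivity (\int[leb]_y (\int[leb]_r f (r, y))).
  apply: eq_Rintegral => y _; rewrite /f /= RintegralZl//; exact: integrable_itvM.
rewrite (Rintegral_slice2 fi) -(Rintegral_slice1 fi).
apply: eq_Rintegral => r _; rewrite /f /=.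
have [/andP[r0 ra]|r0a] := boolP (0 < r < a); last first.
  rewrite [in RHS]indicE mem_setE in_itv/= (negbTE r0a) !mul0r.
  transitivity (\int[leb]_r (0 : R)); last by rewrite Rintegral_cst// mul0r.
  apply: eq_Rintegral => y _; rewrite !indicE !mem_setE !in_itv/=.
  have [/andP[y0 ya]|_] := boolP (0 < y < a); last by rewrite mul0r.
  have [/andP[r0 ry]|_] := boolP (0 < r < y); last by rewrite mul0r mulr0.
  by move: r0a; rewrite r0 (lt_trans ry ya).
transitivity (\int[leb]_y (k r * \1_`]r, a[ y)).
  apply: eq_Rintegral => y _; rewrite !indicE !mem_setE !in_itv/= r0 /=.
  have [ry|_] := ltP r y; last by rewrite mul0r !mulr0.
  by rewrite (lt_trans r0 ry) mul1r mulrC.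
rewrite RintegralZl//; last exact: (integrable_indic_itv r a false true).
rewrite Rintegral_itv_indic ?ltW//.
by rewrite indicE mem_setE in_itv/= r0 ra mul1r mulrC.
Qed.

Lemma ramp_kernelE a p k : 0 < a -> sqintegrable leb k ->
  \int[leb]_r (ramp_kernel a p r * k r) =
  prim k p - a^-1 * \int[leb]_y (\1_`]0, a[ y * prim k y).
Proof.
move=> a0 sk; rewrite integral_prim ?ltW//.
have i1 := integrable_itvM 0 p sk.
have i2 := sqintegrableM (sqintegrable_ramp a) sk.
transitivity (\int[leb]_r (a^-1 * (\1_`]0, a[ r * (r - a) * k r) + \1_`]0, p[ r * k r)).
  by apply: eq_Rintegral => r _; rewrite /ramp_kernel mulrDl !mulrA.
rewrite RintegralD//; last first.
  exact: integrable_scale.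
rewrite RintegralZl// addrC -mulrN; congr (_ + _ * _).
rewrite -[LHS]opprK -[X in - X]mulN1r -RintegralZl//; congr (- _).
by apply: eq_Rintegral => r _; rewrite mulN1r -mulNr -mulrN opprB.
Qed.

(* If [h = c + prim k] on the interval, this recovers [c + prim k p] from [h] and [k]
   by two pairings, and so defines the trace at [p] on square integrable functions. *)
Lemma kernel_representation l a p h k c : 0 < a -> `]0, a[ `<=` left_interval l ->
  sqintegrable leb h -> sqintegrable leb k ->
  {ae leb, forall y, left_interval l y -> h y = c + prim k y} ->
  \int[leb]_r (mean_kernel a r * h r) + \int[leb]_r (ramp_kernel a p r * k r) = c + prim k p.
Proof.
move=> a0 al sh sk hc; rewrite ramp_kernelE//.
have i1 := integrable_itvM 0 a sh.
transitivity (a^-1 * \int[leb]_r (\1_`]0, a[ r * h r) + (prim k p - a^-1 * \int[leb]_y (\1_`]0, a[ y * prim k y))).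
  congr (_ + _); rewrite -RintegralZl//.
  by apply: eq_Rintegral => r _; rewrite /mean_kernel mulrA.
suff -> : \int[leb]_r (\1_`]0, a[ r * h r) = a * c + \int[leb]_y (\1_`]0, a[ y * prim k y).
  by rewrite mulrDr mulKf ?gt_eqF//; lra.
have mp : measurable_fun setT (prim k) by exact: continuous_measurable_fun (continuous_prim sk).
transitivity (\int[leb]_r (c * \1_`]0, a[ r + \1_`]0, a[ r * prim k r)).
  apply: ae_eq_Rintegral.
  - by apply: measurable_funM => //; exact: sh.1.
  - by apply: measurable_funD; apply: measurable_funM.
  apply: ae_mono hc => r hr; rewrite indicE mem_setE in_itv/=.
  have [ra|_] := boolP (0 < r < a); last by rewrite !mul0r mulr0 addr0.
  by rewrite hr ?mulr1 ?mul1r//; apply: al; rewrite /= in_itv.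
have i2 := integrable_indic_itv (0 : R) a false true.
have i3 : leb.-integrable setT (EFin \o (fun r => \1_`]0, a[ r * prim k r)).
  have := integrable_itvM 0 a (sqintegrable_itv_prim a sk); congr (_.-integrable _ _).
  by apply/funext => y /=; rewrite indicE mulrA -natrM mulnb andbb.
rewrite RintegralD//; last first.
  exact: integrable_scale.
by rewrite RintegralZl// Rintegral_itv_indic ?ltW// subr0 mulrC.
Qed.

End trace_kernel.

(** * Density of functions continuous up to the boundary *)

Section average.
Context (R : realType) d1 d2 (X : measurableNormedModType d1 R) (Z : measurableType d2).
Variables (mu : {sigma_finite_measure set X -> \bar R}) (C : coord_space mu)
  (nu : {sigma_finite_measure set Z -> \bar R}).
Variables (B : set Z) (mB : measurable B) (B_fin : (nu B < +oo)%E).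
Variables (tau : Z -> X) (mtau : measurable_fun setT tau).
Implicit Types (f U G phi : X -> R) (v : X) (Omega : set X).

(** Translates by [tau z] are integrated over [B] without normalisation; the factor [fine (nu B)]
    therefore shows up in [average_close]. *)
Definition average f : X -> R := pairing nu \1_B (fun p => f (p.1 + tau p.2)).

Lemma measurable_translates f : measurable_fun setT f ->
  measurable_fun setT (fun p : X * Z => f (p.1 + tau p.2)).
Proof.
move=> mf; apply: measurableT_comp => //; apply: (measurable_addv C); first exact: measurable_fst.
by apply: measurableT_comp => //; exact: measurable_snd.
Qed.

Lemma sqint_translate f z : sqintegrable mu f -> (sqint mu (fun x => f (x + tau z)%R) <= sqint mu f)%E.
Proof. by move=> sf; rewrite (sqint_shift C)//; exact: sf.1. Qed.

Lemma sqint_fin_ge0 f : sqintegrable mu f -> (0 <= sqint mu f < +oo)%E.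
Proof. by move=> sf; rewrite sqint_ge0; exact: sf.2. Qed.

Lemma sqintegrable_translates f : sqintegrable mu f ->
  sqintegrable (mu \x nu)%E (fun p => \1_B p.2 * f (p.1 + tau p.2)).
Proof.
move=> sf; apply: (sqintegrable_indicM mB B_fin _ (sqint_fin_ge0 sf)).
  exact: measurable_translates sf.1.
by apply: aeW => z _; exact: sqint_translate.
Qed.

Lemma sqintegrable_indic_fst f : sqintegrable mu f ->
  sqintegrable (mu \x nu)%E (fun p => \1_B p.2 * f p.1).
Proof.
move=> sf; apply: (sqintegrable_indicM mB B_fin (h := fun p => f p.1) _ (sqint_fin_ge0 sf)).
  by apply: measurableT_comp; [exact: sf.1|exact: measurable_fst].
by apply: aeW => z _.
Qed.

Lemma sqintegrable_average f : sqintegrable mu f -> sqintegrable mu (average f).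
Proof.
move=> sf; rewrite /average pairing_indicE.
apply: sqintegrable_pairing; first exact: sqintegrable_indic.
exact: sqintegrable_translates.
Qed.

Lemma ae_integrable_translates f : sqintegrable mu f ->
  {ae mu, forall x, nu.-integrable setT (EFin \o (fun z => \1_B z * f (x + tau z)))}.
Proof.
move=> sf; apply: (set_integral_integrable mB B_fin (h := fun p => f (p.1 + tau p.2)) _ (sqint_fin_ge0 sf)).
  exact: measurable_translates sf.1.
by apply: aeW => z _; exact: sqint_translate.
Qed.

Lemma integrable_indic_fin : nu.-integrable setT (EFin \o (\1_B : Z -> R)).
Proof.
have s := sqintegrable_indic (R := R) mB B_fin.
have := sqintegrableM s s; congr (_.-integrable _ _).
by apply/funext => z /=; rewrite indicE -natrM mulnb andbb.
Qed.

Lemma average_close f (e : R) : sqintegrable mu f -> 0 <= e ->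
  (forall z, B z -> (sqint mu (fun x => f (x + tau z)%R - f x)%R <= e%:E)%E) ->
  (sqint mu (fun x => average f x - fine (nu B) * f x)%R <= nu B * (e%:E * nu B))%E.
Proof.
move=> sf e0 he; pose h (p : X * Z) := f (p.1 + tau p.2) - f p.1.
have mh : measurable_fun setT h.
  apply: measurable_funB; first exact: measurable_translates sf.1.
  by apply: measurableT_comp; [exact: sf.1|exact: measurable_fst].
have e0oo : (0 <= e%:E < +oo)%E by rewrite lee_fin e0 ltry.
have H : {ae nu, forall z, B z -> (sqint mu (fun x => h (x, z)) <= e%:E)%E}.
  by apply: aeW => z /he.
apply: le_trans (sqint_set_integral mB B_fin mh e0oo H).
rewrite le_eqVlt; apply/orP; left; apply/eqP.
apply: ae_eq_sqint; apply: filterS (ae_integrable_translates sf) => x ix.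
rewrite /average /pairing /=.
have i2 : nu.-integrable setT (EFin \o (fun z => \1_B z * f x)).
  by have := integrableZl measurableT (f x) integrable_indic_fin; congr (_.-integrable _ _);
    apply/funext => z /=; rewrite mulrC EFinM.
transitivity (\int[nu]_z (\1_B z * f (x + tau z)) - \int[nu]_z (\1_B z * f x)).
  congr (_ - _); rewrite RintegralZr//; last exact: integrable_indic_fin.
  by congr (_ * _); rewrite /Rintegral integral_indic// setIT.
by rewrite -RintegralB//; apply: eq_Rintegral => z _; rewrite mulrBr.
Qed.

(** The indicator is placed on both factors: its square is itself, and each factor becomes square
    integrable on the product. *)
Let F f phi (p : X * Z) := (\1_B p.2 * f (p.1 + tau p.2)) * (\1_B p.2 * phi p.1).

Let iF f phi : sqintegrable mu f -> sqintegrable mu phi ->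
  (mu \x nu)%E.-integrable setT (EFin \o F f phi).
Proof.
by move=> sf sphi; exact: (sqintegrableM (sqintegrable_translates sf) (sqintegrable_indic_fst sphi)).
Qed.

Let FE f phi p : F f phi p = \1_B p.2 * f (p.1 + tau p.2) * phi p.1.
Proof. by rewrite /F indicE; case: (_ \in _); rewrite ?mul1r ?mul0r. Qed.

Let integral_F f phi z : sqintegrable mu f -> sqintegrable mu phi ->
  \int[mu]_x F f phi (x, z) = \1_B z * \int[mu]_x (f x * phi (x - tau z)).
Proof.
move=> sf sphi; have sfz := sqintegrable_shift C (tau z) sf.
transitivity (\int[mu]_x (\1_B z * (f (x + tau z) * phi x))).
  by apply: eq_Rintegral => x _; rewrite FE mulrA.
rewrite RintegralZl//; last exact: sqintegrableM.
congr (_ * _); rewrite -[LHS](Rintegral_shift C (- tau z)).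
  by apply: eq_Rintegral => x _; rewrite subrK.
by apply: measurable_funM; [exact: sfz.1|exact: sphi.1].
Qed.

Lemma integrable_average_dual f phi : sqintegrable mu f -> sqintegrable mu phi ->
  nu.-integrable setT (EFin \o (fun z => \1_B z * \int[mu]_x (f x * phi (x - tau z)))).
Proof.
move=> sf sphi; have := integrable_Rintegral_slice2 (iF sf sphi).
by congr (_.-integrable _ _); apply/funext => z; congr EFin; exact: integral_F.
Qed.

Lemma integral_average f phi : sqintegrable mu f -> sqintegrable mu phi ->
  \int[mu]_x (average f x * phi x) = \int[nu]_z (\1_B z * \int[mu]_x (f x * phi (x - tau z))).
Proof.
move=> sf sphi; have i := iF sf sphi.
transitivity (\int[mu]_x \int[nu]_z F f phi (x, z)).
  apply: ae_eq_Rintegral.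
  - by apply: measurable_funM; [exact: (sqintegrable_average sf).1|exact: sphi.1].
  - by apply: measurable_Rintegral_slice1; apply/measurable_EFinP; exact: measurable_int i.
  apply: filterS (ae_integrable_translates sf) => x ix.
  rewrite -RintegralZr//; apply: eq_Rintegral => z _; exact/esym/FE.
rewrite (Rintegral_slice1 i) -(Rintegral_slice2 i); apply: eq_Rintegral => z _.
exact: integral_F.
Qed.

(** [Omega] is invariant under the translations, so each translate of a test function is again one;
    the weak relation for the translates is integrated over [B]. *)
Lemma weakly_average Omega v U G : (forall x z, Omega (x + tau z) <-> Omega x) ->
  sqintegrable mu U -> sqintegrable mu G -> weakly mu Omega v U G ->
  weakly mu Omega v (average U) (average G).
Proof.
move=> OE sU sG w phi tphi.
have sphi := test_function_sqintegrable C tphi.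
have sD := test_function_sqintegrable C (test_function_derive v tphi).
rewrite !integral_average//.
have tz z : test_function Omega (fun x => phi (x - tau z)).
  by apply: (test_function_shift tphi) => x Ox; rewrite opprK; exact/OE.
have i2 := integrable_average_dual sG sphi.
rewrite -[RHS]mulN1r -RintegralZl//; apply: eq_Rintegral => z _.
rewrite mulN1r -[RHS]mulrN; congr (_ * _).
have := w _ (tz z) => <-.
by apply: eq_Rintegral => x _; rewrite (derive_shift_arg _ _ _ _).2.
Qed.

End average.

Section translation_continuity_sum.
Context (R : realType) d (X : measurableNormedModType d R).
Variables (mu : {sigma_finite_measure set X -> \bar R}) (C : coord_space mu).

(** Continuity along one direction at a time is chained over a list of directions, with a radius
    common to all coefficients. This gives uniformity over small horizontal vectors. *)
Lemma translation_continuity_sum (I : Type) (s : seq I) (v : I -> X) (f : X -> R) :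
  sqintegrable mu f -> forall e : R, 0 < e ->
  exists2 r : R, 0 < r & forall c : I -> R, (forall i, `|c i| < r) ->
    (sqint mu (fun x => f (x + \sum_(i <- s) c i *: v i)%R - f x)%R <= e%:E)%E.
Proof.
move=> sf; elim: s => [|i s IHs] e e0.
  exists 1 => // c _; rewrite big_nil (_ : (fun _ => _) = cst 0).
    by rewrite /sqint integral0_eq ?lee_fin ?ltW// => x _; rewrite /= expr0n.
  by apply/funext => x; rewrite addr0 subrr.
have e4 : 0 < e / 4 by rewrite divr_gt0.
have [r1 r10 h1] := translation_continuity C (v i) sf e4.
have [r2 r20 h2] := IHs _ e4.
exists (Num.min r1 r2) => [|c hc]; first by rewrite lt_min r10.
have {}h1 : (sqint mu (fun x => f (x + c i *: v i)%R - f x)%R <= (e / 4)%:E)%E.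
  by apply: h1; move: (hc i); rewrite lt_min => /andP[].
have {}h2 := h2 c (fun j => (andP (eqbLR (lt_min _ _ _) (hc j))).2).
rewrite big_cons; set w := \sum_(_ <- _) _ in h2 *.
have si := sqintegrableB (sqintegrable_shift C (c i *: v i) sf) sf.
have sw := sqintegrableB (sqintegrable_shift C w sf) sf.
have siw := sqintegrable_shift C w si.
rewrite (_ : (fun _ => _) = (fun x => (f (x + w + c i *: v i) - f (x + w)) + (f (x + w) - f x))); last first.
  by apply/funext => x; rewrite -[x + w + _]addrA [w + _]addrC addrA [RHS]addrA subrK.
apply: (le_trans (sqint_add _ siw.1 sw.1)).
rewrite (sqint_shift C w si.1).
apply: (@le_trans _ _ (2%:E * (e / 4)%:E + 2%:E * (e / 4)%:E)%E).
  by apply: leeD; rewrite lee_wpmul2l ?lee_fin.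
by rewrite -!EFinM -EFinD lee_fin; lra.
Qed.

End translation_continuity_sum.

Section horizontal_translations.
Context (R : realType) d (W : measurableNormedModType d R) (N : nat).
Variables (nu : {sigma_finite_measure set W -> \bar R}) (CW : coord_space nu).
Local Notation V := 'rV[R]_N.
Local Notation mu := (lebesgue_rV N : {sigma_finite_measure set V -> \bar R}).

Lemma horizontal_translation_continuity (f : V * W -> R) : sqintegrable (prod_measure mu nu) f ->
  forall e : R, 0 < e -> exists2 r : R, 0 < r & forall x : V, `|x| < r ->
    (sqint (prod_measure mu nu) (fun p => f (p + (x, 0 : W))%R - f p)%R <= e%:E)%E.
Proof.
move=> sf e e0; pose C := coord_space_prod (coord_space_rV R N) CW.
have [r r0 hr] := translation_continuity_sum C (index_enum 'I_N) (fun i => (delta_mx 0 i : V, 0 : W)) sf e0.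
exists r => // x xr.
suff -> : (x, 0 : W) = \sum_i (x 0 i *: (delta_mx 0 i : V, 0 : W)).
  apply: hr => i; apply: le_lt_trans xr.
  by have := (coord_norm (coord_space_rV R N) x `|x| (normr_ge0 x)).1 (lexx _) i.
rewrite [in LHS](row_sum_delta x).
apply: (big_ind2 (fun (y : V) (p : V * W) => (y, 0) = p)) => // [y p z q <- <-|i _].
  by congr pair; rewrite addr0.
by congr pair; rewrite scaler0.
Qed.

End horizontal_translations.

Section trace_pairing.
Context (R : realType) d (V : measurableNormedModType d R).
Variables (mu : {sigma_finite_measure set V -> \bar R}) (CV : coord_space mu).
Local Notation leb := (@lebesgue_measure R : {sigma_finite_measure set (measurableTypeR R) -> \bar R}).
Local Notation X := (V * measurableTypeR R)%type.
Local Notation P := (prod_measure mu leb).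
Implicit Types (U G : X -> R) (a c p y : R) (x : V) (l : \bar R).

Definition cylinder l : set X := [set: V] `*` left_interval l.

Lemma open_cylinder l : open (cylinder l).
Proof.
rewrite (_ : cylinder l = snd @^-1` left_interval l).
  by apply: open_comp (@open_left_interval R l) => x _; exact: cvg_snd.
by apply/seteqP; split => [[x y] []|[x y]].
Qed.

Definition coord_space_cyl : coord_space P := coord_space_prod CV (coord_space_R R).

Lemma convex_cylinder l : convex_along (cylinder l) (0 : V, 1 : R).
Proof.
move=> x s r srs [_ x2] [_ xs2]; split => //.
exact: (convex_left_interval srs x2 xs2).
Qed.

Lemma convex_cylinder_h l (v : V) : convex_along (cylinder l) (v, 0 : R).
Proof.
move=> x s r _ [_ x2] _; split => //=.
by rewrite (_ : r *: (0 : R) = 0) ?addr0//; exact: scaler0.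
Qed.

Definition trace_pairing a p U G x :=
  pairing leb (mean_kernel a) U x + pairing leb (ramp_kernel a p) G x.

Lemma sqintegrable_trace_pairing a p U G : sqintegrable P U -> sqintegrable P G ->
  sqintegrable mu (trace_pairing a p U G).
Proof.
move=> sU sG; apply: sqintegrableD.
  by apply: sqintegrable_pairing => //; exact: sqintegrable_mean_kernel.
by apply: sqintegrable_pairing => //; exact: sqintegrable_ramp_kernel.
Qed.

Lemma sqint_trace_pairing a p : exists2 K : R, 0 <= K & forall U G, sqintegrable P U -> sqintegrable P G ->
  (sqint mu (trace_pairing a p U G) <= K%:E * (sqint P U + sqint P G))%E.
Proof.
have s1 := sqintegrable_mean_kernel a; have s2 := sqintegrable_ramp_kernel a p.
pose K1 := fine (sqint leb (mean_kernel a)); pose K2 := fine (sqint leb (ramp_kernel a p)).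
have K10 : 0 <= K1 by rewrite fine_ge0// sqint_ge0.
have K20 : 0 <= K2 by rewrite fine_ge0// sqint_ge0.
exists (2 * (K1 + K2)) => [|U G sU sG]; first by rewrite mulr_ge0// addr_ge0.
have h1 := sqint_pairing s1 sU; have h2 := sqint_pairing s2 sG.
apply: (le_trans (sqint_add mu (sqintegrable_pairing s1 sU).1 (sqintegrable_pairing s2 sG).1)).
apply: (@le_trans _ _ (2%:E * (K1%:E * sqint P U) + 2%:E * (K2%:E * sqint P G))%E).
  apply: leeD; apply: lee_wpmul2l; rewrite ?lee_fin//.
    by rewrite /K1 fineK ?sqint_fin.
  by rewrite /K2 fineK ?sqint_fin.
rewrite -(fineK (sqint_fin sU)) -(fineK (sqint_fin sG)).
set A := fine _; set B := fine _.
have A0 : 0 <= A by rewrite fine_ge0// sqint_ge0.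
have B0 : 0 <= B by rewrite fine_ge0// sqint_ge0.
rewrite -[(A%:E + B%:E)%E]EFinD -!EFinM -EFinD lee_fin.
have := mulr_ge0 K10 B0; have := mulr_ge0 K20 A0; lra.
Qed.

Lemma ae_pairing_lin (k : R -> R) c (f g : X -> R) : sqintegrable leb k -> sqintegrable P f -> sqintegrable P g ->
  {ae mu, forall x, pairing leb k (fun z => c * f z + g z) x = c * pairing leb k f x + pairing leb k g x}.
Proof.
move=> sk sf sg; have := sqintegrable_slice1 sg; have := sqintegrable_slice1 sf.
apply: filterS2 => x fx gx; rewrite /pairing.
have i1 := sqintegrableM sk fx; have i2 := sqintegrableM sk gx.
rewrite -RintegralZl// -RintegralD//.
  by apply: eq_Rintegral => y _; rewrite mulrDr mulrCA.
exact: integrable_scale.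
Qed.

Lemma trace_pairing_lin a p c U U' G G' :
  sqintegrable P U -> sqintegrable P U' -> sqintegrable P G -> sqintegrable P G' ->
  {ae mu, forall x, trace_pairing a p (fun z => c * U z + U' z) (fun z => c * G z + G' z) x =
    c * trace_pairing a p U G x + trace_pairing a p U' G' x}.
Proof.
move=> sU sU' sG sG'.
have h1 := ae_pairing_lin c (sqintegrable_mean_kernel a) sU sU'.
have h2 := ae_pairing_lin c (sqintegrable_ramp_kernel a p) sG sG'.
by apply: filterS2 h1 h2 => x e1 e2; rewrite /trace_pairing e1 e2; lra.
Qed.

Lemma ae_pairing_eq (k : R -> R) (f g : X -> R) : measurable_fun setT k -> measurable_fun setT f ->
  measurable_fun setT g -> {ae P, forall z, f z = g z} ->
  {ae mu, forall x, pairing leb k f x = pairing leb k g x}.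
Proof.
move=> mk mf mg /(@ae_slice1 _ _ _ _ _ mu leb); apply: filterS => x hx.
apply: ae_eq_Rintegral.
- by apply: measurable_funM => //; exact: measurable_slice1.
- by apply: measurable_funM => //; exact: measurable_slice1.
- by apply: ae_mono hx => y ->.
Qed.

Lemma ae_trace_pairing a p U U' G G' :
  measurable_fun setT U -> measurable_fun setT U' -> measurable_fun setT G -> measurable_fun setT G' ->
  {ae P, forall z, U z = U' z} -> {ae P, forall z, G z = G' z} ->
  {ae mu, forall x, trace_pairing a p U G x = trace_pairing a p U' G' x}.
Proof.
move=> mU mU' mG mG' hU hG.
have h1 := ae_pairing_eq (sqintegrable_mean_kernel a).1 mU mU' hU.
have h2 := ae_pairing_eq (sqintegrable_ramp_kernel a p).1 mG mG' hG.
by apply: filterS2 h1 h2 => x e1 e2; rewrite /trace_pairing e1 e2.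
Qed.

Lemma ae_slice_weakly l U G : sqintegrable P U -> sqintegrable P G ->
  weakly P (cylinder l) (0, 1 : R) U G ->
  {ae mu, forall x, [/\ sqintegrable leb (fun y => U (x, y)), sqintegrable leb (fun y => G (x, y)) &
    weakly (V := measurableTypeR R) leb (left_interval l) (1 : R) (fun y => U (x, y)) (fun y => G (x, y))]}.
Proof.
move=> sU sG w.
have := slice_weakly coord_space_cyl (coord_space_R R) (S := slicing_v mu leb)
  (Omega1 := left_interval l) (Omega2 := setT) (@open_cylinder l) (@convex_cylinder l)
  (@open_left_interval R l) (fun x y _ Ey => conj Logic.I Ey) sU sG w.
move: (sqintegrable_slice1 sU) (sqintegrable_slice1 sG).
by apply: filterS3 => x sUx sGx /(_ Logic.I).
Qed.

(** The null set of [x] is chosen before [p]: on a good slice the dependence on [p] is a primitive,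
    so the traces at all heights form the continuous representative of that slice. *)
Lemma ae_trace_representation l a U G : (0 < l)%E -> 0 < a -> `]0, a[ `<=` left_interval l ->
  sqintegrable P U -> sqintegrable P G -> weakly P (cylinder l) (0, 1 : R) U G ->
  {ae mu, forall x, (forall p, trace_pairing a p U G x = trace_pairing a 0 U G x + prim (fun y => G (x, y)) p) /\
    {ae leb, forall y, left_interval l y -> U (x, y) = trace_pairing a y U G x}}.
Proof.
move=> l0 a0 al sU sG w; apply: filterS (ae_slice_weakly sU sG w) => x [sUx sGx wx].
have [c hc] := interval_representation l0 sUx sGx wx.
have TE p : trace_pairing a p U G x = c + prim (fun y => G (x, y)) p.
  exact: (kernel_representation p a0 al sUx sGx hc).
split => [p|]; first by rewrite !TE (prim_neg _ (lexx 0)) addr0.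
by apply: ae_mono hc => y hy Ey; rewrite TE hy.
Qed.

End trace_pairing.

(** * Continuity of horizontal averages of traces *)

Section box_pairing.
Context (R : realType) (N : nat).
Local Notation leb := (@lebesgue_measure R : {sigma_finite_measure set (measurableTypeR R) -> \bar R}).
Local Notation V := 'rV[R]_N.
Local Notation mu := (lebesgue_rV N : {sigma_finite_measure set V -> \bar R}).
Local Notation X := (V * measurableTypeR R)%type.
Local Notation P := (prod_measure mu leb).
Local Notation CV := (coord_space_rV R N).
Local Notation CX := (coord_space_cyl CV).
Variables (B : set V) (mB : measurable B) (B_fin : (mu B < +oo)%E).
Implicit Types (U H : X -> R) (k : R -> R) (x : V).

Definition horizontal (z : V) : X := (z, 0 : R).

Lemma measurable_horizontal : measurable_fun setT horizontal.
Proof. by apply: measurable_fun_pair => //; exact: measurable_cst. Qed.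

Definition box_kernel k (p : X) : R := \1_B p.1 * k p.2.

Lemma measurable_box_kernel k : measurable_fun setT k -> measurable_fun setT (box_kernel k).
Proof.
move=> mk; apply: measurable_funM.
  by apply: measurableT_comp; [exact: measurable_indic|exact: measurable_fst].
by apply: measurableT_comp => //; exact: measurable_snd.
Qed.

Lemma sqint_box_kernel k : measurable_fun setT k -> sqint P (box_kernel k) = (mu B * sqint leb k)%E.
Proof.
move=> mk; rewrite [LHS](sqint_slice1 mu leb (measurable_box_kernel mk)).
rewrite /box_kernel /=; under eq_integral do rewrite sqint_scale//.
rewrite ge0_integralZr//; last 2 first.
- by apply/measurable_EFinP; apply: measurable_funX; exact: measurable_indic.
- exact: sqint_ge0.
by congr (_ * _)%E; exact: sqint_indic.
Qed.

Lemma sqintegrable_box_kernel k : sqintegrable leb k -> sqintegrable P (box_kernel k).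
Proof.
move=> sk; split; first exact: measurable_box_kernel sk.1.
by rewrite (sqint_box_kernel sk.1) lte_mul_pinfty//; [rewrite ge0_fin_numE|exact: sk.2].
Qed.

(** The average followed by the vertical pairing, written as one inner product of a kernel with a
    translate of [H]. Continuity in [x] is then continuity of translations in L^2, and continuity in
    the height is that of the kernel. *)
Definition box_pairing k H x : R := \int[P]_p (box_kernel k p * H (p + horizontal x)).

Lemma box_pairingE k H x : sqintegrable leb k -> sqintegrable P H ->
  box_pairing k H x = pairing leb k (average mu B horizontal H) x.
Proof.
move=> sk sH; have sHx := sqintegrable_shift CX (horizontal x) sH.
have sK := sqintegrable_box_kernel sk; have i := sqintegrableM sK sHx.
rewrite /box_pairing -[LHS](Rintegral_slice2 (m1 := mu) (m2 := leb) i).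
have mavg := (sqintegrable_average CX mB B_fin measurable_horizontal sH).1.
apply: ae_eq_Rintegral.
- apply: (@measurable_Rintegral_slice1 _ _ _ _ _ mu (fun p => box_kernel k (p.2, p.1) * H ((p.2, p.1) + horizontal x))).
  apply: (measurableT_comp (measurable_funM sK.1 sHx.1)).
  by apply: measurable_fun_pair; [exact: measurable_snd|exact: measurable_fst].
- by apply: measurable_funM; [exact: sk.1|exact: (measurable_slice1 x mavg)].
have := sqintegrable_slice2 (m1 := mu) (m2 := leb) sHx; apply: ae_mono => r sr.
have i2 := sqintegrableM (sqintegrable_indic mB B_fin) sr.
rewrite /average /pairing -RintegralZl//.
  apply: eq_Rintegral => z _; rewrite /box_kernel /= mulrAC mulrC; congr (_ * (_ * H _)).
  by congr pair; rewrite addrC.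
move: i2; congr (_.-integrable _ _); apply/funext => z /=; congr (_ * H _)%:E.
by congr pair; rewrite addrC.
Qed.

Lemma sqr_box_pairing_diff k k' H H' : sqintegrable leb k -> sqintegrable leb k' ->
  sqintegrable P H -> sqintegrable P H' ->
  (((\int[P]_p (box_kernel k p * H p) - \int[P]_p (box_kernel k' p * H' p)) ^+ 2)%:E <=
  2%:E * ((mu B * sqint leb (fun r => k r - k' r)%R) * sqint P H) +
  2%:E * ((mu B * sqint leb k') * sqint P (fun p => H p - H' p)%R))%E.
Proof.
move=> sk sk' sH sH'; have skk := sqintegrableB sk sk'; have sHH := sqintegrableB sH sH'.
have K1 := sqintegrable_box_kernel sk; have K2 := sqintegrable_box_kernel sk'.
have K3 := sqintegrable_box_kernel skk.
have -> : \int[P]_p (box_kernel k p * H p) - \int[P]_p (box_kernel k' p * H' p) =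
    \int[P]_p (box_kernel (fun r => k r - k' r) p * H p) + \int[P]_p (box_kernel k' p * (H p - H' p)).
  have i1 := sqintegrableM K1 sH; have i2 := sqintegrableM K2 sH'.
  have i3 := sqintegrableM K3 sH; have i4 := sqintegrableM K2 sHH.
  rewrite -RintegralB// -RintegralD//; apply: eq_Rintegral => p _.
  by rewrite /box_kernel; ring.
have h1 := sqr_integral_le K3 sH; have h2 := sqr_integral_le K2 sHH.
rewrite (sqint_box_kernel skk.1) in h1; rewrite (sqint_box_kernel sk'.1) in h2.
set A := \int[P]_p _ in h1 *; set D := \int[P]_p _ in h2 *.
apply: (@le_trans _ _ (2%:E * (A ^+ 2)%:E + 2%:E * (D ^+ 2)%:E)%E).
  by rewrite -!EFinM -EFinD lee_fin; have := sqr_ge0 (A - D); lra.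
by apply: leeD; rewrite lee_wpmul2l.
Qed.

Lemma continuous_box_pairing (k : R -> R -> R) (K : R) H :
  0 <= K -> (forall y, sqintegrable leb (k y)) ->
  (forall y y', (sqint leb (fun r => k y r - k y' r)%R <= (K * `|y - y'|)%:E)%E) ->
  sqintegrable P H -> continuous (fun q : X => box_pairing (k q.2) H q.1).
Proof.
move=> K0 sk kK sH q0; pose m := fine (mu B); pose S := fine (sqint P H); pose s0 := fine (sqint leb (k q0.2)).
have m0 : 0 <= m by rewrite fine_ge0.
have S0 : 0 <= S by rewrite fine_ge0// sqint_ge0.
have s00 : 0 <= s0 by rewrite fine_ge0// sqint_ge0.
have mE : mu B = m%:E by rewrite /m fineK// ge0_fin_numE.
have SE : sqint P H = S%:E by rewrite /S fineK// sqint_fin.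
have s0E : sqint leb (k q0.2) = s0%:E by rewrite /s0 fineK// sqint_fin.
apply/cvgrPdist_le => e e0.
(* Each of the two terms of [sqr_box_pairing_diff] carries a factor 2, so each is made at most
   [e ^+ 2 / 4]; the summand 1 prevents a zero denominator. *)
have A1 : 0 < m * K * S + 1 by rewrite ltr_wpDl// !mulr_ge0.
have A2 : 0 < m * s0 + 1 by rewrite ltr_wpDl// !mulr_ge0.
have e1 : 0 < e ^+ 2 / 4 / (m * K * S + 1) by rewrite !divr_gt0// exprn_gt0.
have e2 : 0 < e ^+ 2 / 4 / (m * s0 + 1) by rewrite !divr_gt0// exprn_gt0.
have [r r0 hr] := horizontal_translation_continuity (coord_space_R R) sH e2.
near=> q.
have hy : `|q0.2 - q.2| < e ^+ 2 / 4 / (m * K * S + 1).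
  by near: q; apply: cvgr_dist_lt => //; exact: cvg_snd.
have hx : `|q0.1 - q.1| < r.
  by near: q; apply: cvgr_dist_lt => //; exact: cvg_fst.
have sHq x : sqintegrable P (fun p => H (p + horizontal x)) := sqintegrable_shift CX (horizontal x) sH.
have := sqr_box_pairing_diff (sk q.2) (sk q0.2) (sHq q.1) (sHq q0.1).
rewrite (sqint_shift CX _ sH.1) SE mE s0E.
have -> : sqint P (fun p => H (p + horizontal q.1) - H (p + horizontal q0.1)) =
    sqint P (fun p => H (p + horizontal (q.1 - q0.1)) - H p).
  have sd := sqintegrableB (sHq (q.1 - q0.1)) sH.
  rewrite -[RHS](sqint_shift CX (horizontal q0.1) sd.1); congr (sqint _ _).
  apply/funext => p; rewrite -[p + _ + horizontal (_ - _)]addrA; congr (H (_ + _) - _).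
  by congr pair; rewrite /= ?addr0// addrC subrK.
have {}hr := hr (q.1 - q0.1); rewrite distrC in hx; have {}hr := hr hx.
have {}kK := kK q.2 q0.2; rewrite distrC in hy.
move=> h; rewrite -(ler_pXn2r (n := 2)) ?nnegrE ?(ltW e0)// real_normK ?num_real// -sqrrN opprB -lee_fin.
apply: (le_trans h).
apply: (@le_trans _ _ (2%:E * ((m%:E * (K * `|q.2 - q0.2|)%:E) * S%:E) +
   2%:E * ((m%:E * s0%:E) * (e ^+ 2 / 4 / (m * s0 + 1))%:E))%E).
  apply: leeD; apply: lee_wpmul2l; rewrite ?lee_fin//.
    by apply: lee_wpmul2r; rewrite ?lee_fin//; apply: lee_wpmul2l; rewrite ?lee_fin.
  by apply: lee_wpmul2l; rewrite ?lee_fin ?mulr_ge0//; exact: hr.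
rewrite -!EFinM -EFinD lee_fin.
have B1 : m * (K * `|q.2 - q0.2|) * S <= e ^+ 2 / 4.
  move: hy; rewrite ltr_pdivlMr// => hy; apply: le_trans (ltW hy).
  have := normr_ge0 (q.2 - q0.2); nra.
have B2 : m * s0 * (e ^+ 2 / 4 / (m * s0 + 1)) <= e ^+ 2 / 4.
  rewrite mulrCA ler_piMr ?divr_ge0 ?sqr_ge0// ler_pdivrMr// mul1r; lra.
lra.
Unshelve. all: by end_near.
Qed.

End box_pairing.

Lemma weakly_lin (R : realType) d (V : measurableNormedModType d R)
    (mu : {sigma_finite_measure set V -> \bar R}) (C : coord_space mu) (Omega : set V) v (c : R) U G U' G' :
  sqintegrable mu U -> sqintegrable mu G -> sqintegrable mu U' -> sqintegrable mu G' ->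
  weakly mu Omega v U G -> weakly mu Omega v U' G' ->
  weakly mu Omega v (fun x => c * U x + U' x) (fun x => c * G x + G' x).
Proof.
move=> sU sG sU' sG' w w' phi tphi; have sphi := test_function_sqintegrable C tphi.
have sD := test_function_sqintegrable C (test_function_derive v tphi).
have E f g psi : sqintegrable mu f -> sqintegrable mu g -> sqintegrable mu psi ->
    \int[mu]_x ((c * f x + g x) * psi x) = c * \int[mu]_x (f x * psi x) + \int[mu]_x (g x * psi x).
  move=> sf sg spsi; have i1 := sqintegrableM sf spsi; have i2 := sqintegrableM sg spsi.
  have i3 : mu.-integrable setT (EFin \o (fun x => c * (f x * psi x))).
    exact: integrable_scale.
  rewrite -RintegralZl// -RintegralD//.
  by apply: eq_Rintegral => x _; rewrite mulrDl mulrA.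
by rewrite !E// (w _ tphi) (w' _ tphi) mulrN opprD.
Qed.

Section density.
Context (R : realType) (N : nat).
Local Notation leb := (@lebesgue_measure R : {sigma_finite_measure set (measurableTypeR R) -> \bar R}).
Local Notation V := 'rV[R]_N.
Local Notation mu := (lebesgue_rV N : {sigma_finite_measure set V -> \bar R}).
Local Notation X := (V * measurableTypeR R)%type.
Local Notation P := (prod_measure mu leb).
Local Notation CV := (coord_space_rV R N).
Local Notation CX := (coord_space_cyl CV).
Implicit Types (U : X -> R) (D : X -> X -> R) (l : \bar R).

(** The parts depending on [a] cancel, leaving up to sign an indicator inside the interval between
    [y] and [z]. The factor 1 is the constant [K] of [continuous_box_pairing]. *)
Lemma sqint_ramp_kernelB (a y z : R) :
  (sqint leb (fun r => ramp_kernel a y r - ramp_kernel a z r)%R <= (1 * `|y - z|)%:E)%E.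
Proof.
wlog yz : y z / y <= z.
  move=> hw; have [yz|/ltW zy] := leP y z; first exact: hw.
  rewrite distrC -sqintN; under [X in sqint leb X]eq_fun do rewrite opprB.
  exact: hw.
have -> : (1 * `|y - z|)%:E = sqint leb (\1_`[y, z] : R -> R).
  rewrite sqint_indic// [RHS]lebesgue_measure_itv/= lte_fin mul1r distrC ger0_norm ?subr_ge0//.
  case: ltP => [_|zy]; first by rewrite EFinB.
  by rewrite (_ : y = z) ?subrr//; apply/le_anti; rewrite yz zy.
apply: le_sqint => r; rewrite /ramp_kernel opprD addrACA subrr add0r !indicE !mem_setE !in_itv/=.
have [r0|r0] := ltP 0 r; last by rewrite subrr normr0.
have [ry|yr] := ltP r y; first by rewrite (lt_le_trans ry yz) subrr normr0.
have [rz|zr] := ltP r z; last by rewrite subrr normr0.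
by rewrite (ltW rz) sub0r normrN.
Qed.

Lemma translation_continuity_seq (D : X -> X -> R) (s : seq X) : (forall v, v \in s -> sqintegrable P (D v)) ->
  forall e : R, 0 < e -> exists2 r : R, 0 < r & forall v (x : V), v \in s -> `|x| < r ->
    (sqint P (fun p => D v (p + horizontal x)%R - D v p)%R <= e%:E)%E.
Proof.
move=> + e e0; elim: s => [|w s IHs] sD; first by exists 1.
have [r1 r10 h1] := IHs (fun v vs => sD v (mem_behead (s := w :: s) vs)).
have [r2 r20 h2] := horizontal_translation_continuity (coord_space_R R) (sD w (mem_head w s)) e0.
exists (Num.min r1 r2); first by rewrite lt_min r10.
move=> v x; rewrite inE lt_min => /orP[/eqP ->|vs] /andP[xr1 xr2]; [exact: h2|exact: h1].
Qed.

(* Averaging over small horizontal boxes gives a function which is continuous up to the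
   boundary, because the vertical variable enters through [ramp_kernel] only. *)
Lemma cylinder_density l U D (s : seq X) : (0 < l)%E -> sqintegrable P U ->
  (0, 1 : R) \in s ->
  (forall v, v \in s -> sqintegrable P (D v) /\ weakly P (cylinder l) v U (D v)) ->
  forall e : R, 0 < e -> exists F AU, exists AD : X -> X -> R,
  [/\ continuous F, {ae P, forall z, cylinder l z -> F z = AU z},
    sqintegrable P AU, (sqint P (fun z => AU z - U z)%R <= e%:E)%E &
    forall v, v \in s -> [/\ sqintegrable P (AD v), weakly P (cylinder l) v AU (AD v) &
      (sqint P (fun z => AD v z - D v z)%R <= e%:E)%E]].
Proof.
move=> l0 sU s01 hD e e0; have [a a0 al] := left_interval_lt l0.
have [r1 r10 h1] := translation_continuity_seq (fun v vs => (hD v vs).1) e0.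
have [r2 r20 h2] := horizontal_translation_continuity (coord_space_R R) sU e0.
pose r := Num.min r1 r2; have r0 : 0 < r by rewrite lt_min r10.
(* Sides of length [r / 2] keep the box strictly inside the ball of radius [r] for the maximum
   norm. *)
pose B := rV_box (fun _ : 'I_N => 0 : R) (fun _ => r / 2).
have mB : measurable B by exact: measurable_rV_box.
pose m : R := (r / 2) ^+ N; have m0 : 0 < m by rewrite exprn_gt0// divr_gt0.
have BE : mu B = m%:E.
  rewrite [LHS]lebesgue_rV_box; last by move=> i; rewrite ltW// divr_gt0.
  by rewrite prodr_const card_ord subr0.
have B_fin : (mu B < +oo)%E by rewrite BE ltry.
have Br x : B x -> `|x| < r.
  move=> Bx; apply: (@le_lt_trans _ _ (r / 2)); last lra.
  apply/(coord_norm CV); first lra.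
  move=> i; have := Bx i; rewrite in_itv/= => /andP[x0 xr].
  by rewrite ger0_norm.
pose avg H := fun x : X => m^-1 * average mu B (@horizontal R N) H x.
have savg H : sqintegrable P H -> sqintegrable P (avg H).
  by move=> sH; apply: sqintegrableZ; exact: (sqintegrable_average CX mB B_fin (@measurable_horizontal R N) sH).
have close H : sqintegrable P H -> (forall x, B x -> (sqint P (fun p => H (p + horizontal x)%R - H p)%R <= e%:E)%E) ->
   (sqint P (fun z => avg H z - H z)%R <= e%:E)%E.
  move=> sH hH; have := average_close CX mB B_fin (@measurable_horizontal R N) sH (ltW e0) hH.
  have sA := sqintegrable_average CX mB B_fin (@measurable_horizontal R N) sH.
  rewrite BE /= => h.
  rewrite (_ : (fun _ => _) = (fun z => m^-1 * (average mu B (@horizontal R N) H z - m * H z))); last first.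
    by apply/funext => z; rewrite mulrBr mulKf ?gt_eqF.
  rewrite sqint_scale; last by apply: (sqintegrableB sA _).1; exact: sqintegrableZ.
  apply: (@le_trans _ _ ((m^-1 ^+ 2)%:E * (m%:E * (e%:E * m%:E)))%E).
    by rewrite lee_wpmul2l// lee_fin sqr_ge0.
  rewrite -!EFinM lee_fin (_ : _ * _ = e)//; field; exact: lt0r_neq0.
have wavg v : v \in s -> weakly P (cylinder l) v (avg U) (avg (D v)).
  move=> vs; have [sD wD] := hD v vs.
  have inv x z : cylinder l (x + horizontal z) <-> cylinder (V := V) l x.
    by split => -[_ Ex]; split => //; move: Ex; rewrite /= addr0.
  have wA := weakly_average CX mB B_fin (@measurable_horizontal R N) inv sU sD wD.
  move=> phi tphi; have sphi := test_function_sqintegrable CX tphi.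
  have sDphi := test_function_sqintegrable CX (test_function_derive v tphi).
  have E f psi : sqintegrable P f -> sqintegrable P psi ->
      \int[P]_x (avg f x * psi x) = m^-1 * \int[P]_x (average mu B (@horizontal R N) f x * psi x).
    move=> sf spsi; rewrite -RintegralZl//.
      by apply: eq_Rintegral => x _; rewrite mulrA.
    by apply: sqintegrableM => //; exact: (sqintegrable_average CX mB B_fin (@measurable_horizontal R N) sf).
  by rewrite !E// (wA _ tphi) mulrN.
pose G := D (0, 1 : R); have [sG wG] := hD _ s01.
(* The trace at height [q.2] of the averaged function, expressed by box pairings; it is defined on
   the whole space and agrees with the average almost everywhere in the cylinder. *)
pose F (q : X) := m^-1 * (box_pairing B (mean_kernel a) U q.1 + box_pairing B (ramp_kernel a q.2) G q.1).
have cF : continuous F.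
  (* The mean kernel does not depend on the height, so the constant is 0. *)
  have c1 := continuous_box_pairing mB B_fin (ltac:(exact: lexx 0) : 0 <= 0 :> R)
    (fun=> sqintegrable_mean_kernel a) _ sU.
  have c2 := continuous_box_pairing mB B_fin (ltac:(exact: ler01) : 0 <= 1 :> R)
    (sqintegrable_ramp_kernel a) (sqint_ramp_kernelB a) sG.
  move=> q; apply: cvgM; first exact: cvg_cst.
  apply: cvgD; last exact: c2.
  apply: c1 => y z; under [X in sqint leb X]eq_fun do rewrite subrr.
  by rewrite /sqint integral0_eq ?lee_fin ?mul0r// => x _; rewrite /= expr0n.
exists F, (avg U), (fun v => avg (D v)); split.
- exact: cF.
- have mF := coord_continuous_measurable CX cF.
  have sA := savg _ sU; have sAG := savg _ sG.
  have mC : measurable (cylinder l) := coord_open_measurable CX (@open_cylinder _ _ _ l).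
  have mH : measurable_fun setT (fun q : X => \1_(cylinder l) q * (F q - avg U q)).
    apply: measurable_funM; first exact: measurable_indic.
    by apply: measurable_funB => //; exact: sA.1.
  have : {ae P, forall z, \1_(cylinder l) z * (F z - avg U z) = 0}.
    apply: (@ae_prod1 _ _ _ _ _ mu leb (fun z => \1_(cylinder l) z * (F z - avg U z) = 0)).
      rewrite (_ : mkset _ = (fun q : X => \1_(cylinder l) q * (F q - avg U q)) @^-1` [set 0])//.
      by rewrite -[X in measurable X]setTI; exact: mH.
    have sB H : sqintegrable P H -> sqintegrable P (average mu B (@horizontal R N) H).
      exact: (sqintegrable_average CX mB B_fin (@measurable_horizontal R N)).
    have := ae_trace_representation CV l0 a0 al sA sAG (wavg _ s01).
    have := sqintegrable_slice1 (m1 := mu) (m2 := leb) (sB _ sU).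
    have := sqintegrable_slice1 (m1 := mu) (m2 := leb) (sB _ sG).
    apply: filterS3 => x sGx sUx [_]; apply: ae_mono => y hy.
    have pZ k H : sqintegrable leb k -> sqintegrable leb (fun y => H (x, y)) ->
        pairing leb k (fun z : X => m^-1 * H z) x = m^-1 * pairing leb k H x.
      move=> sk sH; rewrite /pairing -RintegralZl//; last by exact: (sqintegrableM sk sH).
      by apply: eq_Rintegral => t _; rewrite mulrCA.
    rewrite indicE; have [/set_mem[_ Ey]|_] := boolP (_ \in _); last by rewrite mul0r.
    rewrite hy// mul1r /F /= (box_pairingE mB B_fin x (sqintegrable_mean_kernel a) sU).
    rewrite (box_pairingE mB B_fin x (sqintegrable_ramp_kernel a y) sG).
    rewrite /trace_pairing /avg.
    by rewrite !pZ// -?mulrDr ?subrr//; [exact: sqintegrable_ramp_kernel|exact: sqintegrable_mean_kernel].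
  apply: filterS => z + Cz; rewrite indicE mem_set// mul1r => /eqP.
  by rewrite subr_eq0 => /eqP.
- exact: savg.
- by apply: close => // x /Br; rewrite lt_min => /andP[_]; exact: h2.
- move=> v vs; split; [exact: savg (hD v vs).1|exact: wavg|].
  by apply: close => [|x /Br]; [exact: (hD v vs).1|rewrite lt_min => /andP[xr _]; exact: h1].
Qed.

End density.

(** * Traces *)

Section sobolev_patch.
Context (R : realType) d (V : measurableNormedModType d R).
Variables (mu : {sigma_finite_measure set V -> \bar R}) (C : coord_space mu).
Variables (dirs : seq V) (Omega : set V) (oO : open Omega).
Implicit Types (f g u : V -> R) (D : V -> V -> R) (v : V).

Let mO : measurable Omega := coord_open_measurable C oO.

Lemma sqintegrable_patch f : sqintegrable mu f -> sqintegrable mu (f \_ Omega).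
Proof.
move=> sf; apply: (le_sqintegrable _ _ sf).
  by apply/(measurable_restrictT _ mO); apply: measurable_funTS; exact: sf.1.
by move=> x; rewrite patchE; case: ifP => // _; rewrite normr0.
Qed.

Lemma patch_on f x : Omega x -> (f \_ Omega) x = f x.
Proof. by move=> Ox; rewrite patchE mem_set. Qed.

Lemma patch_patch f : (f \_ Omega) \_ Omega = f \_ Omega.
Proof. by apply/funext => x; rewrite !patchE; case: (x \in Omega). Qed.

Lemma patch_lin c f g :
  (fun x => c * f x + g x) \_ Omega = (fun x => c * (f \_ Omega) x + (g \_ Omega) x).
Proof.
by apply/funext => x; rewrite !patchE; case: ifP => // _; rewrite mulr0 addr0.
Qed.

Lemma patch_ae f g : {ae mu, forall x, Omega x -> f x = g x} ->
  {ae mu, forall x, (f \_ Omega) x = (g \_ Omega) x}.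
Proof. by apply: filterS => x h; rewrite !patchE; case: ifP => // /set_mem/h. Qed.

Lemma weakly_patch v u g : sqintegrable mu u -> sqintegrable mu g ->
  weakly mu Omega v u g -> weakly mu Omega v (u \_ Omega) (g \_ Omega).
Proof.
move=> su sg; apply: (ae_weakly C) => //.
- exact: (sqintegrable_patch su).1.
- exact: (sqintegrable_patch sg).1.
- by apply: aeW => x Ox; rewrite patch_on.
- by apply: aeW => x Ox; rewrite patch_on.
Qed.

Lemma H1_weakly u : H1 mu dirs Omega u <->
  sqintegrable mu (u \_ Omega) /\
  forall v, v \in dirs -> exists g, sqintegrable mu g /\ weakly mu Omega v (u \_ Omega) g.
Proof.
split=> [[L2u hu]|[su hu]].
  split; first exact/(L2P _ _ mO).
  move=> v /hu[g [L2g wg]]; exists (g \_ Omega); split; first exact/(L2P _ _ mO).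
  exact/(weak_derivativeP C v mO).
have L2u : L2 mu Omega u by exact/(L2P _ _ mO).
split => // v /hu[g [sg wg]]; have L2g : L2 mu Omega g by apply/(L2P _ _ mO); exact: sqintegrable_patch.
exists g; split => //; apply/(weak_derivativeP C v mO) => //.
by have := weakly_patch su sg wg; rewrite patch_patch.
Qed.

Lemma H1_measurable u : H1 mu dirs Omega u -> sqintegrable mu (u \_ Omega).
Proof. by case/H1_weakly. Qed.

(** [wderive] is an arbitrary choice, so this function is only accessible up to null sets, through
    [gradientP] and [gradient_unique]. *)
Definition gradient v u : V -> R := wderive mu Omega v u \_ Omega.

Lemma gradientP u v : H1 mu dirs Omega u -> v \in dirs ->
  sqintegrable mu (gradient v u) /\ weakly mu Omega v (u \_ Omega) (gradient v u).
Proof.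
move=> [L2u hu] /hu h; rewrite /gradient /wderive.
have [L2g wg] := xgetPex (fun=> 0) h.
by split; [exact/(L2P _ _ mO)|exact/(weak_derivativeP C v mO)].
Qed.

Lemma gradient_unique u v g : H1 mu dirs Omega u -> v \in dirs -> sqintegrable mu g ->
  weakly mu Omega v (u \_ Omega) g -> {ae mu, forall x, gradient v u x = (g \_ Omega) x}.
Proof.
move=> Hu vd sg wg; have [sG wG] := gradientP Hu vd.
have := patch_ae (weakly_unique C oO sG sg wG wg).
by rewrite patch_patch.
Qed.

Lemma H1sqE u : H1sq mu dirs Omega u =
  (sqint mu (u \_ Omega) + \sum_(v <- dirs) sqint mu (gradient v u))%E.
Proof. by rewrite /H1sq L2sqE; congr (_ + _)%E; apply: eq_bigr => v _; rewrite L2sqE. Qed.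

(** By uniqueness any weak derivatives compute the norm. In particular, slices of the gradient on
    the cylinder may replace the derivatives chosen on each slice. *)
Lemma H1sq_weakly u D : sqintegrable mu (u \_ Omega) ->
  (forall v, v \in dirs -> sqintegrable mu (D v) /\ weakly mu Omega v (u \_ Omega) (D v)) ->
  H1 mu dirs Omega u /\
  H1sq mu dirs Omega u = (sqint mu (u \_ Omega) + \sum_(v <- dirs) sqint mu (D v \_ Omega))%E.
Proof.
move=> su hD; have Hu : H1 mu dirs Omega u by apply/H1_weakly; split => // v /hD h; exists (D v).
split => //; rewrite H1sqE; congr (_ + _)%E; apply: eq_big_seq => v vd.
by apply: ae_eq_sqint; have [sD wD] := hD v vd; exact: (gradient_unique Hu).
Qed.

Lemma H1sq_ge0 u : (0 <= H1sq mu dirs Omega u)%E.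
Proof. by rewrite H1sqE adde_ge0 ?sqint_ge0// sume_ge0// => v _; exact: sqint_ge0. Qed.

Lemma sqint_le_H1sq u : (sqint mu (u \_ Omega) <= H1sq mu dirs Omega u)%E.
Proof. by rewrite H1sqE leeDl// sume_ge0// => v _; exact: sqint_ge0. Qed.

Lemma sqint_gradient_le_H1sq u v : v \in dirs ->
  (sqint mu (u \_ Omega) + sqint mu (gradient v u) <= H1sq mu dirs Omega u)%E.
Proof.
move=> vd; rewrite H1sqE (big_rem v)//=; apply: leeD => //.
by rewrite leeDl// sume_ge0// => w _; exact: sqint_ge0.
Qed.

Lemma gradient_le_H1sq u v : v \in dirs -> (sqint mu (gradient v u) <= H1sq mu dirs Omega u)%E.
Proof.
by move/(sqint_gradient_le_H1sq u); apply: le_trans; rewrite leeDr// sqint_ge0.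
Qed.

Lemma H1_lin c u u' : H1 mu dirs Omega u -> H1 mu dirs Omega u' ->
  H1 mu dirs Omega (fun x => c * u x + u' x) /\
  forall v, v \in dirs -> weakly mu Omega v ((fun x => c * u x + u' x) \_ Omega)
     (fun x => c * gradient v u x + gradient v u' x) /\
   {ae mu, forall x, gradient v (fun x => c * u x + u' x) x = c * gradient v u x + gradient v u' x}.
Proof.
move=> Hu Hu'; have E := patch_lin c u u'.
have su := H1_measurable Hu; have su' := H1_measurable Hu'.
have w v : v \in dirs -> sqintegrable mu (fun x => c * gradient v u x + gradient v u' x) /\
    weakly mu Omega v ((fun x => c * u x + u' x) \_ Omega) (fun x => c * gradient v u x + gradient v u' x).
  move=> vd; have [s1 w1] := gradientP Hu vd; have [s2 w2] := gradientP Hu' vd.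
  split; first by apply: sqintegrableD => //; exact: sqintegrableZ.
  by rewrite E; exact: weakly_lin.
have H : H1 mu dirs Omega (fun x => c * u x + u' x).
  apply/H1_weakly; rewrite {1}E; split; first by apply: sqintegrableD => //; exact: sqintegrableZ.
  by move=> v /w h; exists (fun x => c * gradient v u x + gradient v u' x).
split => // v vd; have [s1 w1] := w v vd; split => //.
have := gradient_unique H vd s1 w1.
apply: filterS => x ->; rewrite /gradient !patchE; case: (x \in Omega) => //.
by rewrite mulr0 addr0.
Qed.

End sobolev_patch.

Section closed_interval.
Context (R : realType).
Local Notation leb := (@lebesgue_measure R : {sigma_finite_measure set (measurableTypeR R) -> \bar R}).
Implicit Types (f g : R -> R) (l : \bar R).

Definition left_closure l : set R := [set y | 0 <= y /\ (y%:E <= l)%E].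

(** At the endpoints the interval lies on one side of [y]. Having positive length, it contains a
    point outside any given null set. *)
Lemma left_closure_itv l y r : (0 < l)%E -> left_closure l y -> 0 < r ->
  exists a b, a < b /\ forall z, a < z < b -> left_interval l z /\ `|y - z| < r.
Proof.
move=> l0 [y0 yl] r0; have [ltyl|leyl] := ltP y%:E l.
  have [b [yb br bl]] : exists b, [/\ y < b, b <= y + r & (b%:E <= l)%E].
    case: l l0 yl ltyl => [L| |] //; rewrite ?lte_fin => L0 yL ltyl.
      exists (Num.min (y + r) L); rewrite lt_min ltyl ltrDl r0 ge_min lexx lee_fin ge_min lexx orbT//.
    by exists (y + r); rewrite ltrDl r0 lexx leey.
  exists y, b; split => // z /andP[yz zb]; split.
    by split; [exact: le_lt_trans yz|apply: lt_le_trans bl; rewrite lte_fin].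
  by rewrite ltr0_norm ?subr_lt0// opprB ltrBlDl (lt_le_trans zb br).
have E : l = y%:E by apply/le_anti; rewrite leyl yl.
have y00 : 0 < y by rewrite -lte_fin -E.
exists (Num.max 0 (y - r)), y; split; first by rewrite gt_max y00 gtrBl r0.
move=> z; rewrite gt_max => /andP[/andP[z0 yrz] zy]; split.
  by split => //; rewrite E lte_fin.
by rewrite gtr0_norm ?subr_gt0// ltrBlDl -ltrBlDr.
Qed.

Lemma ae_eq_left_closure l f g : (0 < l)%E ->
  {within left_closure l, continuous f} -> {within left_closure l, continuous g} ->
  {ae leb, forall y, left_interval l y -> f y = g y} ->
  forall y, left_closure l y -> f y = g y.
Proof.
move=> l0 cf cg h y ly; apply/eqP; rewrite -subr_eq0; apply/negPn/negP => fg0.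
have cfy := (subspace_continuousP _ _).1 cf y ly; have cgy := (subspace_continuousP _ _).1 cg y ly.
have cfg : (fun z => f z - g z) @ within (left_closure l) (nbhs y) --> f y - g y by exact: cvgB.
have e0 : 0 < `|f y - g y| by rewrite normr_gt0.
have : \forall z \near within (left_closure l) (nbhs y), `|(f y - g y) - (f z - g z)| < `|f y - g y|.
  by apply: cvgr_dist_lt cfg _ e0.
case/nbhs_ballP => r /= r0 hr.
have [a [b [ab habz]]] := left_closure_itv l0 ly r0.
have [z abz hz] := ae_lebesgue_itv ab h.
have [lz yz] := habz z abz; have := hr z yz.
case: (lz) => z0 zl; move/(_ (conj (ltW z0) (ltW zl))).
by rewrite hz// subrr subr0 ltxx.
Qed.

Lemma slice_continuous_left_closure d (V : measurableNormedModType d R) l (f : V * measurableTypeR R -> R) x :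
  {within [set: V] `*` left_closure l, continuous f} ->
  {within left_closure l, continuous (fun y => f (x, y))}.
Proof.
move=> cf; apply/subspace_continuousP => y ly.
have h := (subspace_continuousP _ _).1 cf (x, y) (conj Logic.I ly).
apply: (@cvg_comp _ _ _ (fun y : measurableTypeR R => (x, y)) f _
  (within ([set: V] `*` left_closure l) (nbhs (x, y))) _ _ h).
move=> A hA; have := @cvg_pair_r R _ _ V (measurableTypeR R) y x _ hA.
rewrite /within /= => H; change (\forall z \near (y : R), left_closure l z -> A (x, z)).
apply: (@filterS R (nbhs (y : R)) _ (fun z => True /\ left_closure l z -> A (x, z))) H => z hz lz.
exact: hz.
Qed.

End closed_interval.

Section trace_operator.
Context (R : realType) (G : metric_graph R) (N : nat).
Local Notation leb := (@lebesgue_measure R : {sigma_finite_measure set (measurableTypeR R) -> \bar R}).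
Local Notation V := 'rV[R]_N.
Local Notation mu := (lebesgue_rV N : {sigma_finite_measure set V -> \bar R}).
Local Notation X := (V * measurableTypeR R)%type.
Local Notation P := (prod_measure mu leb).
Local Notation CV := (coord_space_rV R N).
Local Notation CX := (coord_space_cyl CV).
Variable (e : edge G).
Local Notation Omega := (cyl_open (N := N) e).
Implicit Types (f g : X -> R).

Lemma open_cyl : open Omega.
Proof. exact: (@open_cylinder _ _ _ (len e)). Qed.

Definition vertical : X := (0, 1 : R).

Lemma vertical_dirs : vertical \in dirs_prod (R := R) N.
Proof. by rewrite mem_cat mem_head orbT. Qed.

Lemma H1_cyl_patch f : H1_cyl e f -> sqintegrable P (f \_ Omega).
Proof. exact: (H1_measurable CX (@open_cyl)). Qed.

Lemma H1_cyl_gradient f v : H1_cyl e f -> v \in dirs_prod N ->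
  sqintegrable P (gradient P Omega v f) /\ weakly P Omega v (f \_ Omega) (gradient P Omega v f).
Proof. exact: (gradientP CX (@open_cyl)). Qed.

Lemma H1sq_cylE f : H1sq_cyl e f =
  (sqint P (f \_ Omega) + \sum_(v <- dirs_prod N) sqint P (gradient P Omega v f))%E.
Proof. by rewrite /H1sq_cyl; exact (H1sqE P (dirs_prod N) Omega f). Qed.

Lemma H1_cyl_lin (c : R) f g : H1_cyl e f -> H1_cyl e g -> H1_cyl e (fun z => c * f z + g z).
Proof. by move=> Hf Hg; case: (H1_lin CX (@open_cyl) c Hf Hg). Qed.

Variables (a : R) (a0 : 0 < a) (ae_ : `]0, a[ `<=` left_interval (len e)).

Definition edge_trace p f : V -> R := trace_pairing a p (f \_ Omega) (gradient P Omega vertical f).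

Lemma edge_trace_representation f : H1_cyl e f ->
  {ae mu, forall x, (forall p, edge_trace p f x = edge_trace 0 f x + prim (fun y => gradient P Omega vertical f (x, y)) p) /\
    {ae leb, forall y, edge_open e y -> f (x, y) = edge_trace y f x}}.
Proof.
move=> Hf; have [sG wG] := H1_cyl_gradient Hf vertical_dirs.
have := ae_trace_representation CV (len_gt0 e) a0 ae_ (H1_cyl_patch Hf) sG wG.
apply: filterS => x [h1 h2]; split => //; apply: ae_mono h2 => y hy Ey.
by rewrite /edge_trace -hy// patch_on.
Qed.

Lemma is_trace_operator_edge_trace p : edge_closed e p -> is_trace_operator e p (edge_trace p).
Proof.
move=> ep; split.
- move=> f Hf; have [sG _] := H1_cyl_gradient Hf vertical_dirs.
  exact: (sqintegrable_trace_pairing a p (H1_cyl_patch Hf) sG).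
- move=> c f g Hf Hg; have [sf _] := H1_cyl_gradient Hf vertical_dirs.
  have [sg _] := H1_cyl_gradient Hg vertical_dirs.
  have [H /(_ _ vertical_dirs)[_ hG]] := H1_lin CX (@open_cyl) c Hf Hg.
  have [sh _] := H1_cyl_gradient H vertical_dirs.
  have sl : sqintegrable P (fun x => c * gradient P Omega vertical f x + gradient P Omega vertical g x).
    exact: (sqintegrableD (sqintegrableZ c sf) sg).
  have pE := patch_lin Omega c f g.
  have h1 := ae_trace_pairing a p (H1_cyl_patch H).1 (H1_cyl_patch H).1 sh.1 sl.1 (aeW _ (fun=> erefl)) hG.
  have h2 := trace_pairing_lin a p c (H1_cyl_patch Hf) (H1_cyl_patch Hg) sf sg.
  by apply: filterS2 h1 h2 => x e1 e2; rewrite /edge_trace e1 pE.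
- have [K K0 hK] := sqint_trace_pairing mu a p; exists K => f Hf.
  have [sf _] := H1_cyl_gradient Hf vertical_dirs.
  apply: (le_trans (hK _ _ (H1_cyl_patch Hf) sf)); apply: lee_wpmul2l; first by rewrite lee_fin.
  exact: (sqint_gradient_le_H1sq P _ f vertical_dirs).
- move=> f Hf cf; have := edge_trace_representation Hf.
  have [sf _] := H1_cyl_gradient Hf vertical_dirs.
  apply: filterS2 (sqintegrable_slice1 (m1 := mu) (m2 := leb) sf) => x sx [h1 h2].
  apply/esym/(@ae_eq_left_closure R (len e) (fun y => f (x, y)) (fun y => edge_trace y f x)) => //.
  + exact: len_gt0.
  + exact: slice_continuous_left_closure.
  + apply: continuous_subspaceT; under eq_fun do rewrite h1.
    by move=> y; apply: cvgD; [exact: cvg_cst|exact: continuous_prim].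
Qed.

(** The continuous [F] is only almost everywhere equal on the cylinder to the average whose
    derivatives are known, so these are transferred by [ae_weakly]. The form [-1 * F z + f z] fits
    the linearity clause of [is_trace_operator]. *)
Lemma H1_cyl_density f : H1_cyl e f -> forall eps : R, 0 < eps -> exists F : X -> R,
  [/\ continuous F, H1_cyl e F & (H1sq_cyl e (fun z => (-1 * F z + f z)%R) <= eps%:E)%E].
Proof.
move=> Hf eps eps0; pose s := dirs_prod (R := R) N.
pose n : R := (size s)%:R; have n0 : 0 < 1 + n by rewrite ltr_pwDl// ler0n.
(* [H1sq] has one term for the function and [n] for its derivatives. *)
have e0 : 0 < eps / (1 + n) by rewrite divr_gt0.
have [F [AU [AD [cF FA sAU AUf hAD]]]] := cylinder_density (len_gt0 e) (H1_cyl_patch Hf) vertical_dirs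
  (fun v vs => H1_cyl_gradient Hf vs) e0.
have FAp : {ae P, forall z, (F \_ Omega) z = (AU \_ Omega) z} := patch_ae FA.
have mO : measurable Omega := coord_open_measurable CX (@open_cyl).
have mF := coord_continuous_measurable CX cF.
have mFO : measurable_fun setT (F \_ Omega).
  by apply/(measurable_restrictT _ mO); apply: measurable_funTS.
have sAO := sqintegrable_patch CX (@open_cyl) sAU.
have sFO : sqintegrable P (F \_ Omega).
  by split => //; rewrite (ae_eq_sqint FAp); exact: sAO.2.
have wF v : v \in s -> weakly P Omega v (F \_ Omega) (AD v).
  move=> vs; have [sD wD _] := hAD v vs.
  apply: (ae_weakly CX mFO sD.1 sAU sD) wD; last exact: aeW.
  by apply: filterS FA => z hz Oz; rewrite -hz// patch_on.
have HF : H1_cyl e F.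
  apply/(H1_weakly CX _ (@open_cyl)); split => // v vs; exists (AD v); split; last exact: wF.
  by have [] := hAD v vs.
exists F; split => //.
have [H hH] := H1_lin CX (@open_cyl) (-1) HF Hf.
rewrite H1sq_cylE.
have le0 : (sqint P ((fun z => (-1 * F z + f z)%R) \_ Omega) <= (eps / (1 + n))%:E)%E.
  apply: (le_trans _ AUf); apply: ae_le_nnintegral => [z|z|]; rewrite ?lee_fin ?sqr_ge0//.
  apply: filterS FAp => z; rewrite patch_lin => ->; rewrite lee_fin mulN1r addrC -sqrrN opprB.
  rewrite !patchE; case: (z \in Omega) => //.
  by rewrite subrr expr0n sqr_ge0.
have le1 v : v \in s -> (sqint P (gradient P Omega v (fun z => (-1 * F z + f z)%R)) <= (eps / (1 + n))%:E)%E.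
  move=> vs; have [sD _ Df] := hAD v vs; have [_ hG] := hH v vs.
  have hF := gradient_unique CX (@open_cyl) HF vs sD (wF v vs).
  apply: (le_trans _ Df); apply: ae_le_nnintegral => [z|z|]; rewrite ?lee_fin ?sqr_ge0//.
  apply: filterS2 hG hF => z -> ->; rewrite lee_fin mulN1r addrC -sqrrN opprB.
  rewrite /gradient !patchE; case: (z \in Omega) => //.
  by rewrite subrr expr0n sqr_ge0.
apply: (@le_trans _ _ ((eps / (1 + n))%:E + \sum_(v <- s) (eps / (1 + n))%:E)%E).
  by apply: leeD => //; rewrite big_seq [leRHS]big_seq; apply: lee_sum.
rewrite sumEFin big_const_seq count_predT iter_addr_0 -EFinD lee_fin -mulr_natr -/n.
by rewrite -[X in X + _]mulr1 -mulrDr divfK// gt_eqF.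
Qed.

(** Both operators agree on a continuous [F] close to [f], so their difference at [f] is their
    difference at [f - F], which boundedness makes arbitrarily small. *)
Lemma trace_operator_unique p T T' : is_trace_operator e p T -> is_trace_operator e p T' ->
  forall f, H1_cyl e f -> {ae mu, forall x, T f x = T' f x}.
Proof.
move=> [TL2 Tlin [C TC] Tc] [TL2' Tlin' [C' TC'] Tc'] f Hf.
have H0 (h : X -> R) : (0 <= H1sq_cyl e h)%E by exact (H1sq_ge0 P (dirs_prod N) Omega h).
(* The bounds [C] and [C'] come without sign, hence the absolute values; the factors 2 are those of
   [sqint_sub]. *)
pose K := 2 * `|C| + 2 * `|C'|; have K0 : 0 <= K by rewrite addr_ge0// mulr_ge0.
have sub (h : X -> R) : H1_cyl e h -> (sqint mu (fun x => T h x - T' h x)%R <= K%:E * H1sq_cyl e h)%E.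
  move=> Hh; apply: (le_trans (sqint_sub mu (TL2 h Hh).1 (TL2' h Hh).1)).
  rewrite /K [(_ + _)%:E]EFinD [leRHS]ge0_muleDl ?lee_fin ?mulr_ge0// [(2 * `|C|)%:E]EFinM [(2 * `|C'|)%:E]EFinM -!muleA.
  apply: leeD; apply: lee_wpmul2l; rewrite ?lee_fin//.
    by apply: (le_trans (TC h Hh)); apply: lee_wpmul2r; rewrite ?H0// lee_fin ler_norm.
  by apply: (le_trans (TC' h Hh)); apply: lee_wpmul2r; rewrite ?H0// lee_fin ler_norm.
have le_eps (eps : R) : 0 < eps -> (sqint mu (fun x => T f x - T' f x)%R <= eps%:E)%E.
  move=> eps0; have K1 : 0 < K + 1 by rewrite ltr_wpDl.
  have e0 : 0 < eps / (K + 1) by rewrite divr_gt0.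
  have [F [cF HF hF]] := H1_cyl_density Hf e0.
  have cFw : {within cyl_closed e, continuous F} by exact: continuous_subspaceT.
  have Hh := H1_cyl_lin (-1) HF Hf.
  have -> : sqint mu (fun x => T f x - T' f x) =
    sqint mu (fun x => T (fun z => (-1 * F z + f z)%R) x - T' (fun z => (-1 * F z + f z)%R) x).
    apply: ae_eq_sqint.
    have h1 := Tlin (-1) F f HF Hf; have h2 := Tlin' (-1) F f HF Hf.
    have h3 := Tc F HF cFw; have h4 := Tc' F HF cFw.
    apply: filterS2 (filterI h1 h2) (filterI h3 h4) => x [e1 e2] [e3 e4].
    by rewrite e1 e2 e3 e4; lra.
  apply: (le_trans (sub _ Hh)); apply: (@le_trans _ _ (K%:E * (eps / (K + 1))%:E)%E).
    by apply: lee_wpmul2l; rewrite ?lee_fin.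
  by rewrite -EFinM lee_fin mulrCA ler_piMr ?ltW// ltr_pdivrMr// mul1r ltrDl.
have m : measurable_fun setT (fun x => T f x - T' f x).
  by apply: measurable_funB; [exact: (TL2 f Hf).1|exact: (TL2' f Hf).1].
have s0 : sqint mu (fun x => T f x - T' f x) = 0%E.
  apply/eqP; rewrite eq_le sqint_ge0 andbT; apply/lee_addgt0Pr => eps eps0.
  by rewrite add0e; exact: le_eps.
have := sqint_eq0 m s0; apply: filterS => x /eqP.
by rewrite subr_eq0 => /eqP.
Qed.

Lemma trace_edge_trace p f : edge_closed e p -> H1_cyl e f ->
  {ae mu, forall x, trace e p f x = edge_trace p f x}.
Proof.
move=> ep Hf; have T := is_trace_operator_edge_trace ep.
have T' : is_trace_operator (N := N) e p (trace e p).
  have ex : [set T | is_trace_operator (N := N) e p T] !=set0 by exists (edge_trace p).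
  exact (xgetPex (fun _ _ => 0) ex).
exact: trace_operator_unique T' T f Hf.
Qed.

End trace_operator.

(** * Edgewise and fiberwise functions *)

Section countable_families.
Context (R : realType) (I : countType).

(** Numbers that code no index contribute 0. As a series, the sum over edges can be exchanged with
    integrals by monotone convergence. *)
Lemma esum_countable (f : I -> \bar R) : (forall i, 0 <= f i)%E ->
  (\esum_(i in [set: I]) f i = \sum_(n <oo) oapp f 0 (pickle_inv n))%E.
Proof.
move=> f0; have g0 n : (0 <= oapp f 0 (pickle_inv n) :> \bar R)%E by case: pickle_inv.
rewrite nneseries_esumT//.
have inj : {in [set: I] &, injective pickle} by move=> i j _ _; exact: (pcan_inj pickleK_inv).
have := @reindex_esum R _ _ _ _ _ (fun n => oapp f 0%E (pickle_inv n)) (inj_bij inj).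
under [RHS]eq_esum do rewrite pickleK_inv.
move=> /= <-; rewrite esum_mkcond; apply: eq_esum => n _.
case: ifPn => // /negP nr; case E : (pickle_inv n) => [i|] //=; exfalso; apply: nr.
apply/mem_set; exists i => //; by have := @pickle_invK I n; rewrite E.
Qed.

Lemma ge0_integral_esum d (T : measurableType d) (mu : {measure set T -> \bar R}) (f : I -> T -> \bar R) :
  (forall i x, 0 <= f i x)%E -> (forall i, measurable_fun setT (f i)) ->
  (\int[mu]_x (\esum_(i in [set: I]) f i x) = \esum_(i in [set: I]) \int[mu]_x f i x)%E.
Proof.
move=> f0 mf; under eq_integral do rewrite esum_countable//.
rewrite esum_countable; last by move=> i; exact: integral_ge0.
rewrite integral_nneseries//.
- by apply: eq_eseriesr => n _; case: pickle_inv => //=; rewrite integral0.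
- by move=> n; case: pickle_inv => //=; exact: measurable_cst.
- by move=> n x _; case: pickle_inv => /=.
Qed.

Lemma measurable_esum d (T : measurableType d) (f : I -> T -> \bar R) :
  (forall i x, 0 <= f i x)%E -> (forall i, measurable_fun setT (f i)) ->
  measurable_fun setT (fun x => \esum_(i in [set: I]) f i x)%E.
Proof.
move=> f0 mf; under eq_fun do rewrite esum_countable//.
apply: ge0_emeasurable_sum => [n x _ _|n _]; case: pickle_inv => //=; exact: measurable_cst.
Qed.

Lemma ae_forall_countable d (T : measurableType d) (mu : {measure set T -> \bar R}) (P : I -> T -> Prop) :
  (forall i, {ae mu, forall x, P i x}) -> {ae mu, forall x, forall i, P i x}.
Proof.
move=> hP.
have : {ae mu, forall x, forall n, if pickle_inv n is Some i then P i x else True}.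
  by apply: ae_foralln => n; case: (pickle_inv n) => [i|]; [exact: hP|exact: aeW].
by apply: ae_mono => x + i => /(_ (pickle i)); rewrite pickleK_inv.
Qed.

End countable_families.

Section cylinder_slices.
Context (R : realType) (G : metric_graph R) (N : nat).
Local Notation leb := (@lebesgue_measure R : {sigma_finite_measure set (measurableTypeR R) -> \bar R}).
Local Notation V := 'rV[R]_N.
Local Notation mu := (lebesgue_rV N : {sigma_finite_measure set V -> \bar R}).
Local Notation X := (V * measurableTypeR R)%type.
Local Notation P := (prod_measure mu leb).
Local Notation CV := (coord_space_rV R N).
Local Notation CX := (coord_space_cyl CV).
Local Notation CR := (coord_space_R R).
Implicit Types (f : X -> R).

Lemma cyl_patchE (e : edge G) f x y : (f \_ (cyl_open (N := N) e)) (x, y) = ((fun y => f (x, y)) \_ (edge_open e)) y.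
Proof.
rewrite !patchE; have [/set_mem Ey|Ey] := boolP (y \in edge_open e); first by rewrite mem_set.
by rewrite memNset// => -[_ /mem_set]; rewrite (negbTE Ey).
Qed.

Lemma cyl_patch0 (e : edge G) f x y : ~ edge_open e y -> (f \_ (cyl_open (N := N) e)) (x, y) = 0.
Proof. by move=> Ey; rewrite cyl_patchE patchE memNset. Qed.

(** Slices of the horizontal gradients on the cylinder are weak derivatives of the slices, so
    [H1sq_weakly] computes the norm of a slice from jointly measurable functions. *)
Lemma hslice (e : edge G) f : H1_cyl e f -> {ae leb, forall y, edge_open e y ->
  H1 mu (dirs_rV N) setT (fun x => f (x, y)) /\
  H1sq mu (dirs_rV N) setT (fun x => f (x, y)) =
    (sqint mu (fun x => (f \_ (cyl_open e)) (x, y)) +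
     \sum_(v <- dirs_rV N) sqint mu (fun x => gradient P (cyl_open e) (horizontal v) f (x, y)))%E}.
Proof.
move=> Hf; have sU := H1_cyl_patch Hf.
have dir (i : 'I_N) : horizontal (delta_mx 0 i : V) \in dirs_prod N.
  by rewrite mem_cat; apply/orP; left; apply/mapP; exists (delta_mx 0 i) => //; exact: codom_f.
have hD (i : 'I_N) : {ae leb, forall y, sqintegrable mu (fun x => gradient P (cyl_open e) (horizontal (delta_mx 0 i)) f (x, y)) /\
    (edge_open e y -> weakly mu setT (delta_mx 0 i : V) (fun x => (f \_ (cyl_open e)) (x, y))
      (fun x => gradient P (cyl_open e) (horizontal (delta_mx 0 i)) f (x, y)))}.
  have [sD wD] := H1_cyl_gradient Hf (dir i).
  have := slice_weakly CX CV (S := slicing_h mu leb) (Omega1 := setT) (Omega2 := edge_open e)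
    (@open_cyl _ _ N e) (@convex_cylinder_h _ _ V (len e) (delta_mx 0 i)) openT
    (fun y x Ey _ => conj Logic.I Ey) sU sD wD.
  by apply: ae_mono2 (sqintegrable_slice2 (m1 := mu) (m2 := leb) sD).
have := sqintegrable_slice2 (m1 := mu) (m2 := leb) sU.
apply: ae_mono2 (ae_forall_countable hD) => y hy sUy Ey.
have E : (fun x => f (x, y)) = (fun x => (f \_ (cyl_open e)) (x, y)).
  by apply/funext => x; rewrite patch_on.
have su : sqintegrable mu ((fun x => f (x, y)) \_ setT) by rewrite patch_setT E.
have hDv v : v \in dirs_rV N -> sqintegrable mu (fun x => gradient P (cyl_open e) (horizontal v) f (x, y)) /\
    weakly mu setT v ((fun x => f (x, y)) \_ setT) (fun x => gradient P (cyl_open e) (horizontal v) f (x, y)).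
  move=> /codomP[i ->]; have [h1 h2] := hy i; split => //.
  by rewrite patch_setT E; exact: h2.
have [H1f ->] := H1sq_weakly CV openT su hDv; split => //.
rewrite patch_setT E; congr (_ + _)%E.
by apply: eq_bigr => v _; rewrite patch_setT.
Qed.

Lemma sum_sqint_slice2 (J : eqType) (s : seq J) (g : J -> X -> R) :
  (forall j, j \in s -> measurable_fun setT (g j)) ->
  measurable_fun setT (fun y => \sum_(j <- s) sqint mu (fun x => g j (x, y)))%E /\
  (\int[leb]_y \sum_(j <- s) sqint mu (fun x => g j (x, y)) = \sum_(j <- s) sqint P (g j))%E.
Proof.
elim: s => [|j s IHs] mg.
  split; first by under eq_fun do rewrite big_nil; exact: measurable_cst.
  by under eq_integral do rewrite big_nil; rewrite big_nil integral0.
have [m1 i1] := IHs (fun k ks => mg k (mem_behead (s := j :: s) ks)).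
have mj : measurable_fun setT (fun y => sqint mu (fun x => g j (x, y))).
  exact: (measurable_sqint_slice2 mu (mg j (mem_head j s))).
split; first by under eq_fun do rewrite big_cons; exact: emeasurable_funD.
under eq_integral do rewrite big_cons.
rewrite ge0_integralD//.
- rewrite i1 big_cons; congr (_ + _)%E.
  exact/esym/(sqint_slice2 mu leb (mg j (mem_head j s))).
- by move=> y _; exact: sqint_ge0.
- by move=> y _; rewrite sume_ge0// => v _; exact: sqint_ge0.
Qed.

Lemma integral_hslice (e : edge G) f : H1_cyl e f ->
  (\int[leb]_(y in edge_open e) H1sq mu (dirs_rV N) setT (fun x => f (x, y)) =
   sqint P (f \_ (cyl_open e)) +
   \sum_(v <- dirs_rV N) sqint P (gradient P (cyl_open e) (horizontal v) f))%E.
Proof.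
move=> Hf; have sU := H1_cyl_patch Hf.
have sD v : v \in dirs_rV N -> sqintegrable P (gradient P (cyl_open e) (horizontal v) f).
  move=> vd; have vd' : horizontal v \in dirs_prod N.
    by rewrite mem_cat; apply/orP; left; apply/mapP; exists v.
  exact: (H1_cyl_gradient Hf vd').1.
pose S y := (sqint mu (fun x => (f \_ (cyl_open e)) (x, y)) +
     \sum_(v <- dirs_rV N) sqint mu (fun x => gradient P (cyl_open e) (horizontal v) f (x, y)))%E.
have mS2 g : measurable_fun setT g -> measurable_fun setT (fun y => sqint mu (fun x => g (x, y))) :=
  @measurable_sqint_slice2 _ _ _ _ _ mu g.
transitivity (\int[leb]_y S y)%E.
  (* The left integrand is not known to be measurable; it is replaced by [S], which is, before
     Tonelli is used. *)
  rewrite [LHS]integral_mkcond; apply: ae_eq_nnintegral.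
  - by move=> y; rewrite patchE; case: ifP => // _; exact: H1sq_ge0.
  - by move=> y; rewrite adde_ge0 ?sqint_ge0// sume_ge0// => v _; exact: sqint_ge0.
  apply: ae_mono (hslice Hf) => y hy; rewrite patchE.
  have [/set_mem Ey|Ey] := boolP (y \in edge_open e); first by have [_ ->] := hy Ey.
  have zero g : sqint mu (fun x => (g \_ (cyl_open e)) (x, y)) = 0%E.
    rewrite /sqint integral0_eq// => x _; rewrite cyl_patch0 ?expr0n//.
    by move=> /mem_set; rewrite (negbTE Ey).
  by rewrite /S zero add0e big1// => v _; exact: zero.
rewrite /S ge0_integralD//; last 4 first.
- by move=> y _; exact: sqint_ge0.
- exact: mS2 sU.1.
- by move=> y _; rewrite sume_ge0// => v _; exact: sqint_ge0.
- exact: (sum_sqint_slice2 (fun v vd => (sD v vd).1)).1.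
rewrite (sum_sqint_slice2 (fun v vd => (sD v vd).1)).2; congr (_ + _)%E.
exact/esym/(sqint_slice2 mu leb sU.1).
Qed.

Lemma vslice (e : edge G) f : H1_cyl e f -> {ae mu, forall x,
  H1 leb dirs_R (edge_open e) (fun y => f (x, y)) /\
  H1sq_edge e (fun y => f (x, y)) =
    (sqint leb (fun y => (f \_ (cyl_open e)) (x, y)) +
     sqint leb (fun y => gradient P (cyl_open e) (vertical R N) f (x, y)))%E}.
Proof.
move=> Hf; have sU := H1_cyl_patch Hf; have [sD wD] := H1_cyl_gradient Hf (vertical_dirs R N).
have := ae_slice_weakly CV sU sD wD; apply: filterS => x [sUx sDx wx].
have E : (fun y => f (x, y)) \_ (edge_open e) = (fun y => (f \_ (cyl_open e)) (x, y)).
  by apply/funext => y; rewrite cyl_patchE.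
have su : sqintegrable leb ((fun y => f (x, y)) \_ (edge_open e)) by rewrite E.
pose D (v : measurableTypeR R) y := gradient P (cyl_open e) (vertical R N) f (x, y).
have hD v : v \in dirs_R -> sqintegrable leb (D v) /\
    weakly (V := measurableTypeR R) leb (edge_open e) v ((fun y => f (x, y)) \_ (edge_open e)) (D v).
  by rewrite inE => /eqP ->; rewrite E.
have [H1f H1e] := H1sq_weakly CR (@open_left_interval R (len e)) su hD; split => //.
rewrite [LHS]H1e big_seq1 E; congr (_ + sqint _ _)%E.
by apply/funext => y; rewrite -cyl_patchE /gradient patch_patch.
Qed.

End cylinder_slices.

Section fiber_energies.
Context (R : realType) (G : metric_graph R) (N : nat).
Local Notation leb := (@lebesgue_measure R : {sigma_finite_measure set (measurableTypeR R) -> \bar R}).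
Local Notation V := 'rV[R]_N.
Local Notation mu := (lebesgue_rV N : {sigma_finite_measure set V -> \bar R}).
Local Notation X := (V * measurableTypeR R)%type.
Local Notation P := (prod_measure mu leb).
Local Notation CV := (coord_space_rV R N).
Local Notation CX := (coord_space_cyl CV).
Local Notation CR := (coord_space_R R).
Implicit Types (f : X -> R) (u : edge G -> X -> R).

(** The contribution of one edge to the integral over [x] in the fiberwise definition;
    [horizontal_energy] plays this role for the integral over [y]. Both contain the L^2 part, so
    each is bounded by [H1sq_cyl] and [H1sq_cyl] by their sum. *)
Definition vertical_energy (e : edge G) f : \bar R :=
  (sqint P (f \_ (cyl_open e)) + sqint P (gradient P (cyl_open e) (vertical R N) f))%E.

Definition horizontal_energy (e : edge G) f : \bar R :=
  (sqint P (f \_ (cyl_open e)) +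
   \sum_(v <- dirs_rV N) sqint P (gradient P (cyl_open e) (horizontal v) f))%E.

Lemma vertical_energy_ge0 e f : (0 <= vertical_energy e f)%E.
Proof. by rewrite adde_ge0 ?sqint_ge0. Qed.

Lemma horizontal_energy_ge0 e f : (0 <= horizontal_energy e f)%E.
Proof. by rewrite adde_ge0 ?sqint_ge0// sume_ge0// => v _; exact: sqint_ge0. Qed.

Lemma H1sq_cyl_energies e f : H1sq_cyl e f =
  (horizontal_energy e f + sqint P (gradient P (cyl_open e) (vertical R N) f))%E.
Proof. by rewrite H1sq_cylE big_cat big_map big_seq1 addeA. Qed.

Lemma vertical_energy_le e f : (vertical_energy e f <= H1sq_cyl e f)%E.
Proof.
rewrite H1sq_cyl_energies; apply: leeD => //; rewrite leeDl// sume_ge0// => v _; exact: sqint_ge0.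
Qed.

Lemma horizontal_energy_le e f : (horizontal_energy e f <= H1sq_cyl e f)%E.
Proof. by rewrite H1sq_cyl_energies leeDl// sqint_ge0. Qed.

Lemma H1sq_cyl_le_energies e f : (H1sq_cyl e f <= horizontal_energy e f + vertical_energy e f)%E.
Proof. by rewrite H1sq_cyl_energies; apply: leeD => //; rewrite leeDr// sqint_ge0. Qed.

Definition graph_energy u x : \bar R := (\esum_(e in [set: edge G])
  (sqint leb (fun y => ((u e) \_ (cyl_open e)) (x, y)) +
   sqint leb (fun y => gradient P (cyl_open e) (vertical R N) (u e) (x, y))))%E.

Lemma graph_energy_ge0 u x : (0 <= graph_energy u x)%E.
Proof. by apply: esum_ge0 => e _; rewrite adde_ge0 ?sqint_ge0. Qed.

Section graph_energy_H1.
Variables (u : edge G -> X -> R) (Hu : forall e, H1_cyl e (u e)).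

Let m1 e : measurable_fun setT (fun x => sqint leb (fun y => ((u e) \_ (cyl_open e)) (x, y))).
Proof. exact: (measurable_sqint_slice1 leb (H1_cyl_patch (Hu e)).1). Qed.

Let sD e := (H1_cyl_gradient (Hu e) (vertical_dirs R N)).1.

Let m2 e : measurable_fun setT
  (fun x => sqint leb (fun y => gradient P (cyl_open e) (vertical R N) (u e) (x, y))).
Proof. exact: (measurable_sqint_slice1 leb (sD e).1). Qed.

Lemma measurable_graph_energy : measurable_fun setT (graph_energy u).
Proof.
apply: measurable_esum => [e x|e]; first by rewrite adde_ge0 ?sqint_ge0.
exact: emeasurable_funD.
Qed.

Lemma integral_graph_energy :
  (\int[mu]_x graph_energy u x = \esum_(e in [set: edge G]) vertical_energy e (u e))%E.
Proof.
rewrite ge0_integral_esum; last 2 first.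
- by move=> e x; rewrite adde_ge0 ?sqint_ge0.
- by move=> e; exact: emeasurable_funD.
apply: eq_esum => e _; rewrite ge0_integralD//; last 2 first.
- by move=> x _; exact: sqint_ge0.
- by move=> x _; exact: sqint_ge0.
congr (_ + _)%E; first exact/esym/(sqint_slice1 mu leb (H1_cyl_patch (Hu e)).1).
exact/esym/(sqint_slice1 mu leb (sD e).1).
Qed.

Lemma ae_H1sq_graph : {ae mu, forall x, H1sq_graph (fun e y => u e (x, y)) = graph_energy u x}.
Proof.
apply: filterS (ae_forall_countable (fun e => vslice (Hu e))) => x hx.
by apply: eq_esum => e _; have [_ ->] := hx e.
Qed.

Lemma integral_H1sq_graph :
  (\int[mu]_x H1sq_graph (fun e y => u e (x, y)) = \esum_(e in [set: edge G]) vertical_energy e (u e))%E.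
Proof.
rewrite -integral_graph_energy; apply: ae_eq_nnintegral ae_H1sq_graph => [x|x].
  by apply: esum_ge0 => e _; exact (H1sq_ge0 leb dirs_R (edge_open e) _).
exact: graph_energy_ge0.
Qed.

End graph_energy_H1.

End fiber_energies.

(** * From the edgewise to the fiberwise definition *)

Section edgewise_fiberwise.
Context (R : realType) (G : metric_graph R) (N : nat).
Local Notation leb := (@lebesgue_measure R : {sigma_finite_measure set (measurableTypeR R) -> \bar R}).
Local Notation V := 'rV[R]_N.
Local Notation mu := (lebesgue_rV N : {sigma_finite_measure set V -> \bar R}).
Local Notation X := (V * measurableTypeR R)%type.
Local Notation P := (prod_measure mu leb).
Local Notation CV := (coord_space_rV R N).
Local Notation CX := (coord_space_cyl CV).
Local Notation CR := (coord_space_R R).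
Implicit Types (f : X -> R) (u : edge G -> X -> R).

Lemma ae_lty d (T : measurableType d) (nu : {measure set T -> \bar R}) (f : T -> \bar R) :
  (forall x, 0 <= f x)%E -> measurable_fun setT f -> (\int[nu]_x f x < +oo)%E ->
  {ae nu, forall x, (f x < +oo)%E}.
Proof.
move=> f0 mf foo; have : nu.-integrable setT f.
  by apply/integrableP; split => //; under eq_integral do rewrite gee0_abs//.
move/(integrable_ae measurableT); apply: filterS => x /(_ Logic.I).
by rewrite ge0_fin_numE.
Qed.

(** Gluing conditions mention arbitrary reals, but each edge has at most two glued points. A boolean
    index makes the family countable. For an edge of infinite length [fine] gives 0, again a point
    of the edge. *)
Definition endpoint (e : edge G) (b : bool) : R := if b then fine (len e) else 0.

Lemma glued_endpoint e p v : glued e p v -> edge_closed e p /\ exists b, p = endpoint e b.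
Proof.
case=> [[-> _]|[pl _]].
  by split; [split => //; rewrite ltW// len_gt0|exists false].
split; last by exists true; rewrite /endpoint -pl.
by split; rewrite ?pl// -lee_fin pl ltW// len_gt0.
Qed.

Lemma edge_start (e : edge G) : {a : R | 0 < a & `]0, a[ `<=` left_interval (len e)}.
Proof. by apply: cid2; have [a a0 ha] := left_interval_lt (len_gt0 e); exists a. Qed.

(* [rep e y x] is the continuous representative of [u e (x, y)]. *)
Lemma continuous_representatives u : (forall e, H1_cyl e (u e)) ->
  exists rep : edge G -> R -> V -> R,
  (forall e p, edge_closed e p -> {ae mu, forall x, trace e p (u e) x = rep e p x}) /\
  {ae mu, forall x e, {within edge_closed e, continuous (fun y => rep e y x)} /\
     {ae leb, forall y, edge_open e y -> rep e y x = u e (x, y)}}.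
Proof.
move=> Hu; exists (fun e y => edge_trace e (s2val (edge_start e)) y (u e)); split.
  by move=> e p ep; exact (trace_edge_trace (s2valP (edge_start e)) (s2valP' (edge_start e)) ep (Hu e)).
apply: ae_forall_countable => e.
have := edge_trace_representation (s2valP (edge_start e)) (s2valP' (edge_start e)) (Hu e).
have sD := (H1_cyl_gradient (Hu e) (vertical_dirs R N)).1.
apply: filterS2 (sqintegrable_slice1 (m1 := mu) (m2 := leb) sD) => x sx [h1 h2]; split.
  apply: continuous_subspaceT; under eq_fun do rewrite h1.
  by move=> y; apply: cvgD; [exact: cvg_cst|exact: continuous_prim].
by apply: ae_mono h2 => y + Ey => /(_ Ey).
Qed.

Lemma edgewise_fiberwise u : H1_edgewise u -> H1_fiberwise u.
Proof.
move=> [L2u Hu H1u tru].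
have hor : (\esum_(e in [set: edge G]) horizontal_energy e (u e) < +oo)%E.
  by apply: le_lt_trans H1u; apply: le_esum => e _; exact: horizontal_energy_le.
have ver : (\esum_(e in [set: edge G]) vertical_energy e (u e) < +oo)%E.
  by apply: le_lt_trans H1u; apply: le_esum => e _; exact: vertical_energy_le.
split.
- by move=> e; apply: ae_mono (hslice (Hu e)) => y hy /hy[].
- by under eq_esum do rewrite (integral_hslice (Hu _)).
- have [rep [trE repE]] := continuous_representatives Hu.
  (* The trace condition holds almost everywhere for each pair of endpoints; indexing by edges and
     booleans puts all vertex conditions on one null set. *)
  have match_ (i : edge G * bool * (edge G * bool)) : {ae mu, forall x,
      (exists v, glued i.1.1 (endpoint i.1.1 i.1.2) v /\ glued i.2.1 (endpoint i.2.1 i.2.2) v) ->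
      rep i.1.1 (endpoint i.1.1 i.1.2) x = rep i.2.1 (endpoint i.2.1 i.2.2) x}.
    case: i => -[e1 b1] [e2 b2] /=.
    have [[v [g1 g2]]|nv] := pselect (exists v, glued e1 (endpoint e1 b1) v /\ glued e2 (endpoint e2 b2) v); last first.
      by apply: aeW => x /nv.
    have h1 := trE e1 _ (glued_endpoint g1).1; have h2 := trE e2 _ (glued_endpoint g2).1.
    by apply: filterS3 h1 h2 (tru _ _ _ _ _ g1 g2) => x -> -> ->.
  have finite_energy : {ae mu, forall x, (H1sq_graph (fun e y => u e (x, y)) < +oo)%E}.
    have := ae_lty (nu := mu) (graph_energy_ge0 u) (measurable_graph_energy Hu).
    rewrite integral_graph_energy// => /(_ ver).
    by apply: filterS2 (ae_H1sq_graph Hu) => x ->.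
  have H1x := ae_forall_countable (fun e => vslice (Hu e)).
  apply: filterS2 repE (filterI H1x (filterI finite_energy (ae_forall_countable match_))) => x hrep [hH1 [hfin hmatch]]; split.
  + by move=> e; have [] := hH1 e.
  + exact: hfin.
  + exists (fun e y => rep e y x); last by move=> e; have [] := hrep e.
    split=> [e|e1 e2 p1 p2 v g1 g2]; first by have [] := hrep e.
    have [_ [b1 E1]] := glued_endpoint g1; have [_ [b2 E2]] := glued_endpoint g2.
    by rewrite E1 E2; apply: (hmatch (e1, b1, (e2, b2))); exists v; rewrite -E1 -E2.
- by rewrite integral_H1sq_graph.
Qed.

End edgewise_fiberwise.

(** * From the fiberwise to the edgewise definition *)

Section fiberwise_edgewise.
Context (R : realType) (G : metric_graph R) (N : nat).
Local Notation leb := (@lebesgue_measure R : {sigma_finite_measure set (measurableTypeR R) -> \bar R}).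
Local Notation V := 'rV[R]_N.
Local Notation mu := (lebesgue_rV N : {sigma_finite_measure set V -> \bar R}).
Local Notation X := (V * measurableTypeR R)%type.
Local Notation P := (prod_measure mu leb).
Local Notation CV := (coord_space_rV R N).
Local Notation CX := (coord_space_cyl CV).
Local Notation CR := (coord_space_R R).
Implicit Types (f : X -> R) (u : edge G -> X -> R).

Lemma esum_ge_term (I : choiceType) (f : I -> \bar R) i : (forall j, 0 <= f j)%E ->
  (f i <= \esum_(j in [set: I]) f j)%E.
Proof.
move=> f0; rewrite -(esum_set1 (f0 i)) esum_mkcond; apply: le_esum => j _.
by case: ifP.
Qed.

Lemma measurable_cyl_closed (e : edge G) : measurable (cyl_closed (N := N) e).
Proof.
apply: measurableX => //.
rewrite (_ : edge_closed e = `[0, +oo[%classic `&` [set y : R | (y%:E <= len e)%E]).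
  apply: measurableI; first exact: measurable_itv.
  case: (len e) => [r| |].
  - rewrite (_ : mkset _ = `]-oo, r]%classic); first exact: measurable_itv.
    by apply/seteqP; split => y /=; rewrite in_itv/= lee_fin.
  - rewrite (_ : mkset _ = setT); first exact: measurableT.
    by apply/seteqP; split => y //= _; rewrite leey.
  - rewrite (_ : mkset _ = set0); first exact: measurable0.
    by apply/seteqP; split.
by apply/seteqP; split => y; rewrite /setI /= in_itv/= andbT.
Qed.

Section one_edge.
Variables (e : edge G) (f : X -> R) (mf : measurable_fun (cyl_closed e) f).
Local Notation U := (f \_ (cyl_open e)).
Local Notation Bh y := (H1sq mu (dirs_rV N) setT (fun x => f (x, y))).

Let mU : measurable_fun setT U.
Proof.
apply/(measurable_restrictT _ (coord_open_measurable CX (@open_cyl _ _ N e))).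
apply: measurable_funS mf; last by move=> x [_ [x0 xl]]; split => //; split; exact: ltW.
exact: measurable_cyl_closed.
Qed.

Hypothesis Hh : {ae leb, forall y, edge_open e y -> H1 mu (dirs_rV N) setT (fun x => f (x, y))}.
Hypothesis finh : (\int[leb]_(y in edge_open e) Bh y < +oo)%E.

Let B y : \bar R := ((fun y => Bh y) \_ (edge_open e)) y.

Let B0 y : (0 <= B y)%E.
Proof. by rewrite /B patchE; case: ifP => // _; exact: H1sq_ge0. Qed.

Let finB : (\int[leb]_y B y < +oo)%E.
Proof. by apply: le_lt_trans finh; rewrite [leRHS]integral_mkcond. Qed.

Let slice_on y : edge_open e y -> (fun x => U (x, y)) = (fun x => f (x, y)).
Proof. by move=> Ey; apply/funext => x; rewrite patch_on. Qed.

Lemma sqintegrable_of_fibers : sqintegrable P U.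
Proof.
split; first exact: mU.
have -> : sqint P U = (\int[leb]_y sqint mu (fun x => U (x, y)))%E := sqint_slice2 mu leb mU.
apply: le_lt_trans finB.
apply: ae_le_nnintegral => [y|//|]; first exact: sqint_ge0.
apply: aeW => y; have [Ey|Ey] := pselect (edge_open e y).
  rewrite /B patchE mem_set// slice_on//.
  by have := sqint_le_H1sq mu (dirs_rV N) setT (fun x => f (x, y)); rewrite patch_setT.
rewrite /B patchE memNset// /sqint integral0_eq// => x _.
by rewrite cyl_patch0 ?expr0n.
Qed.

Hypothesis Hv : {ae mu, forall x, H1 leb dirs_R (edge_open e) (fun y => f (x, y))}.
Hypothesis finv : (\int[mu]_x H1sq_edge e (fun y => f (x, y)) < +oo)%E.

(** [joint_weak_derivative] is applied once for each direction: horizontal ones on the slices of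
    constant height, the vertical one on the slices of constant [x]. The norm of the slice serves as
    the integrable bound. *)
Lemma H1_cyl_of_fibers : H1_cyl e f.
Proof.
have sU := sqintegrable_of_fibers.
apply/(H1_weakly CX _ (@open_cyl _ _ N e)); split => // v.
rewrite mem_cat inE => /orP[/mapP[w wd ->]|/eqP ->].
  have := joint_weak_derivative CX CV (S := slicing_h mu leb) (Omega := cyl_open e) (Omega1 := setT)
    (Omega2 := edge_open e) (v := w) (U := U) (B := B) (@open_cyl _ _ N e) openT _ _ _ sU B0 finB.
  apply => //.
  - by move=> y x; split => [[_ Ey]|[Ey _]].
  - apply: ae_mono Hh => y + Ey => /(_ Ey) H1f.
    have [sg wg] := gradientP CV openT H1f wd; exists (gradient mu setT w (fun x => f (x, y))).
    rewrite patch_setT in wg; rewrite slice_on//; split => //.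
    by rewrite /B patchE mem_set//; exact: gradient_le_H1sq.
have := joint_weak_derivative CX CR (S := slicing_v mu leb) (Omega := cyl_open e) (Omega1 := edge_open e)
  (Omega2 := setT) (v := (1 : R)) (U := U) (B := fun x => H1sq_edge e (fun y => f (x, y)))
  (@open_cyl _ _ N e) (@open_left_interval R (len e)) (@convex_left_interval R (len e)) _ _ sU _ finv.
apply => //.
- by move=> x [_].
- by move=> x; exact (H1sq_ge0 leb dirs_R (edge_open e) _).
- apply: filterS Hv => x H1f _.
  have d1 : (1 : R) \in dirs_R by rewrite mem_head.
  have [sg wg] := gradientP CR (@open_left_interval R (len e)) H1f d1.
  exists (gradient leb (edge_open e) (1 : R) (fun y => f (x, y))).
  have -> : (fun y => U (x, y)) = (fun y => f (x, y)) \_ (edge_open e) by apply/funext => y; exact: cyl_patchE.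
  by split => //; exact (gradient_le_H1sq leb _ _ d1).
Qed.

End one_edge.

Lemma fiberwise_edgewise u : (forall e, measurable_fun (cyl_closed e) (u e)) ->
  H1_fiberwise u -> H1_edgewise u.
Proof.
move=> mu_ [Hh finh Hv finv].
have h0 e : (0 <= \int[leb]_(y in edge_open e) H1sq mu (dirs_rV N) setT (fun x => u e (x, y)))%E.
  by apply: integral_ge0 => y _; exact: H1sq_ge0.
have v0 e x : (0 <= H1sq_edge e (fun y => u e (x, y)))%E.
  exact (H1sq_ge0 leb dirs_R (edge_open e) _).
have Hu e : H1_cyl e (u e).
  apply: (H1_cyl_of_fibers (mu_ e) (Hh e)).
  - exact: le_lt_trans (esum_ge_term e h0) finh.
  - by apply: filterS Hv => x [].
  - apply: le_lt_trans finv; apply: ae_le_nnintegral => [x|x|].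
    + exact: v0.
    + by apply: esum_ge0.
    + by apply: aeW => x; exact: (esum_ge_term e (fun e => v0 e x)).
have fin : (\esum_(e in [set: edge G]) H1sq_cyl e (u e) < +oo)%E.
  (* On an edge where [u e] is in H^1, the two energies are exactly the fiberwise integrals, whose
     sums over edges are finite by assumption. *)
  apply: (@le_lt_trans _ _ (\esum_(e in [set: edge G]) (horizontal_energy e (u e) + vertical_energy e (u e)))%E).
    by apply: le_esum => e _; exact: H1sq_cyl_le_energies.
  rewrite esumD; last 2 first.
  - by move=> e _; exact: horizontal_energy_ge0.
  - by move=> e _; exact: vertical_energy_ge0.
  rewrite -integral_H1sq_graph//; apply: lte_add_pinfty finv.
  by move: finh; under eq_esum do rewrite (integral_hslice (Hu _)).
split => //.
  apply: le_lt_trans fin; apply: le_esum => e _.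
  have -> : L2sq (lebesgue_prod N) (cyl_open e) (u e) = sqint P ((u e) \_ (cyl_open e)).
    exact (L2sqE P (cyl_open e) (u e)).
  exact (sqint_le_H1sq P (dirs_prod N) (cyl_open e) (u e)).
move=> e1 e2 p1 p2 v g1 g2; have [rep [trE repE]] := continuous_representatives Hu.
have c1 := (glued_endpoint g1).1; have c2 := (glued_endpoint g2).1.
apply: filterS3 Hv repE (filterI (trE _ _ c1) (trE _ _ c2)) => x [_ _ [wc [cwc wcE] wcu]] hrep [tr1 tr2].
rewrite tr1 tr2.
(* The traces are values of [rep], while the matching condition concerns the given representative
   [wc]. Both are continuous and agree almost everywhere inside the edge, hence also at its
   endpoints. *)
have repwc e p : edge_closed e p -> rep e p x = wc e p.
  have [crep repu] := hrep e.
  apply: (@ae_eq_left_closure R (len e) (fun y => rep e y x) (wc e) (len_gt0 e) crep (cwc e)).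
  by apply: (ae_mono2 _ repu (wcu e)) => y h1 h2 Ey; rewrite h1// h2.
by rewrite !repwc//; exact: wcE g1 g2.
Qed.

End fiberwise_edgewise.

Theorem proposition2p4 (R : realType) (G : metric_graph R) (N : nat)
    (hN : (1 <= N)%N) (hG : connected_graph G)
    (u : edge G -> 'rV[R]_N * measurableTypeR R -> R)
    (hu : forall e, measurable_fun (cyl_closed (N := N) e) (u e)) :
  H1_edgewise u <-> H1_fiberwise u.
Proof. by split; [exact: edgewise_fiberwise|exact: fiberwise_edgewise]. Qed.
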